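(* Let $r>1/2$ and let $T>0$ be fixed. Assume that the exact solution $w=w(x,t)$ of the quadratic nonlinear Schrödinger equation $$i\partial_t w=-\partial_x^2 w+\varepsilon w^2,\quad x\in\mathbb{T},\ t>0,\qquad w(x,0)=\phi(x),$$ with $\varepsilon\in(0,1]$, satisfies $w(t)\in H^{r+2}$ for $0\le t\le T/\varepsilon$. Let $w^n$ be given by the symmetric second-order low-regularity integrator $$\begin{aligned}w^{n+1}=\;&e^{i\tau\partial_x^2}w^n-i\varepsilon\tau\left(\hat w^n_0\,e^{i\tau\partial_x^2}w^n+\hat w^{n+1}_0\,w^{n+1}\right)+\frac{i\varepsilon\tau}{2}\left((\hat w^n_0)^2+(\hat w^{n+1}_0)^2\right)\\&+\frac{\varepsilon}{4}\Big[\left(e^{i\tau\partial_x^2}\partial_x^{-1}w^n\right)^2+\left(\partial_x^{-1}w^{n+1}\right)^2-e^{i\tau\partial_x^2}\Big(\left(\partial_x^{-1}w^n\right)^2+\left(e^{-i\tau\partial_x^2}\partial_x^{-1}w^{n+1}\right)^2\Big)\Big]\end{aligned}$$ with $w^0=\phi$. Then there exists a constant $\tau_0>0$ such that for $0<\tau\le\tau_0$, $$\|w(t_n)-w^n\|_r\lesssim\varepsilon\tau^2,\qquad 0\le n\le\frac{T/\varepsilon}{\tau}.$$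
   Context: $\mathbb{T}=(-\pi,\pi)$ is the one-dimensional torus, $\phi$ is a given complex-valued function, and $\|\cdot\|_r$ is the standard norm of the Sobolev space $H^r=H^r(\mathbb{T})$. $\tau$ is the time step and $t_n=n\tau$. The notation $A\lesssim B$ means that there is a generic constant $C>0$, independent of the time step $\tau$ and of $\varepsilon$, such that $|A|\le CB$. For $f\in L^2(\mathbb{T})$ write $f(x)=\sum_{l\in\mathbb{Z}}\hat f_l e^{ilx}$; $\hat f_0$ is the zeroth Fourier coefficient, and scalars such as $(\hat w^n_0)^2$ are regarded as constant functions. $e^{it\partial_x^2}$ is the Fourier multiplier with symbol $e^{-itl^2}$, and $\partial_x^{-1}f(x)=\sum_{l\in\mathbb{Z}\setminus\{0\}}\frac{1}{il}\hat f_l e^{ilx}$.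
   Formalization: The implicit scheme has spurious solutions (e.g. w^1=2i/(ετ) for φ=0), so w^n is required to satisfy ‖w^n‖_r≤K for a fixed K>M, existence of such w^n being proved; w(t) is assumed bounded by a common M in H^{r+2} on [0,T/ε], on which τ_0 and the constant may depend. *)

(* Defs.v *)
(* MathComp-Analysis, with R[i] from mathcomp-real-closed as the complex field. *)
From HB Require Import structures.
From mathcomp Require Import all_boot all_order all_algebra.
From mathcomp Require Import all_classical all_reals all_analysis.
From mathcomp Require Import complex.

Set Implicit Arguments.
Unset Strict Implicit.
Unset Printing Implicit Defensive.

Import Order.TTheory GRing.Theory Num.Theory.
Import numFieldNormedType.Exports.

Local Open Scope classical_set_scope.
Local Open Scope ring_scope.
Local Open Scope complex_scope.

(* A function on the torus is a 2pi-periodic function R -> R[i].  R[i] is not a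
   normed module over R in the library, so limits, derivatives and integrals of
   complex-valued functions are taken on real and imaginary parts. *)
Section Torus.
Variable R : realType.
Implicit Types (f g : R -> R[i]) (l : int) (r t x : R).

Definition torus : set R := `]- pi, pi[.

Definition periodic2pi f : Prop := forall x, f (x + 2 * pi) = f x.

Definition normsq (z : R[i]) : R := complex.Re z ^+ 2 + complex.Im z ^+ 2.

(* e^{i x} *)
Definition cis x : R[i] := cos x +i* sin x.

Definition torus_integral f : R[i] :=
  (\int[lebesgue_measure]_(x in torus) complex.Re (f x)) +i*
  (\int[lebesgue_measure]_(x in torus) complex.Im (f x)).

Definition fourier_coef f l : R[i] :=
  (2 * pi)^-1%:C * torus_integral (fun x => f x * cis (- (l%:~R * x))).

Definition L2 f : Prop :=
  [/\ measurable_fun torus (fun x => complex.Re (f x)),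
      measurable_fun torus (fun x => complex.Im (f x)) &
      lebesgue_measure.-integrable torus (fun x => (normsq (f x))%:E)].

Definition sobolev_norm r f : \bar R :=
  ((\esum_(l in [set: int])
     ((1 + l%:~R ^+ 2) `^ r * normsq (fourier_coef f l))%:E) `^ 2^-1)%E.

Definition sobolev r f : Prop :=
  [/\ periodic2pi f, L2 f & (sobolev_norm r f < +oo)%E].

(* sum over l in Z, as the limit of the sums over |l| <= N *)
Definition zsum (a : int -> R) : R :=
  limn (fun N : nat => \sum_(k < N.*2.+1) a (k%:Z - N%:Z)).

Definition fourier_series (c : int -> R[i]) : R -> R[i] := fun x =>
  zsum (fun l => complex.Re (c l * cis (l%:~R * x))) +i*
  zsum (fun l => complex.Im (c l * cis (l%:~R * x))).

Definition fourier_multiplier (m : int -> R[i]) f : R -> R[i] :=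
  fourier_series (fun l => m l * fourier_coef f l).

(* e^{i t d_x^2} *)
Definition schrodinger t : (R -> R[i]) -> (R -> R[i]) :=
  fourier_multiplier (fun l => cis (- (t * l%:~R ^+ 2))).

(* d_x^{-1} *)
Definition dx_inv : (R -> R[i]) -> (R -> R[i]) :=
  fourier_multiplier (fun l => if l == 0 then 0 else ('i * l%:~R)^-1).

Definition cderivable f x : Prop :=
  derivable (fun y => complex.Re (f y)) x 1 /\
  derivable (fun y => complex.Im (f y)) x 1.

Definition cderive f : R -> R[i] := fun x =>
  derive1 (fun y => complex.Re (f y)) x +i* derive1 (fun y => complex.Im (f y)) x.

Definition ccontinuous_on (A : set R) f : Prop :=
  {within A, continuous (fun t => complex.Re (f t))} /\
  {within A, continuous (fun t => complex.Im (f t))}.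

(* Solution w t x of i w_t = - w_xx + eps w^2 on 0 <= t <= S with w 0 = phi.
   An H^{r+2} function with r > 1/2 has a C^2 representative, hence the
   equation is required pointwise. *)
Definition qnls_solution (eps S : R) (phi : R -> R[i]) (w : R -> R -> R[i]) :
    Prop :=
  [/\ forall x, w 0 x = phi x,
      forall x, ccontinuous_on `[0, S] (fun t => w t x) &
      forall t x, 0 < t < S ->
        [/\ cderivable (fun s => w s x) t,
            cderivable (w t) x,
            cderivable (cderive (w t)) x &
            'i * cderive (fun s => w s x) t =
              - cderive (cderive (w t)) x + eps%:C * w t x ^+ 2]].

(* One step u |-> v of the integrator, as an (implicit) relation.  Elements of
   H^r are classes modulo null sets, hence the almost-everywhere equality. *)
Definition slri_step (eps tau : R) (u v : R -> R[i]) : Prop :=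
  let E := schrodinger tau in
  let Em := schrodinger (- tau) in
  let u0 := fourier_coef u 0 in
  let v0 := fourier_coef v 0 in
  {ae lebesgue_measure, forall x : R,
    v x = E u x
      - 'i * (eps * tau)%:C * (u0 * E u x + v0 * v x)
      + 'i * (eps * tau / 2)%:C * (u0 ^+ 2 + v0 ^+ 2)
      + (eps / 4)%:C *
          (E (dx_inv u) x ^+ 2 + dx_inv v x ^+ 2
           - E (fun y => dx_inv u y ^+ 2 + Em (dx_inv v) y ^+ 2) x)}.

(* Numerical solution in H^r up to time S, staying in the H^r-ball of radius K.
   A step is a quadratic equation for the new value and also has spurious
   solutions, of size 1/(eps tau); the bound K singles out the relevant branch. *)
Definition slri_solution (eps tau S r K : R) (phi : R -> R[i])
    (W : nat -> R -> R[i]) : Prop :=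
  [/\ W 0%N = phi,
      forall n : nat, n%:R * tau <= S ->
        sobolev r (W n) /\ (sobolev_norm r (W n) <= K%:E)%E &
      forall n : nat, n.+1%:R * tau <= S -> slri_step eps tau (W n) (W n.+1)].

End Torus.

(* Main.v *)
Require Import Defs.
From mathcomp Require Import all_boot all_order all_algebra.
From mathcomp Require Import all_classical all_reals all_analysis.
From mathcomp Require Import measurable_realfun complex.
From mathcomp Require Import zify ring lra.

Import Order.TTheory GRing.Theory Num.Theory.
Import numFieldNormedType.Exports.

Local Open Scope classical_set_scope.
Local Open Scope ring_scope.
Local Open Scope complex_scope.

Local Set Implicit Arguments.
Local Unset Strict Implicit.

(** In the rotating frame [v_l(s) = exp(i s l^2) w_l(t_n + s)] of the linear
    flow, the Fourier coefficients of the solution satisfy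
      [v_l' = - i eps sum_(j + m = l) exp(2 i s j m) v_j v_m],
    because [l^2 - j^2 - m^2 = 2 j m].  The unknown [v] therefore moves at a
    rate of order [eps], and only the explicit phases oscillate fast.  Seen in
    this frame, a step of the integrator from [a] to [b] is
      [b_l = a_l - (i eps / 2) sum_(j + m = l)
               (int_0^tau exp(2 i s j m) ds) (a_j a_m + b_j b_m)]:
    the phases are integrated exactly, and the slow products [v_j v_m] are
    replaced by the mean of their values at both ends of the step.  The
    operators [dx^-1] of the scheme come from evaluating the integral: it is
    [(exp(2 i tau j m) - 1) / (2 i j m)] when [j m <> 0], and the pairs with
    [j m = 0] produce the terms with the zeroth coefficient ([step_coefP]).

    Local error.  The products [v_j v_m] have a rate of order [eps] which varies
    by [O(eps tau)] over a step, and the phases differ from constants by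
    [O(tau j m)].  Hence their first-order terms cancel in the trapezoidal rule,
    the defect is of size [eps^2 tau^3] in [H^r], and the factor [j m] costs one
    derivative of each argument ([local_error]).  The estimates rest on [H^r]
    being a convolution algebra on the Fourier side for [r > 1/2] ([hb_zconv]).

    Global error.  The quadratic terms carry the factor [eps tau], so the
    implicit relation is solvable in the ball of radius [K] by Picard iteration
    ([step_exists]), and errors are amplified by [1 + O(eps tau)] per step
    ([stability]).  Over [T / (eps tau)] steps the local errors sum up to
    [O(eps tau^2)] ([gronwall_bound_le]).  Conversely, this bound keeps the
    numerical values close enough to the exact ones for the next step to be
    solvable in the same ball, which gives the existence of the numerical
    solution ([solution_exists]).

    Passing between functions and coefficients uses the inversion of Fourier
    series at a point where the function is Lipschitz ([fourier_inversion]).  It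
    identifies products of series with convolutions ([fourier_series_mul]) and
    the solution with its Fourier series ([w_series]); the equation then bounds
    the time derivative of the solution, and the coefficients are differentiated
    under the integral sign ([w_coef_derive]). *)

(** * Moduli, characters and the mean value inequality *)

Section Modulus.
Variable R : realType.
Implicit Types (z w : R[i]) (x y : R).

(** A real-valued modulus: the norm of [R[i]] takes its values in [R[i]]. *)
Definition cmod z : R := Num.sqrt (normsq z).

Lemma normsq_ge0 z : 0 <= normsq z.
Proof. by rewrite addr_ge0 ?sqr_ge0. Qed.

Lemma sqr_cmod z : cmod z ^+ 2 = normsq z.
Proof. by rewrite sqr_sqrtr ?normsq_ge0. Qed.

Lemma cmod_ge0 z : 0 <= cmod z.
Proof. exact: sqrtr_ge0. Qed.

Lemma cmodE z : (cmod z)%:C = `|z|.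
Proof. by rewrite normc_def. Qed.

Lemma cmod0 : cmod 0 = 0.
Proof. by apply: complexI; rewrite cmodE normr0. Qed.

Lemma cmodM z w : cmod (z * w) = cmod z * cmod w.
Proof. by apply: complexI; rewrite rmorphM/= !cmodE normrM. Qed.

Lemma cmodD z w : cmod (z + w) <= cmod z + cmod w.
Proof. by rewrite -lecR rmorphD/= !cmodE ler_normD. Qed.

Lemma cmodN z : cmod (- z) = cmod z.
Proof. by apply: complexI; rewrite !cmodE normrN. Qed.

Lemma cmodJ z : cmod z^*%C = cmod z.
Proof. by case: z => a b; rewrite /cmod /normsq/= sqrrN. Qed.

Lemma cmodB z w : cmod (z - w) <= cmod z + cmod w.
Proof. by rewrite -(cmodN w) cmodD. Qed.

Lemma cmod_distC z w : cmod (z - w) = cmod (w - z).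
Proof. by rewrite -opprB cmodN. Qed.

Lemma cmodR x : cmod x%:C = `|x|.
Proof. by rewrite /cmod /normsq /= expr0n addr0 sqrtr_sqr. Qed.

Lemma cmod1 : cmod 1 = 1.
Proof. by rewrite (cmodR 1) normr1. Qed.

Lemma cmodi : cmod 'i = 1.
Proof. by rewrite /cmod /normsq/= expr0n expr1n add0r sqrtr1. Qed.

Lemma cmodV z : cmod z^-1 = (cmod z)^-1.
Proof. by apply: complexI; rewrite fmorphV/= !cmodE normfV. Qed.

Lemma cmod_eq0 z : cmod z = 0 -> z = 0.
Proof. by move=> h; apply/eqP; rewrite -normr_eq0 -cmodE h. Qed.

Lemma intC (l : int) : (l%:~R : R[i]) = (l%:~R : R)%:C.
Proof. by rewrite rmorph_int. Qed.

Lemma cmod_int (l : int) : cmod l%:~R = `|l%:~R|.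
Proof. by rewrite intC cmodR. Qed.

Lemma normr_Re z : `|complex.Re z| <= cmod z.
Proof. by rewrite -sqrtr_sqr ler_wsqrtr // lerDl sqr_ge0. Qed.

Lemma normr_Im z : `|complex.Im z| <= cmod z.
Proof. by rewrite -sqrtr_sqr ler_wsqrtr // lerDr sqr_ge0. Qed.

Lemma cmod_le_ReIm z : cmod z <= `|complex.Re z| + `|complex.Im z|.
Proof.
case: z => a b /=.
have -> : a +i* b = a%:C + 'i * b%:C by rewrite [LHS]complexE.
by rewrite (le_trans (cmodD _ _))// cmodM cmodi mul1r !cmodR.
Qed.

Lemma cmod_sum (I : Type) (s : seq I) (F : I -> R[i]) :
  cmod (\sum_(i <- s) F i) <= \sum_(i <- s) cmod (F i).
Proof.
elim: s => [|i s IH]; first by rewrite !big_nil cmod0.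
by rewrite !big_cons (le_trans (cmodD _ _))// lerD2l.
Qed.

Lemma Re_sum (I : Type) (s : seq I) (F : I -> R[i]) :
  complex.Re (\sum_(i <- s) F i) = \sum_(i <- s) complex.Re (F i).
Proof.
elim: s => [|i s IH]; first by rewrite !big_nil.
by rewrite !big_cons -IH; case: (F i) (bigop _ _ _) => [a b] [].
Qed.

Lemma Im_sum (I : Type) (s : seq I) (F : I -> R[i]) :
  complex.Im (\sum_(i <- s) F i) = \sum_(i <- s) complex.Im (F i).
Proof.
elim: s => [|i s IH]; first by rewrite !big_nil.
by rewrite !big_cons -IH; case: (F i) (bigop _ _ _) => [a b] [].
Qed.

Lemma cReD z w : complex.Re (z + w) = complex.Re z + complex.Re w.
Proof. by case: z w => [a b] []. Qed.

Lemma cImD z w : complex.Im (z + w) = complex.Im z + complex.Im w.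
Proof. by case: z w => [a b] []. Qed.

Lemma cReB z w : complex.Re (z - w) = complex.Re z - complex.Re w.
Proof. by case: z w => [a b] []. Qed.

Lemma cImB z w : complex.Im (z - w) = complex.Im z - complex.Im w.
Proof. by case: z w => [a b] []. Qed.

Lemma cReM z w : complex.Re (z * w) =
  complex.Re z * complex.Re w - complex.Im z * complex.Im w.
Proof. by case: z w => [a b] []. Qed.

Lemma cImM z w : complex.Im (z * w) =
  complex.Re z * complex.Im w + complex.Im z * complex.Re w.
Proof. by case: z w => [a b] []. Qed.

Lemma complex_ext z w :
  complex.Re z = complex.Re w -> complex.Im z = complex.Im w -> z = w.
Proof. by case: z w => [a b] [c d] /= -> ->. Qed.

End Modulus.

Local Notation "|: a :|" := (fun l => cmod (a l)) (at level 0, a at level 99).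

Section Cis.
Variable R : realType.
Implicit Types (x y h t : R).

Lemma cisD x y : cis (x + y) = cis x * cis y.
Proof. by apply: complex_ext; rewrite ?cReM ?cImM /= ?cosD ?sinD//; ring. Qed.

Lemma cis0 : cis (0 : R) = 1.
Proof. by apply: complex_ext; rewrite /= ?cos0 ?sin0. Qed.

Lemma cmod_cis x : cmod (cis x) = 1.
Proof. by rewrite /cmod /normsq /= cos2Dsin2 sqrtr1. Qed.

Lemma cisNK x : cis (- x) * cis x = 1.
Proof. by rewrite -cisD addNr cis0. Qed.

Lemma cisKN x : cis x * cis (- x) = 1.
Proof. by rewrite mulrC cisNK. Qed.

End Cis.

Lemma ler_of_sqr (R : realDomainType) (x y : R) :
  0 <= y -> x ^+ 2 <= y ^+ 2 -> x <= y.
Proof.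
move=> y0 h; rewrite (le_trans (ler_norm _))// -(@ler_pXn2r _ 2) ?nnegrE//.
by rewrite real_normK ?num_real.
Qed.

Section FiniteSums.
Variables (R : realType) (I : eqType).
Implicit Types (s : seq I) (x y : I -> R).

Lemma sumr_seq_ge0 s x : (forall i, 0 <= x i) -> 0 <= \sum_(i <- s) x i.
Proof. by move=> h; apply: sumr_ge0. Qed.

Lemma cauchy_schwarz_seq s x y :
  (\sum_(i <- s) x i * y i) ^+ 2 <=
  (\sum_(i <- s) x i ^+ 2) * (\sum_(i <- s) y i ^+ 2).
Proof.
elim: s => [|i s IH]; first by rewrite !big_nil mulr0 expr0n.
rewrite !big_cons.
have X0 : 0 <= \sum_(i <- s) x i ^+ 2 by apply: sumr_seq_ge0 => j; exact: sqr_ge0.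
have Y0 : 0 <= \sum_(i <- s) y i ^+ 2 by apply: sumr_seq_ge0 => j; exact: sqr_ge0.
move: IH X0 Y0; move: (\sum_(j <- s) x j ^+ 2) (\sum_(j <- s) y j ^+ 2) => X Y.
move: (\sum_(j <- s) x j * y j) (x i) (y i) => P a b PXY X0 Y0.
have : 2 * (P * (a * b)) <= X * b ^+ 2 + Y * a ^+ 2.
  apply: ler_of_sqr; first by rewrite addr_ge0 // mulr_ge0 // sqr_ge0.
  have : 0 <= (X * b ^+ 2 - Y * a ^+ 2) ^+ 2 by exact: sqr_ge0.
  have : P ^+ 2 * (a * b) ^+ 2 <= X * Y * (a * b) ^+ 2.
    by rewrite ler_wpM2r// sqr_ge0.
  by nra.
by nra.
Qed.

(** The triangle inequality of a Euclidean norm, in the squared form used for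
    the truncated Sobolev norms. *)
Lemma minkowski_seq s x y A B : 0 <= A -> 0 <= B ->
  \sum_(i <- s) x i ^+ 2 <= A ^+ 2 -> \sum_(i <- s) y i ^+ 2 <= B ^+ 2 ->
  \sum_(i <- s) (x i + y i) ^+ 2 <= (A + B) ^+ 2.
Proof.
move=> A0 B0 hx hy.
have -> : \sum_(i <- s) (x i + y i) ^+ 2 = \sum_(i <- s) x i ^+ 2 +
    \sum_(i <- s) y i ^+ 2 + 2 * \sum_(i <- s) x i * y i.
  by rewrite mulr_sumr -!big_split; apply: eq_bigr => i _ /=; ring.
suff : \sum_(i <- s) x i * y i <= A * B by lra.
apply: ler_of_sqr; first exact: mulr_ge0.
rewrite (le_trans (cauchy_schwarz_seq _ _ _))// exprMn.
by apply: ler_pM => //; apply: sumr_seq_ge0 => i; exact: sqr_ge0.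
Qed.

End FiniteSums.

Section ComplexDerivative.
Variable R : realType.
Implicit Types (f g : R -> R[i]) (t a b : R) (d : R[i]).

Definition is_cderive f t d : Prop :=
  is_derive t 1 (fun x => complex.Re (f x)) (complex.Re d) /\
  is_derive t 1 (fun x => complex.Im (f x)) (complex.Im d).

Lemma is_deriveM_scalar (u v : R -> R) t du dv :
  is_derive t 1 u du -> is_derive t 1 v dv ->
  is_derive t 1 (fun x => u x * v x) (u t * dv + v t * du).
Proof. by move=> hu hv; exact: is_deriveM. Qed.

Lemma is_cderiveM f g t df dg : is_cderive f t df -> is_cderive g t dg ->
  is_cderive (fun x => f x * g x) t (f t * dg + df * g t).
Proof.
move=> [hf1 hf2] [hg1 hg2]; split.
- have h := is_deriveB (is_deriveM_scalar hf1 hg1) (is_deriveM_scalar hf2 hg2).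
  apply: (is_derive_eq (f := fun x => complex.Re (f x * g x)) (v := 1)).
    by under eq_fun do rewrite cReM; exact: h.
  by rewrite cReD !cReM; ring.
- have h := is_deriveD (is_deriveM_scalar hf1 hg2) (is_deriveM_scalar hf2 hg1).
  apply: (is_derive_eq (f := fun x => complex.Im (f x * g x)) (v := 1)).
    by under eq_fun do rewrite cImM; exact: h.
  by rewrite cImD !cImM; ring.
Qed.

Lemma is_cderiveB f g t df dg : is_cderive f t df -> is_cderive g t dg ->
  is_cderive (fun x => f x - g x) t (df - dg).
Proof.
move=> [hf1 hf2] [hg1 hg2]; split.
- under eq_fun do rewrite cReB; rewrite cReB; exact: is_deriveB.
- under eq_fun do rewrite cImB; rewrite cImB; exact: is_deriveB.
Qed.

Lemma is_cderive_cst (z : R[i]) t : is_cderive (fun=> z) t 0.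
Proof. by split; exact: is_derive_cst. Qed.

Lemma is_cderive_id_scale (z : R[i]) t : is_cderive (fun x => x%:C * z) t z.
Proof.
split.
- under eq_fun do rewrite cReM/= mul0r subr0.
  have := is_deriveM_scalar (is_derive_id t 1) (is_derive_cst (complex.Re z) t 1).
  by rewrite /cst/= mulr0 add0r mulr1.
- under eq_fun do rewrite cImM/= mul0r addr0.
  have := is_deriveM_scalar (is_derive_id t 1) (is_derive_cst (complex.Im z) t 1).
  by rewrite /cst/= mulr0 add0r mulr1.
Qed.

Lemma is_cderive_cis (c : R) t :
  is_cderive (fun x => cis (x * c)) t ('i * c%:C * cis (t * c)).
Proof.
have hc : is_derive t 1 (fun x : R => x * c) c.
  have := is_deriveM_scalar (is_derive_id t 1) (is_derive_cst c t 1).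
  by rewrite /cst/= mulr0 add0r mulr1.
have h1 := @is_derive1_comp R cos (fun x => x * c) t _ _ (is_derive_cos _) hc.
have h2 := @is_derive1_comp R sin (fun x => x * c) t _ _ (is_derive_sin _) hc.
split; [apply: (is_derive_eq h1)|apply: (is_derive_eq h2)].
- by rewrite /=; ring.
- by rewrite /=; ring.
Qed.

Lemma is_cderive_continuous f t d : is_cderive f t d ->
  {for t, continuous (fun x => complex.Re (f x))} /\
  {for t, continuous (fun x => complex.Im (f x))}.
Proof.
by move=> [[h1 _] [h2 _]]; split; apply: differentiable_continuous;
  apply/derivable1_diffP.
Qed.

End ComplexDerivative.

Section MeanValue.
Variables (R : realType) (I : eqType).

Lemma is_derive_sum_seq (s : seq I) (u du : I -> R -> R) (t : R) :
  (forall i, is_derive t 1 (u i) (du i t)) ->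
  is_derive t 1 (fun x => \sum_(i <- s) u i x) (\sum_(i <- s) du i t).
Proof.
move=> h; elim: s => [|i s IH].
  under eq_fun do rewrite big_nil; rewrite big_nil; exact: is_derive_cst.
under eq_fun do rewrite big_cons; rewrite big_cons; exact: is_deriveD.
Qed.

Lemma within_continuous_sum_seq (A : set R) (s : seq I) (u : I -> R -> R) :
  (forall i, {within A, continuous (u i)}) ->
  {within A, continuous (fun x => \sum_(i <- s) u i x)}.
Proof.
move=> h; elim: s => [|i s IH].
  under eq_fun do rewrite big_nil; move=> x; exact: cvg_cst.
under eq_fun do rewrite big_cons; move=> x; apply: cvgD; [exact: h|exact: IH].
Qed.

(** Testing the increment of [f] against itself reduces the vector-valued
    inequality to the scalar mean value theorem. *)
Lemma mean_value_seq (s : seq I) (p : I -> R) (f g : R -> I -> R[i])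
    (a b B : R) : a <= b -> 0 <= B -> (forall i, 0 <= p i) ->
  (forall i, ccontinuous_on `[a, b] (f^~ i)) ->
  (forall t i, a < t < b -> is_cderive (f^~ i) t (g t i)) ->
  (forall t, a < t < b -> \sum_(i <- s) p i * normsq (g t i) <= B ^+ 2) ->
  \sum_(i <- s) p i * normsq (f b i - f a i) <= (B * (b - a)) ^+ 2.
Proof.
move=> ab B0 p0 cf df hB.
have [<-|nab] := eqVneq a b.
  rewrite big1 ?sqr_ge0// => i _.
  by rewrite subrr /normsq/= expr0n/= addr0 mulr0.
have {}ab : a < b by rewrite lt_neqAle nab ab.
(* [psi] is the inner product of [f] with the fixed increment [D]. *)
pose D i := f b i - f a i.
pose psi i x := p i * (complex.Re (D i) * complex.Re (f x i) +
                       complex.Im (D i) * complex.Im (f x i)).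
pose dpsi i x := p i * (complex.Re (D i) * complex.Re (g x i) +
                        complex.Im (D i) * complex.Im (g x i)).
have cpsi : {within `[a, b], continuous (fun x => \sum_(i <- s) psi i x)}.
  apply: within_continuous_sum_seq => i x; have [c1 c2] := cf i.
  apply: cvgM; first exact: cvg_cst.
  by apply: cvgD; apply: cvgM; try exact: cvg_cst; [exact: c1|exact: c2].
have dpsiP x : x \in `]a, b[ ->
    is_derive x 1 (fun x => \sum_(i <- s) psi i x) (\sum_(i <- s) dpsi i x).
  rewrite in_itv => /= axb; apply: is_derive_sum_seq => i.
  have [h1 h2] := df _ i axb.
  have k1 := is_deriveM_scalar (is_derive_cst (complex.Re (D i)) x 1) h1.
  have k2 := is_deriveM_scalar (is_derive_cst (complex.Im (D i)) x 1) h2.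
  have k := is_deriveM_scalar (is_derive_cst (p i) x 1) (is_deriveD k1 k2).
  apply: (is_derive_eq k).
  by rewrite /dpsi /cst/=; ring.
have [c cab] := MVT ab dpsiP cpsi.
set N := \sum_(i <- s) p i * normsq (f b i - f a i).
have N0 : 0 <= N.
  by apply: sumr_seq_ge0 => i; rewrite mulr_ge0 ?normsq_ge0.
have -> : \sum_(i <- s) psi i b - \sum_(i <- s) psi i a = N.
  rewrite -sumrB; apply: eq_bigr => i _.
  by rewrite /psi /D /normsq cReB cImB; ring.
have hc : \sum_(i <- s) dpsi i c <= Num.sqrt N * B.
  apply: ler_of_sqr; first by rewrite mulr_ge0 ?sqrtr_ge0.
  rewrite exprMn sqr_sqrtr//.
  pose X (j : bool * I) := Num.sqrt (p j.2) *
    (if j.1 then complex.Re (D j.2) else complex.Im (D j.2)).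
  pose Y (j : bool * I) := Num.sqrt (p j.2) *
    (if j.1 then complex.Re (g c j.2) else complex.Im (g c j.2)).
  pose S := [seq (true, i) | i <- s] ++ [seq (false, i) | i <- s].
  have := cauchy_schwarz_seq S X Y.
  rewrite /S !big_cat !big_map /= -!big_split /=.
  have -> : \sum_(i <- s) (X (true, i) * Y (true, i) + X (false, i) * Y (false, i))
     = \sum_(i <- s) dpsi i c.
    apply: eq_bigr => i _; rewrite /X /Y /dpsi/=.
    rewrite -[p i in RHS]sqr_sqrtr//; ring.
  have -> : \sum_(i <- s) (X (true, i) ^+ 2 + X (false, i) ^+ 2) = N.
    by apply: eq_bigr => i _; rewrite /X /= !exprMn sqr_sqrtr// -mulrDr.
  have -> : \sum_(i <- s) (Y (true, i) ^+ 2 + Y (false, i) ^+ 2) =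
            \sum_(i <- s) p i * normsq (g c i).
    by apply: eq_bigr => i _; rewrite /Y /= !exprMn sqr_sqrtr// -mulrDr.
  move=> /le_trans; apply; rewrite ler_wpM2l//; apply: hB.
  by move: cab; rewrite in_itv.
move=> hN.
have ba0 : 0 <= b - a by rewrite subr_ge0 ltW.
have : N <= Num.sqrt N * (B * (b - a)) by rewrite {1}hN mulrA ler_wpM2r.
rewrite -{1}(sqr_sqrtr N0) expr2.
have [s0|sN0] := eqVneq (Num.sqrt N) 0.
  by move=> _; rewrite -(sqr_sqrtr N0) s0 expr0n sqr_ge0.
have sN : 0 < Num.sqrt N by rewrite lt_neqAle eq_sym sN0 sqrtr_ge0.
rewrite ler_pM2l// => h.
by rewrite -(sqr_sqrtr N0) ler_pXn2r ?nnegrE ?mulr_ge0 ?sqrtr_ge0.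
Qed.

End MeanValue.

Section MeanValueComplex.
Variable R : realType.
Implicit Types (f g : R -> R[i]).

Lemma mean_value_complex f g (a b B : R) : a <= b -> 0 <= B ->
  ccontinuous_on `[a, b] f ->
  (forall t, a < t < b -> is_cderive f t (g t)) ->
  (forall t, a < t < b -> cmod (g t) <= B) ->
  cmod (f b - f a) <= B * (b - a).
Proof.
move=> ab B0 cf df gB; have ba : 0 <= b - a by rewrite subr_ge0.
have := @mean_value_seq R _ [:: tt] (fun=> 1) (fun t _ => f t) (fun t _ => g t)
  a b B ab B0.
rewrite big_seq1 mul1r -sqr_cmod => h; apply: ler_of_sqr; first exact: mulr_ge0.
apply: h => //; first by move=> t _; exact: df.
move=> t atb; rewrite big_seq1 mul1r -sqr_cmod.
by rewrite ler_pXn2r ?nnegrE ?cmod_ge0 ?gB.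
Qed.

Lemma ccontinuous_is_cderive (A : set R) f g :
  (forall t, is_cderive f t (g t)) -> ccontinuous_on A f.
Proof.
move=> df; split; apply: continuous_subspaceT => t;
  by have [] := is_cderive_continuous (df t).
Qed.

Lemma ccontinuous_onB (A : set R) f g :
  ccontinuous_on A f -> ccontinuous_on A g -> ccontinuous_on A (fun x => f x - g x).
Proof.
move=> [f1 f2] [g1 g2]; split.
- have -> : (fun x => complex.Re (f x - g x)) =
    (fun x => complex.Re (f x) - complex.Re (g x)).
    by apply/funext => x; rewrite cReB.
  by move=> x; apply: cvgB; [exact: f1|exact: g1].
- have -> : (fun x => complex.Im (f x - g x)) =
    (fun x => complex.Im (f x) - complex.Im (g x)).
    by apply/funext => x; rewrite cImB.
  by move=> x; apply: cvgB; [exact: f2|exact: g2].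
Qed.

Lemma ccontinuous_onM (A : set R) f g :
  ccontinuous_on A f -> ccontinuous_on A g -> ccontinuous_on A (fun x => f x * g x).
Proof.
move=> [f1 f2] [g1 g2]; split.
- have -> : (fun x => complex.Re (f x * g x)) =
    (fun x => complex.Re (f x) * complex.Re (g x) - complex.Im (f x) * complex.Im (g x)).
    by apply/funext => x; rewrite cReM.
  by move=> x; apply: cvgB; apply: cvgM;
    [exact: f1|exact: g1|exact: f2|exact: g2].
- have -> : (fun x => complex.Im (f x * g x)) =
    (fun x => complex.Re (f x) * complex.Im (g x) + complex.Im (f x) * complex.Re (g x)).
    by apply/funext => x; rewrite cImM.
  by move=> x; apply: cvgD; apply: cvgM;
    [exact: f1|exact: g2|exact: f2|exact: g1].
Qed.

Lemma cmod_cisB1 (y : R) : cmod (cis y - 1) <= `|y|.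
Proof.
wlog y0 : y / 0 <= y => [hw|].
  have [/hw//|/ltW y0] := leP 0 y.
  have := hw (- y); rewrite oppr_ge0 normrN => /(_ y0).
  suff -> : cis (- y) - 1 = cis (- y) * (1 - cis y).
    by rewrite cmodM cmod_cis mul1r cmod_distC.
  by rewrite mulrBr mulr1 cisNK.
have := @mean_value_complex (fun x => cis (x * 1)) _ 0 y 1 y0 ler01
  (ccontinuous_is_cderive _ (is_cderive_cis 1)) (fun t _ => is_cderive_cis 1 t).
rewrite mul0r mulr1 cis0 mul1r subr0 ger0_norm//; apply => t _.
by rewrite !cmodM cmodi cmod_cis cmodR normr1 !mulr1.
Qed.

Lemma cmod_cisB (x y : R) : cmod (cis x - cis y) <= `|x - y|.
Proof.
have -> : cis x - cis y = cis y * (cis (x - y) - 1).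
  by rewrite mulrBr mulr1 -cisD (addrC y) subrK.
by rewrite cmodM cmod_cis mul1r cmod_cisB1.
Qed.

Lemma cmod_cisB1_lin (y : R) : cmod (cis y - 1 - 'i * y%:C) <= y ^+ 2.
Proof.
wlog y0 : y / 0 <= y => [hw|].
  have [/hw//|/ltW y0] := leP 0 y.
  have := hw (- y); rewrite oppr_ge0 sqrrN => /(_ y0).
  suff -> : cis y - 1 - 'i * y%:C = (cis (- y) - 1 - 'i * (- y)%:C)^*%C.
    by rewrite cmodJ.
  by apply: complex_ext; rewrite /= ?cosN ?sinN; ring.
have d (t : R) := is_cderiveB (is_cderive_cis 1 t) (is_cderive_id_scale 'i t).
have := @mean_value_complex (fun x => cis (x * 1) - x%:C * 'i) _ 0 y y y0 y0
  (ccontinuous_is_cderive _ d) (fun t _ => d t).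
rewrite mul0r mulr1 cis0 (_ : 0%:C * 'i%C = 0) ?mul0r// !subr0 -expr2.
have -> : cis y - y%:C * 'i - 1 = cis y - 1 - 'i * y%:C by ring.
apply => t /andP[t0 ty].
rewrite !mulr1 -[X in _ - X]mulr1 -mulrBr cmodM cmodi mul1r.
by rewrite (le_trans (cmod_cisB1 _))// ger0_norm ltW.
Qed.

End MeanValueComplex.

(** * Sums over the integers *)

Section IntegerSums.
Variable R : realType.
Implicit Types (a b : int -> R[i]) (al be : int -> R) (q : seq int) (A B : R) (u v : nat -> R[i]) (z w c : R[i]).

Lemma sum_subset_le (al : int -> R) (q q' : seq int) : (forall l, 0 <= al l) ->
  uniq q -> uniq q' -> {subset q <= q'} ->
  \sum_(l <- q) al l <= \sum_(l <- q') al l.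
Proof.
move=> al0 uq uq' qq'.
rewrite [leRHS](bigID (fun l => l \in q))/=.
have pq : perm_eq [seq l <- q' | l \in q] q.
  apply: uniq_perm => //; first by rewrite filter_uniq.
  by move=> l; rewrite mem_filter andb_idr// => /qq'.
by rewrite -[X in X + _]big_filter (perm_big q pq) lerDl sumr_ge0.
Qed.

(** The frequencies of the symmetric partial sums, as a duplicate-free sequence
    that can be compared with arbitrary ones. *)
Definition zseq (N : nat) : seq int :=
  [seq (k%:Z - N%:Z) | k <- iota 0 N.*2.+1].

Lemma uniq_zseq N : uniq (zseq N).
Proof. by rewrite map_inj_uniq ?iota_uniq// => i j; lia. Qed.

Lemma mem_zseq N (l : int) : (l \in zseq N) = (`|l| <= N)%N.
Proof.
apply/mapP/idP => [[k]|lN]; first by rewrite mem_iota => ? ->; lia.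
by exists `|(l + N%:Z)%R|%N; [rewrite mem_iota; lia|lia].
Qed.

Lemma zsumE (al : int -> R) :
  zsum al = limn (fun N => \sum_(l <- zseq N) al l).
Proof.
rewrite /zsum; suff -> : (fun N : nat => \sum_(k < N.*2.+1) al (k%:Z - N%:Z)) =
  (fun N => \sum_(l <- zseq N) al l) by [].
apply/funext => N; rewrite big_map.
exact: esym (big_mkord xpredT (fun k : nat => al (k%:Z - N%:Z))).
Qed.

Lemma seq_sub_zseq q : exists N, {subset q <= zseq N}.
Proof.
elim: q => [|l q [N hN]]; first by exists 0%N.
exists (maxn N `|l|%N) => k; rewrite in_cons => /orP[/eqP ->|/hN];
  rewrite !mem_zseq; lia.
Qed.

Lemma zseq_sub N N' : (N <= N')%N -> {subset zseq N <= zseq N'}.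
Proof. by move=> h l; rewrite !mem_zseq => /leq_trans; apply. Qed.

(** The bound [A] on the sum of the family [al], required of every finite
    partial sum: no convergence has to be established before estimating. *)
Definition l1b al A := forall q, uniq q -> \sum_(l <- q) al l <= A.

Lemma l1b_ge0 al A : l1b al A -> 0 <= A.
Proof. by move=> /(_ [::] erefl); rewrite big_nil. Qed.

Lemma l1b_mono al be A : (forall l, al l <= be l) -> l1b be A -> l1b al A.
Proof. by move=> h hb q uq; rewrite (le_trans _ (hb q uq))// ler_sum. Qed.

Lemma l1bD al be A B : l1b al A -> l1b be B -> l1b (fun l => al l + be l) (A + B).
Proof. by move=> ha hb q uq; rewrite big_split lerD ?ha ?hb. Qed.

Lemma l1bZ al A (c : R) : 0 <= c -> l1b al A -> l1b (fun l => c * al l) (c * A).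
Proof. by move=> c0 ha q uq; rewrite -mulr_sumr ler_wpM2l ?ha. Qed.

Lemma l1b_inj al A (f : int -> int) : injective f ->
  l1b al A -> l1b (fun l => al (f l)) A.
Proof.
by move=> fi h q uq; rewrite -(big_map f xpredT al); apply: h; rewrite map_inj_uniq.
Qed.

Lemma nondecreasing_zsum al : (forall l, 0 <= al l) ->
  nondecreasing_seq (fun N => \sum_(l <- zseq N) al l).
Proof.
by move=> h m n mn; apply: sum_subset_le; rewrite ?uniq_zseq//; exact: zseq_sub.
Qed.

Lemma is_cvg_zsum_ge0 al A : (forall l, 0 <= al l) -> l1b al A ->
  cvgn (fun N => \sum_(l <- zseq N) al l).
Proof.
move=> h hA; apply: nondecreasing_is_cvgn; first exact: nondecreasing_zsum.
by exists A => _ [N _ <-]; apply: hA; exact: uniq_zseq.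
Qed.

Lemma cvg_zsum al A : l1b (fun l => `|al l|) A ->
  (fun N => \sum_(l <- zseq N) al l) @ \oo --> zsum al.
Proof.
move=> h; rewrite zsumE.
have h1 := is_cvg_zsum_ge0 (fun l => normr_ge0 (al l)) h.
have h2 : cvgn (fun N => \sum_(l <- zseq N) (`|al l| + al l)).
  apply: (@is_cvg_zsum_ge0 _ (A + A)) => [l|].
    by have := ler_norm (- al l); rewrite normrN; lra.
  by apply: (l1b_mono _ (l1bD h h)) => l; rewrite lerD2l ler_norm.
suff -> : (fun N => \sum_(l <- zseq N) al l) =
    (fun N => \sum_(l <- zseq N) (`|al l| + al l)) -
    (fun N => \sum_(l <- zseq N) `|al l|) by exact: is_cvgB.
apply/funext => N.
transitivity (\sum_(l <- zseq N) (`|al l| + al l) - \sum_(l <- zseq N) `|al l|) => //.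
by rewrite big_split/= addrAC subrr add0r.
Qed.

Lemma zsum_ge_partial al A N : (forall l, 0 <= al l) -> l1b al A ->
  \sum_(l <- zseq N) al l <= zsum al.
Proof.
move=> al0 h; rewrite zsumE; apply: nondecreasing_cvgn_le.
- exact: nondecreasing_zsum.
- exact: is_cvg_zsum_ge0 h.
Qed.

Definition ccvg (u : nat -> R[i]) z := (fun n => cmod (u n - z)) @ \oo --> (0 : R).

Lemma ccvg_le u z (e : nat -> R) : (forall n, cmod (u n - z) <= e n) ->
  e @ \oo --> (0 : R) -> ccvg u z.
Proof.
move=> h e0; apply: (squeeze_cvgr _ (cvg_cst 0) e0).
by near=> n; rewrite cmod_ge0 h.
Unshelve. all: by end_near. Qed.

Lemma ccvg_unique (u : nat -> R[i]) (z w : R[i]) : ccvg u z -> ccvg u w -> z = w.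
Proof.
move=> hz hw; apply/eqP; rewrite -subr_eq0; apply/eqP/cmod_eq0/eqP.
rewrite eq_le cmod_ge0 andbT.
have h : (fun n => cmod (u n - z) + cmod (u n - w)) @ \oo --> (0 : R).
  by rewrite -[X in _ --> X]addr0; exact: cvgD.
apply: (cvgr_to_ge h); near=> n.
rewrite (cmod_distC (u n) z) (le_trans _ (cmodD _ _))//.
by rewrite subrKA.
Unshelve. all: by end_near. Qed.

Lemma ccvgD u v z w : ccvg u z -> ccvg v w -> ccvg (fun n => u n + v n) (z + w).
Proof.
move=> hu hv; apply: (@ccvg_le _ _ (fun n => cmod (u n - z) + cmod (v n - w))).
  by move=> n; rewrite opprD addrACA cmodD.
by rewrite -[X in _ --> X]addr0; exact: cvgD.
Qed.

Lemma ccvgZ u z c : ccvg u z -> ccvg (fun n => c * u n) (c * z).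
Proof.
move=> hu; apply: (@ccvg_le _ _ (fun n => cmod c * cmod (u n - z))).
  by move=> n; rewrite -mulrBr cmodM.
by rewrite -[X in _ --> X](mulr0 (cmod c)); apply: cvgM => //; exact: cvg_cst.
Qed.

Lemma ccvg_cst z : ccvg (fun=> z) z.
Proof. by rewrite /ccvg subrr cmod0; exact: cvg_cst. Qed.

Lemma ccvg_cmod u z : ccvg u z -> (fun n => cmod (u n)) @ \oo --> cmod z.
Proof.
move=> h; apply/cvgrPdist_le => e e0.
move/cvgrPdist_le : h => /(_ _ e0) h; near=> n.
have hn : cmod (u n - z) <= e.
  have : `|0 - cmod (u n - z)| <= e by near: n.
  by rewrite sub0r normrN ger0_norm// cmod_ge0.
apply: le_trans hn; rewrite ler_norml.
have := cmodD (u n - z) z; rewrite subrK.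
have := cmodD (z - u n) (u n); rewrite subrK (cmod_distC z).
by move=> h1 h2; apply/andP; split; lra.
Unshelve. all: by end_near. Qed.

Lemma ccvg_bound u z A : ccvg u z -> (forall n, cmod (u n) <= A) -> cmod z <= A.
Proof. by move=> /ccvg_cmod h hA; apply: (cvgr_to_le h); near=> n.
Unshelve. all: by end_near. Qed.

Lemma cvg_dist0 (x : nat -> R) (l : R) :
  x @ \oo --> l -> (fun n => `|x n - l|) @ \oo --> (0 : R).
Proof.
move=> h; have : (fun n => x n - l) @ \oo --> (0 : R).
  by rewrite -(subrr l); apply: cvgB => //; exact: cvg_cst.
by move=> /cvg_norm; rewrite normr0.
Qed.

Lemma cvg_scale0 (a : R) (x : nat -> R) :
  x @ \oo --> (0 : R) -> (fun n => a * x n) @ \oo --> (0 : R).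
Proof.
by move=> h; rewrite -[X in _ --> X](mulr0 a); apply: cvgM => //; exact: cvg_cst.
Qed.

Definition csum a : R[i] :=
  zsum (fun l => complex.Re (a l)) +i* zsum (fun l => complex.Im (a l)).

Lemma ccvg_csum a A : l1b (fun l => cmod (a l)) A ->
  ccvg (fun N => \sum_(l <- zseq N) a l) (csum a).
Proof.
move=> h.
have h1 : l1b (fun l => `|complex.Re (a l)|) A.
  by apply: l1b_mono h => l; exact: normr_Re.
have h2 : l1b (fun l => `|complex.Im (a l)|) A.
  by apply: l1b_mono h => l; exact: normr_Im.
pose e1 N := `|\sum_(l <- zseq N) complex.Re (a l) - zsum (fun l => complex.Re (a l))|.
pose e2 N := `|\sum_(l <- zseq N) complex.Im (a l) - zsum (fun l => complex.Im (a l))|.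
apply: (@ccvg_le _ _ (fun N => e1 N + e2 N)).
  move=> N; rewrite (le_trans (cmod_le_ReIm _))//.
  by rewrite cReB cImB Re_sum Im_sum.
rewrite -[X in _ --> X]addr0; apply: cvgD.
- exact: cvg_dist0 (cvg_zsum h1).
- exact: cvg_dist0 (cvg_zsum h2).
Qed.

Lemma csum_unique a A z : l1b (fun l => cmod (a l)) A ->
  ccvg (fun N => \sum_(l <- zseq N) a l) z -> csum a = z.
Proof. by move=> h; apply: ccvg_unique; exact: ccvg_csum h. Qed.

Lemma csum_bound a A : l1b (fun l => cmod (a l)) A -> cmod (csum a) <= A.
Proof.
move=> h; apply: (ccvg_bound (ccvg_csum h)) => N.
by rewrite (le_trans (cmod_sum _ _))// h// uniq_zseq.
Qed.

Lemma csumD a b A B : l1b (fun l => cmod (a l)) A -> l1b (fun l => cmod (b l)) B ->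
  csum (fun l => a l + b l) = csum a + csum b.
Proof.
move=> ha hb; apply: (@csum_unique _ (A + B)).
  by apply: l1b_mono (l1bD ha hb) => l; exact: cmodD.
have := ccvgD (ccvg_csum ha) (ccvg_csum hb).
by under [X in ccvg X]eq_fun do rewrite -big_split.
Qed.

Lemma csumZ a A c : l1b (fun l => cmod (a l)) A ->
  csum (fun l => c * a l) = c * csum a.
Proof.
move=> ha; apply: (@csum_unique _ (cmod c * A)).
  by apply: l1b_mono (l1bZ (cmod_ge0 c) ha) => l; rewrite cmodM.
have := ccvgZ c (ccvg_csum ha).
by under [X in ccvg X]eq_fun do rewrite mulr_sumr.
Qed.

Lemma csum_finite a q : uniq q -> (forall l, l \notin q -> a l = 0) ->
  csum a = \sum_(l <- q) a l.
Proof.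
move=> uq a0.
have sumE q' : uniq q' -> {subset q <= q'} ->
    \sum_(l <- q') a l = \sum_(l <- q) a l.
  move=> uq' qq'; rewrite (bigID (fun l => l \in q))/= [X in _ + X]big1 ?addr0//.
  rewrite -big_filter; apply: perm_big; apply: uniq_perm => //.
    by rewrite filter_uniq.
  by move=> l; rewrite mem_filter andb_idr// => /qq'.
apply: (@csum_unique _ (\sum_(l <- q) cmod (a l))).
  move=> q' uq'; have -> : \sum_(l <- q') cmod (a l) =
      \sum_(l <- [seq l <- q' | l \in q]) cmod (a l).
    rewrite big_filter (bigID (fun l => l \in q))/= [X in _ + X]big1 ?addr0// => l.
    by move=> /a0 ->; rewrite cmod0.
  apply: sum_subset_le => //; first by move=> l; exact: cmod_ge0.
    by rewrite filter_uniq.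
  by move=> l; rewrite mem_filter => /andP[].
have [N hN] := seq_sub_zseq q.
apply: cvg_near_cst; exists N => // n /= Nn.
rewrite sumE ?uniq_zseq ?subrr ?cmod0// => l /hN.
exact: zseq_sub.
Qed.

Lemma csum_ext a b : (forall l, a l = b l) -> csum a = csum b.
Proof. by move=> /funext ->. Qed.

(** The comparison of finite tails passes to the limit. *)
Lemma csum_tail a al A N : (forall l, cmod (a l) <= al l) -> l1b al A ->
  cmod (csum a - \sum_(l <- zseq N) a l) <= zsum al - \sum_(l <- zseq N) al l.
Proof.
move=> aal h.
have al0 l : 0 <= al l by rewrite (le_trans _ (aal l))// cmod_ge0.
have ha : l1b (fun l => cmod (a l)) A by apply: l1b_mono h.
have hc := ccvgD (ccvg_csum ha) (ccvg_cst (- \sum_(l <- zseq N) a l)).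
apply: (cvgr_to_le (ccvg_cmod hc)).
near=> n; have Nn : (N <= n)%N by near: n; exact: nbhs_infty_ge.
apply: (@le_trans _ _ (\sum_(l <- zseq n) al l - \sum_(l <- zseq N) al l)).
  have sumE (V : zmodType) (F : int -> V) : \sum_(l <- zseq n) F l - \sum_(l <- zseq N) F l =
     \sum_(l <- zseq n | l \notin zseq N) F l.
    rewrite (bigID (fun l => l \in zseq N))/=.
    have p : perm_eq [seq l <- zseq n | l \in zseq N] (zseq N).
      apply: uniq_perm; rewrite ?filter_uniq ?uniq_zseq// => l.
      by rewrite mem_filter andb_idr// => /(zseq_sub Nn).
    by rewrite -[X in X + _ - _]big_filter (perm_big _ p) addrAC subrr add0r.
  have -> : \sum_(l <- zseq n) a l + - \sum_(l <- zseq N) a l =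
    \sum_(l <- zseq n | l \notin zseq N) a l by exact: (sumE R[i] a).
  rewrite (sumE R al) -[X in cmod X]big_filter -[leRHS]big_filter.
  rewrite (le_trans (cmod_sum _ _))//.
  exact: ler_sum.
by rewrite lerD2r; apply: zsum_ge_partial h.
Unshelve. all: by end_near. Qed.

Lemma cvg_zsum_tail al A : (forall l, 0 <= al l) -> l1b al A ->
  (fun N => zsum al - \sum_(l <- zseq N) al l) @ \oo --> (0 : R).
Proof.
move=> al0 h; rewrite -[X in _ --> X](subrr (zsum al)); apply: cvgB; first exact: cvg_cst.
by apply: (@cvg_zsum _ A); apply: l1b_mono h => l; rewrite ger0_norm.
Qed.

End IntegerSums.

(** * Weighted sequence spaces *)

Section SobolevSequences.
Variable R : realType.
Implicit Types (al be : int -> R) (q : seq int) (A B s : R) (l : int).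

Definition wt s l : R := (1 + l%:~R ^+ 2) `^ s.

Lemma wt_base_ge1 l : 1 <= 1 + (l%:~R : R) ^+ 2.
Proof. by rewrite lerDl sqr_ge0. Qed.

Lemma wt_base_gt0 l : 0 < 1 + (l%:~R : R) ^+ 2.
Proof. exact: lt_le_trans ltr01 (wt_base_ge1 l). Qed.

Lemma wt_gt0 s l : 0 < wt s l.
Proof. by rewrite powR_gt0// wt_base_gt0. Qed.

Lemma wt_ge0 s l : 0 <= wt s l.
Proof. exact/ltW/wt_gt0. Qed.

Lemma wtD s s' l : wt (s + s') l = wt s l * wt s' l.
Proof. by rewrite /wt powRD// (gt_eqF (wt_base_gt0 l)) implybT. Qed.

Lemma wt1 l : wt 1 l = 1 + l%:~R ^+ 2.
Proof. by rewrite /wt powRr1// ltW// wt_base_gt0. Qed.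

Lemma wt_le s s' l : s <= s' -> wt s l <= wt s' l.
Proof. by move=> h; rewrite /wt ler_powR// wt_base_ge1. Qed.

Lemma wt_ge1 s l : 0 <= s -> 1 <= wt s l.
Proof. by move=> s0; rewrite -(powRr0 (1 + l%:~R ^+ 2)) ler_powR// wt_base_ge1. Qed.

Lemma wt_half s l : wt s l = wt (s / 2) l ^+ 2.
Proof. by rewrite expr2 -wtD -splitr. Qed.

(** Peetre's inequality: the index of larger modulus is at least half of the
    sum. *)
Lemma wt_addl s j m : 0 <= s -> wt s (j + m) <= 4 `^ s * (wt s j + wt s m).
Proof.
move=> s0.
have key i k : `|i%:~R : R| <= `|k%:~R : R| -> wt s (i + k) <= 4 `^ s * wt s k.
  move=> ik; rewrite /wt -powRM ?ler0n//; last by rewrite ltW// wt_base_gt0.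
  apply: ge0_ler_powR => //; rewrite ?nnegrE ?mulr_ge0// ?(ltW (wt_base_gt0 _))//.
  have : (i%:~R : R) ^+ 2 <= k%:~R ^+ 2.
    by rewrite -[leLHS]real_normK ?num_real// -[leRHS]real_normK ?num_real//
      ler_pXn2r ?nnegrE.
  by rewrite intrD; nra.
have p0 : 0 <= (4 : R) `^ s by rewrite powR_ge0.
have [h|/ltW h] := leP `|j%:~R : R| `|m%:~R|.
  by rewrite (le_trans (key _ _ h))// ler_wpM2l// lerDr wt_ge0.
by rewrite addrC (le_trans (key _ _ h))// ler_wpM2l// lerDl wt_ge0.
Qed.

(** The bound [A] on the norm of [H^s] of a sequence with moduli [al]. As for
    [l1b], it is a condition on finite partial sums; it is stable under limits
    of the entries ([hb_lim]) and, for [s > 1 / 2], under convolution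
    ([hb_zconv]). *)
Definition hb s al A := 0 <= A /\
  forall q, uniq q -> \sum_(l <- q) wt s l * al l ^+ 2 <= A ^+ 2.

Lemma hb_ge0 s al A : hb s al A -> 0 <= A.
Proof. by case. Qed.

Lemma hb_le s al A B : hb s al A -> A <= B -> hb s al B.
Proof.
move=> [A0 h] AB; split; first exact: le_trans AB.
by move=> q uq; rewrite (le_trans (h q uq))// ler_pXn2r ?nnegrE// (le_trans A0).
Qed.

Lemma hb_mono s al be A : (forall l, 0 <= al l <= be l) -> hb s be A -> hb s al A.
Proof.
move=> h [A0 hA]; split=> // q uq; apply: le_trans (hA q uq).
apply: ler_sum => l _; have /andP[a0 ab] := h l.
by rewrite ler_wpM2l ?wt_ge0// ler_pXn2r ?nnegrE// (le_trans a0).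
Qed.

Lemma hbD s al be A B : hb s al A -> hb s be B -> hb s (fun l => al l + be l) (A + B).
Proof.
move=> [A0 hA] [B0 hB]; split; first exact: addr_ge0.
move=> q uq; have := @minkowski_seq _ _ q (fun l => wt (s / 2) l * al l)
  (fun l => wt (s / 2) l * be l) A B A0 B0.
under eq_bigr do rewrite exprMn -wt_half.
under [in X in _ -> X -> _]eq_bigr do rewrite exprMn -wt_half.
under [in X in _ -> _ -> X]eq_bigr do rewrite -mulrDr exprMn -wt_half.
by apply; [exact: hA|exact: hB].
Qed.

Lemma hbZ s al A (c : R) : 0 <= c -> hb s al A -> hb s (fun l => c * al l) (c * A).
Proof.
move=> c0 [A0 hA]; split; first exact: mulr_ge0.
move=> q uq; rewrite exprMn.
under eq_bigr do rewrite exprMn mulrCA.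
by rewrite -mulr_sumr ler_wpM2l ?sqr_ge0// hA.
Qed.

Lemma hb_weaken s s' al A : s <= s' -> hb s' al A -> hb s al A.
Proof.
move=> ss' [A0 h]; split=> // q uq; apply: le_trans (h q uq).
by apply: ler_sum => l _; rewrite ler_wpM2r ?sqr_ge0// wt_le.
Qed.

Lemma hb_term s al A l : 0 <= s -> hb s al A -> al l <= A.
Proof.
move=> s0 [A0 h]; apply: ler_of_sqr => //; apply: le_trans (h [:: l] erefl).
by rewrite big_seq1 ler_peMl ?sqr_ge0// wt_ge1.
Qed.

Lemma hb_lim s (u : nat -> int -> R) al A : (forall n, hb s (u n) A) ->
  (forall l, (fun n => u n l) @ \oo --> al l) -> hb s al A.
Proof.
move=> h ul; split; first by have [] := h 0%N.
move=> q uq.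
have : (fun n => \sum_(l <- q) wt s l * u n l ^+ 2) @ \oo -->
       \sum_(l <- q) wt s l * al l ^+ 2.
  elim: q {uq} => [|l q IH].
    under eq_fun do rewrite big_nil; rewrite big_nil; exact: cvg_cst.
  under eq_fun do rewrite big_cons; rewrite big_cons; apply: cvgD => //.
  by apply: cvgM; [exact: cvg_cst|under eq_fun do rewrite expr2; exact: cvgM].
by move=> /cvgr_to_le; apply; apply: nearW => n; have [_] := h n; apply.
Qed.

(** [l ^ 2] is at most the weight [wt 1 l]. *)
Lemma hb_deriv s al A : hb (s + 1) al A -> hb s (fun l => `|l%:~R| * al l) A.
Proof.
move=> [A0 h]; split=> // q uq; apply: le_trans (h q uq); apply: ler_sum => l _.
rewrite exprMn mulrA ler_wpM2r ?sqr_ge0// wtD ler_wpM2l ?wt_ge0//.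
by rewrite wt1 real_normK ?num_real// lerDr.
Qed.

End SobolevSequences.

Lemma big_zseqS (V : nmodType) (N : nat) (F : int -> V) :
  \sum_(l <- zseq N.+1) F l =
  F N.+1%:Z + F (- N.+1%:Z) + \sum_(l <- zseq N) F l.
Proof.
have [uz hz] : uniq (zseq N) /\ forall l, (l \in zseq N) = (`|l| <= N)%N.
  by split; [exact: uniq_zseq|exact: mem_zseq].
have [uz' hz'] : uniq (zseq N.+1) /\ forall l, (l \in zseq N.+1) = (`|l| <= N.+1)%N.
  by split; [exact: uniq_zseq|exact: mem_zseq].
move: (zseq N) (zseq N.+1) uz hz uz' hz' => z z' uz hz uz' hz'.
have p : perm_eq z' (N.+1%:Z :: - N.+1%:Z :: z).
  apply: uniq_perm => //; first by rewrite /= uz in_cons !hz; lia.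
  by move=> l; rewrite !in_cons hz hz'; lia.
by rewrite (perm_big _ p) !big_cons /= addrA.
Qed.

Section Summability.
Variables (R : realType) (s : R).
Hypothesis s_gt : 1 / 2 < s.

Let s_gt0 : 0 < s. Proof. by have := s_gt; lra. Qed.

Lemma dyadic_ratio : 0 < 1 - 2 * (4 : R) `^ (- s).
Proof.
rewrite subr_gt0 powRN ltr_pdivrMr ?powR_gt0// mul1r.
have h2 : (4 : R) `^ (1 / 2) = 2.
  have -> : (4 : R) = 2 ^+ 2 by rewrite expr2; ring.
  by rewrite -powR_mulrn// -powRrM mul1r divff// powRr1.
rewrite -[s in ltRHS](subrKC (1 / 2)) powRD ?pnatr_eq0 ?implybT// h2 ltr_pMr//.
have h1 : (1 : R) `^ (s - 1 / 2) = 1 by rewrite powR1.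
rewrite -[ltLHS]h1.
by apply: gt0_ltr_powR; rewrite ?nnegrE ?subr_gt0 ?ltr1n.
Qed.

(** Cauchy condensation: pairing the terms of indices [2k] and [2k+1] bounds a
    partial sum by [1] plus a contraction of itself. *)
Lemma sum_inv_square_le N :
  \sum_(1 <= k < N.+1) (k%:R ^+ 2 : R) `^ (- s) <= 1 / (1 - 2 * 4 `^ (- s)).
Proof.
pose f k : R := (k%:R ^+ 2) `^ (- s).
have f0 k : 0 <= f k by exact: powR_ge0.
have f1 : f 1%N = 1 by rewrite /f expr1n powR1.
have feven k : f k.*2 = 4 `^ (- s) * f k.
  by rewrite /f -powRM ?sqr_ge0// -muln2 natrM exprMn mulrC; congr ((_ * _) `^ _); ring.
have fodd k : (0 < k)%N -> f k.*2.+1 <= 4 `^ (- s) * f k.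
  move=> k0; rewrite -feven /f !powRN lef_pV2 ?posrE ?powR_gt0 ?exprn_gt0 ?ltr0n ?double_gt0//.
  by apply: ge0_ler_powR; rewrite ?nnegrE ?sqr_ge0 ?ltW// ltr_pXn2r ?nnegrE// ltr_nat.
have step M : \sum_(1 <= k < M.*2.+2) f k <= 1 + 2 * 4 `^ (- s) * \sum_(1 <= k < M.+1) f k.
  elim: M => [|M IH]; first by rewrite !big_nat1 f1 big_geq// mulr0 addr0.
  rewrite doubleS big_nat_recr// big_nat_recr//=.
  rewrite [in leRHS]big_nat_recr//= mulrDr addrA -addrA lerD//.
  have := fodd M.+1 isT; rewrite -[M.*2.+2]doubleS feven; lra.
rewrite ler_pdivlMr ?dyadic_ratio//.
have : \sum_(1 <= k < N.+1) f k <= \sum_(1 <= k < N.*2.+2) f k.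
  rewrite [leRHS](@big_cat_nat _ _ _ N.+1)//=; last by rewrite ltnS -addnn; lia.
  by rewrite lerDl sumr_ge0.
move=> /le_trans/(_ (step N)); rewrite /f; lra.
Qed.

Definition zeta_const : R := 1 + 2 * (1 / (1 - 2 * 4 `^ (- s))).

Lemma zeta_const_gt0 : 0 < zeta_const.
Proof.
have h := dyadic_ratio.
by rewrite /zeta_const ltr_pwDl// mulr_ge0// divr_ge0// ltW.
Qed.

Lemma l1b_wtN : l1b (wt (- s)) zeta_const.
Proof.
move=> q uq; have [N qN] := seq_sub_zseq q.
apply: (@le_trans _ _ (\sum_(l <- zseq N) wt (- s) l)).
  by apply: sum_subset_le => //; [move=> l; exact: wt_ge0|exact: uniq_zseq].
apply: (@le_trans _ _ (1 + 2 * \sum_(1 <= k < N.+1) (k%:R ^+ 2 : R) `^ (- s))); last first.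
  by rewrite lerD2l ler_wpM2l// sum_inv_square_le.
elim: {q uq qN} N => [|N IH].
  rewrite big_geq// mulr0 addr0 big_seq1.
  by rewrite /wt expr0n/= addr0 powR1.
rewrite big_zseqS big_nat_recr//= mulrDr addrA addrC lerD//.
have h : wt (- s) N.+1%:Z <= (N.+1%:R ^+ 2 : R) `^ (- s).
  rewrite /wt !powRN lef_pV2 ?posrE ?powR_gt0 ?exprn_gt0 ?ltr0n ?wt_base_gt0//.
  apply: ge0_ler_powR; rewrite ?nnegrE ?sqr_ge0 ?(ltW s_gt0)//.
  by rewrite lerDr.
have -> : wt (- s) (- N.+1%:Z) = wt (- s) N.+1%:Z by rewrite /wt mulrNz sqrrN.
by rewrite mulr_natl mulr2n lerD.
Qed.

Definition l1_const : R := Num.sqrt zeta_const.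

Lemma l1_const_gt0 : 0 < l1_const.
Proof. by rewrite sqrtr_gt0 zeta_const_gt0. Qed.

(** Sobolev embedding on the Fourier side: above the exponent [1/2] the
    Cauchy-Schwarz inequality against the summable weight gives absolute
    summability of the coefficients. *)
Lemma hb_l1 al A : hb s al A -> l1b al (l1_const * A).
Proof.
move=> [A0 h] q uq; apply: ler_of_sqr; first by rewrite mulr_ge0// ltW// l1_const_gt0.
have -> : \sum_(l <- q) al l =
    \sum_(l <- q) wt (- s / 2) l * (wt (s / 2) l * al l).
  apply: eq_bigr => l _; rewrite mulrA -wtD mulNr addNr.
  by rewrite /wt powRr0 mul1r.
rewrite (le_trans (cauchy_schwarz_seq _ _ _))// exprMn sqr_sqrtr ?(ltW zeta_const_gt0)//.
have hw : \sum_(l <- q) wt (- s / 2) l ^+ 2 <= zeta_const.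
  under eq_bigr do rewrite -wt_half; exact: l1b_wtN.
have ha : \sum_(l <- q) (wt (s / 2) l * al l) ^+ 2 <= A ^+ 2.
  under eq_bigr do rewrite exprMn -wt_half; exact: h.
by apply: ler_pM => //; apply: sumr_seq_ge0 => l; exact: sqr_ge0.
Qed.

End Summability.

Section Algebra.
Variable R : realType.
Implicit Types (f g al be : int -> R) (q : seq int).

Lemma cauchy_schwarz_weight q f g : (forall j, 0 <= g j) ->
  (\sum_(j <- q) f j * g j) ^+ 2 <=
  (\sum_(j <- q) g j) * \sum_(j <- q) f j ^+ 2 * g j.
Proof.
move=> g0.
have := cauchy_schwarz_seq q (fun j => f j * Num.sqrt (g j)) (fun j => Num.sqrt (g j)).
under eq_bigr do rewrite -mulrA -expr2 sqr_sqrtr//.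
under [in X in _ <= X * _]eq_bigr do rewrite exprMn sqr_sqrtr//.
under [in X in _ <= _ * X]eq_bigr do rewrite sqr_sqrtr//.
by rewrite mulrC.
Qed.

Lemma sum_shift_le g G q (c : int) :
  l1b g G -> uniq q -> \sum_(l <- q) g (l - c) <= G.
Proof. by move=> /(@l1b_inj _ _ _ (fun l => l - c)) h; apply: h; exact: addIr. Qed.

Lemma sum_shiftN_le g G q (c : int) :
  l1b g G -> uniq q -> \sum_(l <- q) g (c - l) <= G.
Proof.
move=> /(@l1b_inj _ _ _ (fun l => c - l)) h; apply: h => i j /addrI.
exact: oppr_inj.
Qed.

(** Young's inequality, in the case of one square summable and one summable
    sequence, for the two orders of the factors. *)
Lemma young_left q q' f g F G : (forall j, 0 <= g j) -> uniq q -> uniq q' ->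
  l1b (fun l => f l ^+ 2) (F ^+ 2) -> l1b g G ->
  \sum_(l <- q) (\sum_(j <- q') f j * g (l - j)) ^+ 2 <= (F * G) ^+ 2.
Proof.
move=> g0 uq uq' hf hg; have G0 := l1b_ge0 hg.
apply: (@le_trans _ _ (\sum_(l <- q) G * \sum_(j <- q') f j ^+ 2 * g (l - j))).
  apply: ler_sum => l _.
  rewrite (le_trans (cauchy_schwarz_weight _ _ _))//.
  rewrite ler_wpM2r ?sum_shiftN_le//.
  by apply: sumr_seq_ge0 => j; rewrite mulr_ge0 ?sqr_ge0.
rewrite -mulr_sumr exchange_big/= (_ : (F * G) ^+ 2 = G * (F ^+ 2 * G)); last by ring.
rewrite ler_wpM2l// (@le_trans _ _ (\sum_(j <- q') f j ^+ 2 * G))//.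
  by apply: ler_sum => j _; rewrite -mulr_sumr ler_wpM2l ?sqr_ge0// sum_shift_le.
by rewrite -mulr_suml ler_wpM2r// hf.
Qed.

Lemma young_right q q' f g F G : (forall j, 0 <= g j) -> uniq q -> uniq q' ->
  l1b (fun l => f l ^+ 2) (F ^+ 2) -> l1b g G ->
  \sum_(l <- q) (\sum_(j <- q') g j * f (l - j)) ^+ 2 <= (F * G) ^+ 2.
Proof.
move=> g0 uq uq' hf hg; have G0 := l1b_ge0 hg.
apply: (@le_trans _ _ (\sum_(l <- q) G * \sum_(j <- q') f (l - j) ^+ 2 * g j)).
  apply: ler_sum => l _.
  under eq_bigr do rewrite mulrC.
  rewrite (le_trans (cauchy_schwarz_weight _ (fun j => f (l - j)) _))//.
  rewrite ler_wpM2r ?hg//.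
  by apply: sumr_seq_ge0 => j; rewrite mulr_ge0 ?sqr_ge0.
rewrite -mulr_sumr exchange_big/= (_ : (F * G) ^+ 2 = G * (F ^+ 2 * G)); last by ring.
rewrite ler_wpM2l// (@le_trans _ _ (\sum_(j <- q') F ^+ 2 * g j))//.
  by apply: ler_sum => j _; rewrite -mulr_suml ler_wpM2r ?(sum_shift_le j hf).
by rewrite -mulr_sumr ler_wpM2l ?sqr_ge0 ?hg.
Qed.

Lemma hb_l2 s al A : hb s al A -> l1b (fun l => (wt (s / 2) l * al l) ^+ 2) (A ^+ 2).
Proof.
by move=> [_ h] q uq; under eq_bigr do rewrite exprMn -wt_half; exact: h.
Qed.

Definition alg_const (s : R) : R := 2 * 4 `^ (s / 2) * l1_const s.

Lemma alg_const_gt0 s : 1 / 2 < s -> 0 < alg_const s.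
Proof. by move=> s12; rewrite !mulr_gt0 ?powR_gt0 ?l1_const_gt0. Qed.

(** Above the exponent [1/2] the weighted space is a convolution algebra: the
    weight is distributed over the factors, and the factor that does not receive
    it is summable. *)
Lemma hb_conv_seq s q' al be A B : 1 / 2 < s -> uniq q' ->
  (forall j, 0 <= al j) -> (forall j, 0 <= be j) ->
  hb s al A -> hb s be B ->
  hb s (fun l => \sum_(j <- q') al j * be (l - j)) (alg_const s * (A * B)).
Proof.
move=> s12 uq' al0 be0 ha hb_; have [A0 _] := ha; have [B0 _] := hb_.
have c0 := alg_const_gt0 s12; have lc0 := l1_const_gt0 s12.
split; first by rewrite !mulr_ge0// ltW.
move=> q uq.
pose p l : R := wt (s / 2) l; pose c4 : R := 4 `^ (s / 2).
have c40 : 0 <= c4 by exact: powR_ge0.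
have p0 l : 0 <= p l by exact: wt_ge0.
have s0 : 0 <= s / 2 by lra.
pose X l := c4 * \sum_(j <- q') (p j * al j) * be (l - j).
pose Y l := c4 * \sum_(j <- q') al j * (p (l - j) * be (l - j)).
apply: (@le_trans _ _ (\sum_(l <- q) (X l + Y l) ^+ 2)).
  apply: ler_sum => l _; rewrite wt_half -exprMn.
  rewrite ler_pXn2r ?nnegrE//; last 2 first.
  - by rewrite mulr_ge0// sumr_seq_ge0// => j; rewrite mulr_ge0.
  - by rewrite addr_ge0// mulr_ge0// sumr_seq_ge0// => j; rewrite !mulr_ge0.
  rewrite /X /Y -mulrDr -big_split/= !mulr_sumr.
  apply: ler_sum => j _.
  have := wt_addl j (l - j) s0; rewrite subrKC -/(p _) -/(p j) -/(p (l - j)) -/c4 => h.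
  apply: (le_trans (ler_wpM2r (mulr_ge0 (al0 j) (be0 (l - j))) h)).
  by rewrite le_eqVlt; apply/orP; left; apply/eqP; ring.
have -> : alg_const s * (A * B) =
    c4 * (A * (l1_const s * B)) + c4 * (B * (l1_const s * A)).
  by rewrite /alg_const -/c4; ring.
apply: minkowski_seq; rewrite ?mulr_ge0 ?(ltW lc0)//.
- under eq_bigr do rewrite exprMn; rewrite -mulr_sumr exprMn ler_wpM2l ?sqr_ge0//.
  by apply: young_left => //; [exact: hb_l2 ha|exact: hb_l1].
- under eq_bigr do rewrite exprMn; rewrite -mulr_sumr exprMn ler_wpM2l ?sqr_ge0//.
  by apply: (@young_right q q' (fun l => p l * be l)) => //;
    [exact: hb_l2 hb_|exact: hb_l1].
Qed.

(** [zconv P] is the convolution-type sum of a kernel [P j m] that already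
    contains the values of the two sequences, so that identities between
    bilinear expressions are checked on [P]. *)
Definition zconv (P : int -> int -> R[i]) (l : int) : R[i] :=
  csum (fun j => P j (l - j)).

Lemma zconv_l1 (P : int -> int -> R[i]) (k : R) al be A Bm l :
  0 <= k -> (forall j, 0 <= al j) -> (forall j, 0 <= be j <= Bm) ->
  (forall j m, cmod (P j m) <= k * (al j * be m)) ->
  l1b al A -> l1b (fun j => cmod (P j (l - j))) (k * (Bm * A)).
Proof.
move=> k0 al0 beB hP ha.
have Bm0 : 0 <= Bm by have /andP[] := beB 0; exact: le_trans.
apply: (l1b_mono _ (l1bZ k0 (l1bZ Bm0 ha))) => j.
rewrite (le_trans (hP _ _))// ler_wpM2l// mulrC ler_wpM2r//.
by have /andP[] := beB (l - j).
Qed.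

Lemma hb_zconv s (P : int -> int -> R[i]) (k : R) al be A B : 1 / 2 < s -> 0 <= k ->
  (forall j, 0 <= al j) -> (forall j, 0 <= be j) ->
  (forall j m, cmod (P j m) <= k * (al j * be m)) ->
  hb s al A -> hb s be B ->
  hb s (fun l => cmod (zconv P l)) (k * (alg_const s * (A * B))).
Proof.
move=> s12 k0 al0 be0 hP ha hb_.
apply: (@hb_lim _ _ (fun n l => cmod (\sum_(j <- zseq n) P j (l - j)))).
  move=> n; apply: (hb_mono _ (hbZ k0 (hb_conv_seq s12 (uniq_zseq n) al0 be0 ha hb_))).
  move=> l; rewrite cmod_ge0/= (le_trans (cmod_sum _ _))// mulr_sumr.
  by apply: ler_sum.
move=> l; apply: ccvg_cmod; apply: ccvg_csum.
have s0 : 0 <= s by lra.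
apply: (@zconv_l1 P k al be _ B l k0 al0 _ hP (hb_l1 s12 ha)) => j.
by rewrite be0/= (hb_term _ s0 hb_).
Qed.

End Algebra.

(** * Oscillatory kernels *)

Section Phases.
Variable R : realType.
Implicit Types (s t h : R) (j m : int).

Definition freq j m : R := 2 * (j%:~R * m%:~R).

(** The phase of the pair [(j, m)] in the rotating frame: [freq j m] is
    [(j + m) ^ 2 - j ^ 2 - m ^ 2]. *)
Definition phase s j m : R[i] := cis (s * freq j m).

(** The integral of [phase _ j m] from [0] to [s]. *)
Definition phase_int s j m : R[i] :=
  if freq j m == 0 then s%:C else (phase s j m - 1) / ('i * (freq j m)%:C).

Lemma freqE j m : `|freq j m| = 2 * (`|j%:~R| * `|m%:~R|).
Proof. by rewrite /freq !normrM ger0_norm. Qed.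

Lemma cmod_phase s j m : cmod (phase s j m) = 1.
Proof. exact: cmod_cis. Qed.

Lemma phaseD s t j m : phase (s + t) j m = phase s j m * phase t j m.
Proof. by rewrite /phase mulrDl cisD. Qed.

Lemma phase_lip s t j m :
  cmod (phase s j m - phase t j m) <= 2 * `|s - t| * (`|j%:~R| * `|m%:~R|).
Proof.
rewrite (le_trans (cmod_cisB _ _))// -mulrBl normrM freqE.
by rewrite mulrCA mulrA.
Qed.

Lemma phase_int0 j m : phase_int 0 j m = 0.
Proof. by rewrite /phase_int /phase mul0r cis0 subrr mul0r; case: ifP. Qed.

Lemma cmod_phase_int s j m : cmod (phase_int s j m) <= `|s|.
Proof.
rewrite /phase_int; case: ifPn => [_|k0]; first by rewrite cmodR.
rewrite cmodM cmodV cmodM cmodi mul1r cmodR ler_pdivrMr ?normr_gt0//.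
by rewrite (le_trans (cmod_cisB1 _))// normrM.
Qed.

(** Additivity of the integral with respect to the interval. *)
Lemma phase_int_cocycle s h j m :
  phase_int (s + h) j m - phase_int s j m = phase s j m * phase_int h j m.
Proof.
rewrite /phase_int; case: ifPn => [/eqP k0|k0].
  by rewrite /phase k0 mulr0 cis0 mul1r rmorphD/= addrAC subrr add0r.
by rewrite phaseD; ring.
Qed.

(** Freezing the phase costs the factor [j m], that is, one derivative on
    each argument of the bilinear form. *)
Lemma phase_int_taylor h j m :
  cmod (phase_int h j m - h%:C) <= 2 * h ^+ 2 * (`|j%:~R| * `|m%:~R|).
Proof.
rewrite /phase_int; case: ifPn => [_|k0].
  by rewrite subrr cmod0 mulr_ge0// mulr_ge0// sqr_ge0.
have i0 : 'i != 0 :> R[i] by exact: neq0Ci.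
have kc0 : (freq j m)%:C != 0 :> R[i] by rewrite (inj_eq (@complexI R)).
have -> : (phase h j m - 1) / ('i * (freq j m)%:C) - h%:C =
    (cis (h * freq j m) - 1 - 'i * (h * freq j m)%:C) / ('i * (freq j m)%:C).
  have -> : (h * freq j m)%:C = h%:C * (freq j m)%:C by exact: rmorphM.
  by rewrite /phase; field; rewrite i0 kc0.
rewrite cmodM cmodV cmodM cmodi mul1r cmodR ler_pdivrMr ?normr_gt0//.
rewrite (le_trans (cmod_cisB1_lin _))// -[leLHS]real_normK ?num_real//.
rewrite normrM freqE exprMn real_normK ?num_real//.
by rewrite le_eqVlt; apply/orP; left; apply/eqP; ring.
Qed.

Lemma phase_int_taylor_end s j m :
  cmod (phase_int s j m - s%:C * phase s j m) <= 2 * s ^+ 2 * (`|j%:~R| * `|m%:~R|).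
Proof.
have h : phase_int s j m = - (phase s j m * phase_int (- s) j m).
  by rewrite -phase_int_cocycle subrr phase_int0 sub0r opprK.
have -> : phase_int s j m - s%:C * phase s j m =
    - (phase s j m * (phase_int (- s) j m - (- s)%:C)).
  by rewrite {1}h rmorphN/=; ring.
by rewrite cmodN cmodM cmod_phase mul1r (le_trans (phase_int_taylor _ _ _))// sqrrN.
Qed.

Lemma phase_int_taylor_at s h j m :
  cmod (phase_int (s + h) j m - phase_int s j m - h%:C * phase s j m) <=
  2 * h ^+ 2 * (`|j%:~R| * `|m%:~R|).
Proof.
rewrite phase_int_cocycle (mulrC h%:C) -mulrBr cmodM cmod_phase mul1r.
exact: phase_int_taylor.
Qed.

End Phases.

Section BoundedKernels.
Variables (R : realType) (sg : R).
Hypothesis sg12 : 1 / 2 < sg.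
Implicit Types (P Q : int -> int -> R[i]) (a b : int -> R[i]) (X Y k : R).

(** Besides the bound on [zconv P], each of the sums is required to converge
    absolutely. Then [zconv] is linear on such kernels, and identities between
    bilinear expressions reduce to identities between kernels. *)
Definition kb P X := hb sg (fun l => cmod (zconv P l)) X /\
  forall l, exists A, l1b (fun j => cmod (P j (l - j))) A.

Lemma zconvD P Q X Y : kb P X -> kb Q Y ->
  forall l, zconv (fun j m => P j m + Q j m) l = zconv P l + zconv Q l.
Proof.
move=> [_ hP] [_ hQ] l; have [A hA] := hP l; have [B hB] := hQ l.
exact: csumD hA hB.
Qed.

Lemma zconvZ P X (c : R[i]) : kb P X ->
  forall l, zconv (fun j m => c * P j m) l = c * zconv P l.
Proof. by move=> [_ hP] l; have [A hA] := hP l; exact: csumZ hA. Qed.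

Lemma hb_cmodD s a b X Y : hb s |: a :| X -> hb s |: b :| Y ->
  hb s |: fun l => a l + b l :| (X + Y).
Proof.
by move=> ha hb_; apply: hb_mono (hbD ha hb_) => l; rewrite cmod_ge0 cmodD.
Qed.

Lemma hb_cmodZ s a X (c : R[i]) : hb s |: a :| X ->
  hb s |: fun l => c * a l :| (cmod c * X).
Proof.
by move=> ha; apply: hb_mono (hbZ (cmod_ge0 c) ha) => l; rewrite cmod_ge0 cmodM/=.
Qed.

Lemma hb_cmodB s a b X Y : hb s |: a :| X -> hb s |: b :| Y ->
  hb s |: fun l => a l - b l :| (X + Y).
Proof.
by move=> ha hb_; apply: hb_mono (hbD ha hb_) => l; rewrite cmod_ge0 cmodB.
Qed.

Lemma hb_ext s a b X : (forall l, a l = b l) -> hb s |: a :| X -> hb s |: b :| X.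
Proof. by move=> /funext ->. Qed.

Lemma kbD P Q X Y : kb P X -> kb Q Y -> kb (fun j m => P j m + Q j m) (X + Y).
Proof.
move=> hP hQ; split.
  by apply: (@hb_ext _ (fun l => zconv P l + zconv Q l)) => [l|];
    [rewrite (zconvD hP hQ)|apply: hb_cmodD; [case: hP|case: hQ]].
move=> l; have [A hA] := hP.2 l; have [B hB] := hQ.2 l; exists (A + B).
by apply: l1b_mono (l1bD hA hB) => j; exact: cmodD.
Qed.

Lemma kbZ P X (c : R[i]) : kb P X -> kb (fun j m => c * P j m) (cmod c * X).
Proof.
move=> hP; split.
  by apply: (@hb_ext _ (fun l => c * zconv P l)) => [l|];
    [rewrite (zconvZ c hP)|apply: hb_cmodZ; case: hP].
move=> l; have [A hA] := hP.2 l; exists (cmod c * A).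
by apply: l1b_mono (l1bZ (cmod_ge0 c) hA) => j; rewrite cmodM.
Qed.

Lemma kbB P Q X Y : kb P X -> kb Q Y -> kb (fun j m => P j m - Q j m) (X + Y).
Proof.
move=> hP hQ; have := kbD hP (kbZ (-1) hQ); rewrite cmodN cmod1 mul1r.
by congr kb; apply/funext => j; apply/funext => m; rewrite mulN1r.
Qed.

Lemma zconvB P Q X Y : kb P X -> kb Q Y ->
  forall l, zconv (fun j m => P j m - Q j m) l = zconv P l - zconv Q l.
Proof.
move=> hP hQ l; rewrite -[- zconv Q l]mulN1r -(zconvZ (-1) hQ).
rewrite -(zconvD hP (kbZ (-1) hQ)).
by apply: csum_ext => j; rewrite mulN1r.
Qed.

Lemma kb_ext P Q X : (forall j m, P j m = Q j m) -> kb P X -> kb Q X.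
Proof. by move=> h; have -> : P = Q by apply/funext => j; apply/funext. Qed.

Lemma kb_dom P k (al be : int -> R) X Y : 0 <= k ->
  (forall j, 0 <= al j) -> (forall j, 0 <= be j) ->
  (forall j m, cmod (P j m) <= k * (al j * be m)) ->
  hb sg al X -> hb sg be Y -> kb P (k * (alg_const sg * (X * Y))).
Proof.
move=> k0 al0 be0 hP ha hb_; split; first exact: (hb_zconv sg12 k0 al0 be0).
have s0 : 0 <= sg by have := sg12; lra.
move=> l; exists (k * (Y * (l1_const sg * X))).
apply: (@zconv_l1 _ P k al be _ Y l k0 al0 _ hP (hb_l1 sg12 ha)) => j.
by rewrite be0/= (hb_term _ s0 hb_).
Qed.

Lemma kb_mul (e : int -> int -> R[i]) a b k X Y : 0 <= k ->
  (forall j m, cmod (e j m) <= k) -> hb sg |: a :| X -> hb sg |: b :| Y ->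
  kb (fun j m => e j m * (a j * b m)) (k * (alg_const sg * (X * Y))).
Proof.
move=> k0 he; apply: kb_dom => //; try by move=> j; exact: cmod_ge0.
by move=> j m; rewrite !cmodM ler_wpM2r// mulr_ge0 ?cmod_ge0.
Qed.

Lemma kb_mul_deriv (e : int -> int -> R[i]) a b k X Y : 0 <= k ->
  (forall j m, cmod (e j m) <= k * (`|j%:~R| * `|m%:~R|)) ->
  hb (sg + 1) |: a :| X -> hb (sg + 1) |: b :| Y ->
  kb (fun j m => e j m * (a j * b m)) (k * (alg_const sg * (X * Y))).
Proof.
move=> k0 he ha hb_.
apply: (kb_dom k0 _ _ _ (hb_deriv ha) (hb_deriv hb_)).
- by move=> j; rewrite mulr_ge0 ?cmod_ge0.
- by move=> j; rewrite mulr_ge0 ?cmod_ge0.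
move=> j m; rewrite !cmodM.
apply: le_trans (ler_wpM2r (mulr_ge0 (cmod_ge0 _) (cmod_ge0 _)) (he j m)) _.
by rewrite le_eqVlt; apply/orP; left; apply/eqP; ring.
Qed.

End BoundedKernels.

(** * The local error in the rotating frame *)

Ltac nonneg := repeat first [assumption | exact: ler01 | exact: ler0n |
  exact: sqr_ge0 | exact: cmod_ge0 | apply: addr_ge0 | apply: mulr_ge0].

Section Closedness.
Variables (R : realType) (sg : R).
Implicit Types (al : int -> R) (X Y : R).

Lemma hb_closed al X : 0 <= X -> (forall e, 0 < e -> hb sg al (X + e)) ->
  hb sg al X.
Proof.
move=> X0 h; split=> // q uq.
set S := \sum_(l <- q) _.
have S0 : 0 <= S by apply: sumr_seq_ge0 => l; rewrite mulr_ge0 ?wt_ge0 ?sqr_ge0.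
have : Num.sqrt S <= X.
  apply/ler_addgt0Pr => e e0; have [Xe0 hq] := h e e0.
  by rewrite -(ger0_norm Xe0) -sqrtr_sqr ler_wsqrtr// hq.
by rewrite -{2}(sqr_sqrtr S0) ler_pXn2r ?nnegrE ?sqrtr_ge0.
Qed.

(** A self-referential bound can be absorbed once some bound is known: the
    infimum of all bounds satisfies the inequality. *)
Lemma hb_absorb al X0 c x : 0 <= c -> 0 <= x < 1 -> hb sg al X0 ->
  (forall X, hb sg al X -> hb sg al (c + x * X)) -> hb sg al (c / (1 - x)).
Proof.
move=> c0 /andP[x0 x1] h0 h.
pose S : set R := [set X | hb sg al X].
have S0 : S !=set0 by exists X0.
have lbS : lbound S 0 by move=> X [].
have hS : has_inf S by split => //; exists 0.
have I0 : 0 <= inf S by exact: lb_le_inf.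
have hI : hb sg al (inf S).
  apply: hb_closed => // e e0; have [X SX Xe] := inf_adherent e0 hS.
  exact: hb_le SX (ltW Xe).
apply: (hb_le hI).
have : inf S <= c + x * inf S.
  by apply: ge_inf; [exists 0|exact: h].
rewrite ler_pdivlMr ?subr_gt0//; lra.
Qed.

(** Increments of size [B h + C h ^ 2] on arbitrarily fine partitions add up to
    [B T]: the discrete form of the mean value inequality, which spares the
    differentiation of infinite sums. *)
Lemma hb_subdivision (F : R -> int -> R[i]) (T B C : R) : 0 <= T -> 0 <= B -> 0 <= C ->
  (forall s h, 0 <= s -> 0 <= h -> s + h <= T ->
     hb sg (fun l => cmod (F (s + h) l - F s l)) (B * h + C * h ^+ 2)) ->
  hb sg (fun l => cmod (F T l - F 0 l)) (B * T).
Proof.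
move=> T0 B0 C0 h.
have key n k : (k <= n.+1)%N -> let d := T / n.+1%:R in
    hb sg (fun l => cmod (F (k%:R * d) l - F 0 l)) (k%:R * (B * d + C * d ^+ 2)).
  move=> + d; have d0 : 0 <= d by rewrite divr_ge0.
  elim: k => [_|k IH kn].
    rewrite !mul0r; split => // q uq; rewrite big1 ?sqr_ge0// => l _.
    by rewrite subrr cmod0 expr0n mulr0.
  have kd : k%:R * d + d <= T.
    rewrite -[X in _ + X]mul1r -mulrDl natr1 /d mulrCA ler_piMr//.
    by rewrite ler_pdivrMr ?ltr0n// mul1r ler_nat.
  have := h (k%:R * d) d (mulr_ge0 (ler0n _ _) d0) d0 kd.
  move=> h1; have h2 := hb_cmodD (IH (ltnW kn)) h1.
  apply: (hb_le (hb_ext _ h2)); last by rewrite -natr1; lra.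
  by move=> l; rewrite /= -natr1 mulrDl mul1r addrC subrKA.
apply: hb_closed => [|e e0]; first exact: mulr_ge0.
(* Fine enough for the sum of the quadratic terms to be at most [e]. *)
pose n := Num.truncn (C * T ^+ 2 / e).
have hn : C * T ^+ 2 / e < n.+1%:R by rewrite truncnS_gt.
have n0 : 0 < (n.+1%:R : R) by rewrite ltr0n.
apply: (hb_le (hb_ext _ (key n n.+1 (leqnn _)))) => [l|].
  by rewrite mulrC divfK ?gt_eqF.
have -> : n.+1%:R * (B * (T / n.+1%:R) + C * (T / n.+1%:R) ^+ 2) =
          B * T + C * T ^+ 2 / n.+1%:R.
  by field; rewrite gt_eqF.
rewrite lerD2l ler_pdivrMr//; move: hn; rewrite ltr_pdivrMr// => /ltW.
by rewrite (mulrC e).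
Qed.

End Closedness.

(** For a solution bounded by [M] in [H^(sg + 1)], the twisted solution moves
    at a rate at most [eps * G] in [H^(sg + 1)], and this rate is Lipschitz in
    [H^sg] with constant [eps * L]. *)
Definition local_const (R : realType) (sg M : R) : R :=
  let G := alg_const (sg + 1) * M ^+ 2 in
  let L := 2 * alg_const sg * M ^+ 2 + 2 * alg_const sg * G * M in
  4 * alg_const sg * G * M + 2 * alg_const sg * L * M + alg_const sg * G ^+ 2.

Lemma local_const_ge0 (R : realType) (sg M : R) : 1 / 2 < sg -> 0 <= M ->
  0 <= local_const sg M.
Proof.
move=> sg12 M0; have A0 := ltW (alg_const_gt0 sg12).
have A1 : 0 <= alg_const (sg + 1) by apply/ltW/alg_const_gt0; lra.
by rewrite /local_const; nonneg.
Qed.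

Section LocalError.
Variables (R : realType) (sg eps tau M : R) (v : R -> int -> R[i]).
Hypotheses (sg12 : 1 / 2 < sg) (eps01 : 0 < eps <= 1) (tau0 : 0 <= tau).

(** Integral over [[0, s]] of the nonlinearity in the rotating frame, with its
    arguments kept fixed. *)
Definition Phi (s : R) (a b : int -> R[i]) : int -> R[i] :=
  zconv (fun j m => phase_int s j m * (a j * b m)).

Definition twisted_rhs (s : R) (a : int -> R[i]) (l : int) : R[i] :=
  - 'i * eps%:C * zconv (fun j m => phase s j m * (a j * a m)) l.

Let g s := twisted_rhs s (v s).

Hypothesis v_cont : forall l, ccontinuous_on `[0, tau] (v^~ l).
Hypothesis v_der : forall t l, 0 < t < tau -> is_cderive (v^~ l) t (g t l).
Hypothesis v_bound : forall t, 0 <= t <= tau -> hb (sg + 1) |: v t :| M.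

Let G := alg_const (sg + 1) * M ^+ 2.
Let L := 2 * alg_const sg * M ^+ 2 + 2 * alg_const sg * G * M.

Let sg1 : 1 / 2 < sg + 1. Proof. by move: sg12; lra. Qed.
Let eps0 : 0 <= eps. Proof. by move: eps01 => /andP[/ltW]. Qed.
Let eps1 : eps <= 1. Proof. by move: eps01 => /andP[]. Qed.
Let M0 : 0 <= M.
Proof. by have [] := v_bound (t := 0) (introT andP (conj (lexx _) tau0)). Qed.
Let K0 : 0 <= alg_const sg. Proof. exact/ltW/alg_const_gt0. Qed.
Let K1 : 0 <= alg_const (sg + 1). Proof. exact/ltW/alg_const_gt0. Qed.
Let G0 : 0 <= G. Proof. by rewrite mulr_ge0// sqr_ge0. Qed.
Let L0 : 0 <= L.
Proof. by rewrite /L; nonneg. Qed.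

Let v_bound0 t : 0 <= t <= tau -> hb sg |: v t :| M.
Proof. by move=> /v_bound; apply: hb_weaken; rewrite lerDl. Qed.

Let cmod_ieps : cmod (- 'i * eps%:C) = eps.
Proof. by rewrite cmodM cmodN cmodi mul1r cmodR ger0_norm. Qed.

Let g_bound t : 0 <= t <= tau -> hb (sg + 1) |: g t :| (eps * G).
Proof.
move=> ht; rewrite -cmod_ieps; apply: hb_cmodZ.
rewrite -[G]mul1r /G expr2; have hv := v_bound ht.
apply: (proj1 (kb_mul sg1 ler01 _ hv hv)) => j m.
by rewrite cmod_phase.
Qed.

Let mean_value (rho B s t : R) (f df : R -> int -> R[i]) :
  0 <= s -> s <= t -> t <= tau -> 0 <= B ->
  (forall l, ccontinuous_on `[s, t] (f^~ l)) ->
  (forall x l, s < x < t -> is_cderive (f^~ l) x (df x l)) ->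
  (forall x, s < x < t -> hb rho |: df x :| B) ->
  hb rho |: fun l => f t l - f s l :| (B * (t - s)).
Proof.
move=> s0 st tT B0 cf hf hB; split; first by rewrite mulr_ge0// subr_ge0.
move=> q uq; under eq_bigr do rewrite sqr_cmod.
apply: (@mean_value_seq _ _ q (wt rho) f df s t B) => //.
  by move=> l; exact: wt_ge0.
by move=> x hx; under eq_bigr do rewrite -sqr_cmod; have [_] := hB x hx; exact.
Qed.

Let v_cont_sub s t l : 0 <= s -> t <= tau -> ccontinuous_on `[s, t] (v^~ l).
Proof.
move=> s0 tT; have [h1 h2] := v_cont l.
by split; [apply: continuous_subspaceW h1|apply: continuous_subspaceW h2];
  apply: subset_itv; rewrite bnd_simp.
Qed.

Let v_lip s t : 0 <= s -> s <= t -> t <= tau ->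
  hb (sg + 1) |: fun l => v t l - v s l :| (eps * G * (t - s)).
Proof.
move=> s0 st tT; apply: (@mean_value _ _ s t v g s0 st tT).
- by nonneg.
- by move=> l; exact: v_cont_sub.
- by move=> x l /andP[sx xt]; apply: v_der; rewrite (le_lt_trans s0)//= (lt_le_trans xt).
- by move=> x /andP[sx xt]; apply: g_bound; rewrite (le_trans s0) ?ltW//= (lt_le_trans xt).
Qed.

(** Time acts through the phases, which cost one derivative on each argument
    and give the first term of [L], and through [v], which gives the second. *)
Let g_lip s t : 0 <= s -> s <= t -> t <= tau ->
  hb sg |: fun l => g t l - g s l :| (eps * L * (t - s)).
Proof.
move=> s0 st tT.
have hs : 0 <= s <= tau by rewrite s0 (le_trans st).
have ht : 0 <= t <= tau by rewrite tT (le_trans s0).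
have ts0 : 0 <= t - s by rewrite subr_ge0.
have hd : hb sg |: fun l => v t l - v s l :| (eps * G * (t - s)).
  by apply: hb_weaken (v_lip s0 st tT); rewrite lerDl.
have one (x : R) j m : cmod (phase x j m) <= 1 by rewrite cmod_phase.
have k1 : kb sg (fun j m => (phase t j m - phase s j m) * (v t j * v t m))
    (2 * (t - s) * (alg_const sg * (M * M))).
  apply: kb_mul_deriv => //; [by rewrite mulr_ge0| |exact: v_bound|exact: v_bound].
  by move=> j m; rewrite -(ger0_norm ts0); exact: phase_lip.
have k2 := kb_mul sg12 ler01 (one s) hd (v_bound0 ht).
have k3 := kb_mul sg12 ler01 (one s) (v_bound0 hs) hd.
have kt := kb_mul sg12 ler01 (one t) (v_bound0 ht) (v_bound0 ht).
have ks := kb_mul sg12 ler01 (one s) (v_bound0 hs) (v_bound0 hs).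
have [hk _] := kbD k1 (kbD k2 k3).
have hsum := hb_cmodZ (- 'i * eps%:C) hk.
apply: (hb_le (hb_ext _ hsum)); last first.
  rewrite cmod_ieps -[leRHS]mulrA ler_wpM2l// /L.
  set A := alg_const sg; have A0 : 0 <= A by [].
  have : eps * (2 * (t - s) * A * G * M) <= 1 * (2 * (t - s) * A * G * M).
    by rewrite ler_wpM2r//; nonneg.
  by lra.
move=> l; rewrite /= -[RHS]mulrBr; congr (_ * _).
rewrite -[- zconv _ _ in RHS]mulN1r -(zconvZ _ ks) -(zconvD kt (kbZ (-1) ks)).
apply: csum_ext => j; ring.
Qed.

(** The derivative [g x - g y] of [v - x * g y] is at most
    [eps * L * (t - s)]. The expansion is needed at both ends of the interval. *)
Let v_taylor s t y : 0 <= s -> s <= y <= t -> t <= tau ->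
  hb sg |: fun l => v t l - v s l - (t - s)%:C * g y l :| (eps * L * (t - s) ^+ 2).
Proof.
move=> s0 /andP[sy yt] tT; have st := le_trans sy yt.
pose f x l := v x l - x%:C * g y l; pose df x l := g x l - g y l.
have ts0 : 0 <= t - s by rewrite subr_ge0.
have B0 : 0 <= eps * L * (t - s) by nonneg.
have h := @mean_value sg (eps * L * (t - s)) s t f df s0 st tT B0.
have -> : eps * L * (t - s) ^+ 2 = eps * L * (t - s) * (t - s) by ring.
apply: (hb_ext _ (h _ _ _)).
- by move=> l; rewrite /f rmorphB/=; ring.
- move=> l; apply: ccontinuous_onB; first exact: v_cont_sub.
  exact: (ccontinuous_is_cderive _ (is_cderive_id_scale (g y l))).
- move=> x l /andP[sx xt]; apply: is_cderiveB; last exact: is_cderive_id_scale.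
  by apply: v_der; rewrite (le_lt_trans s0)//= (lt_le_trans xt).
- move=> x /andP[sx xt]; have [yx|/ltW xy] := leP y x.
    apply: (hb_le (g_lip _ yx _)).
    + exact: le_trans sy.
    + exact: le_trans (ltW xt) tT.
    + by rewrite ler_wpM2l ?mulr_ge0// lerB// ltW.
  apply: (hb_le (hb_ext (a := fun l => -1 * (g y l - g x l)) _ (hb_cmodZ (-1) (g_lip _ xy _)))).
  + by move=> l; rewrite mulN1r opprB.
  + exact: le_trans (ltW sx).
  + exact: le_trans yt tT.
  + by rewrite cmodN cmod1 mul1r ler_wpM2l ?mulr_ge0// lerB// ltW.
Qed.

Let F (s : R) (l : int) : R[i] :=
  v s l + 'i * (eps / 2)%:C * (Phi s (v 0) (v 0) l + Phi s (v s) (v s) l).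

Let B := tau ^+ 2 * (4 * alg_const sg * G * M + 2 * alg_const sg * L * M +
                     alg_const sg * G ^+ 2).
Let C := eps * L + 4 * alg_const sg * M ^+ 2 + 4 * alg_const sg * G * M +
  tau * alg_const sg * G ^+ 2 + 2 * tau * alg_const sg * L * M.

Let B0 : 0 <= B. Proof. by rewrite /B; nonneg. Qed.
Let C0 : 0 <= C. Proof. by rewrite /C; nonneg. Qed.

(** The trapezoidal rule with exact phases: in the increment of [F] the terms
    linear in [h] combine into the defect of a first-order expansion of the
    quadratic term, which is of size [eps * s ^ 2]; the remaining terms are
    quadratic in [h]. *)
Let F_increment s h : 0 <= s -> 0 <= h -> s + h <= tau ->
  hb sg |: fun l => F (s + h) l - F s l :| (eps ^+ 2 * B * h + C * h ^+ 2).
Proof.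
move=> s0 h0 shT.
have sT : s <= tau by apply: le_trans shT; rewrite lerDl.
have s_in : 0 <= s <= tau by rewrite s0.
have z_in : 0 <= (0 : R) <= tau by rewrite lexx.
have sh_in : 0 <= s + h <= tau by rewrite shT addr_ge0.
have ssh : s <= s + h by rewrite lerDl.
have hb_sub a X : hb (sg + 1) |: a :| X -> hb sg |: a :| X.
  by apply: hb_weaken; rewrite lerDl.
set a := v 0; set x := v s; set x' := v (s + h); set gs := g s.
have ha1 := v_bound z_in; rewrite -/a in ha1; have ha := hb_sub _ _ ha1.
have hx1 := v_bound s_in; rewrite -/x in hx1; have hx := hb_sub _ _ hx1.
have hx'1 := v_bound sh_in; rewrite -/x' in hx'1; have hx' := hb_sub _ _ hx'1.
have hg1 := g_bound s_in; rewrite -/gs in hg1.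
pose d l := x' l - x l.
have hd : hb sg |: d :| (eps * G * h).
  by apply: hb_sub; have := v_lip s0 ssh shT; rewrite addrAC subrr add0r.
pose d2 l := d l - h%:C * gs l.
have hd2 : hb sg |: d2 :| (eps * L * h ^+ 2).
  have : s <= s <= s + h by rewrite lexx.
  by move=> /(v_taylor s0)/(_ shT); rewrite addrAC subrr add0r.
pose y l := x l - a l.
have hy : hb sg |: y :| (eps * G * s).
  by apply: hb_sub; have := v_lip (lexx 0) s0 sT; rewrite subr0.
pose z l := y l - s%:C * gs l.
have hz : hb sg |: z :| (eps * L * s ^+ 2).
  have : 0 <= s <= s by rewrite s0 lexx.
  by move=> /(v_taylor (lexx 0))/(_ sT); rewrite subr0.
pose e := @phase R s.
have one j m : cmod (e j m) <= 1 by rewrite cmod_phase.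
have phs j m : cmod (phase_int s j m) <= s by rewrite (le_trans (cmod_phase_int _ _ _))// ger0_norm.
have phsh j m : cmod (phase_int (s + h) j m) <= s + h.
  by rewrite (le_trans (cmod_phase_int _ _ _))// ger0_norm// addr_ge0.
pose w j m := phase_int (s + h) j m - phase_int s j m - h%:C * e j m.
have hw j m : cmod (w j m) <= 2 * h ^+ 2 * (`|j%:~R| * `|m%:~R|).
  exact: phase_int_taylor_at.
pose w' j m := phase_int s j m - s%:C * e j m.
have hw' j m : cmod (w' j m) <= 2 * s ^+ 2 * (`|j%:~R| * `|m%:~R|).
  exact: phase_int_taylor_end.
have h20 : 0 <= 2 * h ^+ 2 by nonneg.
have s20 : 0 <= 2 * s ^+ 2 by nonneg.
(* [q1] to [q5] are quadratic in [h]. [q6] to [q8] are linear in [h] and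
   quadratic in [s]: the terms in [h * s * gs * x] cancel between the increment
   of [v * v], integrated against [phase_int s], and [a * a = (x - y) * (x - y)]. *)
have q1 := kb_mul_deriv sg12 h20 hw ha1 ha1.
have q2 := kb_mul_deriv sg12 h20 hw hx'1 hx'1.
have q3 := kbZ h%:C (kbD (kb_mul sg12 ler01 one hd hx') (kb_mul sg12 ler01 one hx hd)).
have q4 := kb_mul sg12 s0 phs hd hd.
have q5 := kbD (kb_mul sg12 s0 phs hd2 hx) (kb_mul sg12 s0 phs hx hd2).
have q6 := kbZ h%:C (kbD (kb_mul_deriv sg12 s20 hw' hg1 hx1)
                         (kb_mul_deriv sg12 s20 hw' hx1 hg1)).
have q7 := kbZ (- h%:C) (kbD (kb_mul sg12 ler01 one hz hx) (kb_mul sg12 ler01 one hx hz)).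
have q8 := kbZ h%:C (kb_mul sg12 ler01 one hy hy).
have [hq _] := kbD q1 (kbD q2 (kbD q3 (kbD q4 (kbD q5 (kbD q6 (kbD q7 q8)))))).
have hF := hb_cmodD hd2 (hb_cmodZ ('i * (eps / 2)%:C) hq).
have p1 := kb_mul sg12 (addr_ge0 s0 h0) phsh ha ha.
have p2 := kb_mul sg12 s0 phs ha ha.
have p3 := kb_mul sg12 (addr_ge0 s0 h0) phsh hx' hx'.
have p4 := kb_mul sg12 s0 phs hx hx.
have p5 := kb_mul sg12 ler01 one hx hx.
apply: (hb_le (hb_ext _ hF)) => [l|].
  rewrite /F /Phi -/a -/x -/x'.
  have -> : d2 l = x' l - x l - h%:C * gs l by [].
  set Q := zconv _ l.
  have -> : Q = zconv (fun j m => phase_int (s + h) j m * (a j * a m)) l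
    - zconv (fun j m => phase_int s j m * (a j * a m)) l
    + (zconv (fun j m => phase_int (s + h) j m * (x' j * x' m)) l
    - zconv (fun j m => phase_int s j m * (x j * x m)) l)
    - (2 * h)%:C * zconv (fun j m => e j m * (x j * x m)) l.
    have k12 := kbB p1 p2; have k34 := kbB p3 p4.
    have k := kbD k12 k34; have k5 := kbZ (2 * h)%:C p5.
    rewrite -(zconvB p1 p2) -(zconvB p3 p4) -(zconvD k12 k34).
    rewrite -(zconvZ _ p5) -(zconvB k k5).
    apply: csum_ext => j; rewrite /z /y /d2 /d /w /w' rmorphM/=.
    have -> : 2%:C = 2 :> R[i] by rewrite rmorph_nat.
    ring.
  rewrite /gs /g /twisted_rhs -/x -/e.
  have -> : (2 * h)%:C = 2 * h%:C :> R[i] by rewrite rmorphM/= rmorph_nat.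
  have -> : (eps / 2)%:C = eps%:C / 2 :> R[i] by rewrite fmorph_div/= rmorph_nat.
  by field.
rewrite cmodM cmodi mul1r !cmodR ?cmodN ?cmodR (ger0_norm h0) ger0_norm; last first.
  by rewrite divr_ge0.
rewrite /B /C; move: (alg_const sg) K0 => A A0.
have pw n : eps ^+ n <= 1 by exact: exprn_ile1.
have sT2 : s ^+ 2 <= tau ^+ 2 by rewrite ler_pXn2r.
have st n : s * eps ^+ n <= tau.
  by rewrite -[leRHS]mulr1 ler_pM// exprn_ge0.
have P2 : 0 <= A * G * M by nonneg.
have P3 : 0 <= A * G * G by nonneg.
have P4 : 0 <= A * L * M by nonneg.
have h2 : 0 <= h ^+ 2 by nonneg.
have eh : 0 <= eps ^+ 2 * h by nonneg.
have t1 : eps ^+ 1 * (h ^+ 2 * (A * M * M)) <= 1 * (h ^+ 2 * (A * M * M)).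
  by rewrite ler_wpM2r//; nonneg.
have t2 : eps ^+ 2 * (h ^+ 2 * (A * G * M)) <= 1 * (h ^+ 2 * (A * G * M)).
  by rewrite ler_wpM2r//; nonneg.
have t3 : s * eps ^+ 3 * (h ^+ 2 * (A * G * G)) <= tau * (h ^+ 2 * (A * G * G)).
  by rewrite ler_wpM2r//; nonneg.
have t4 : s * eps ^+ 2 * (h ^+ 2 * (A * L * M)) <= tau * (h ^+ 2 * (A * L * M)).
  by rewrite ler_wpM2r//; nonneg.
have t5 : s ^+ 2 * (eps ^+ 2 * h * (A * G * M)) <= tau ^+ 2 * (eps ^+ 2 * h * (A * G * M)).
  by rewrite ler_wpM2r//; nonneg.
have t6 : s ^+ 2 * (eps ^+ 2 * h * (A * L * M)) <= tau ^+ 2 * (eps ^+ 2 * h * (A * L * M)).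
  by rewrite ler_wpM2r//; nonneg.
have t7 : (eps * s ^+ 2) * (eps ^+ 2 * h * (A * G * G)) <= tau ^+ 2 * (eps ^+ 2 * h * (A * G * G)).
  rewrite ler_wpM2r//; first by nonneg.
  by rewrite -[leRHS]mul1r ler_pM//; nonneg.
have r1 : 0 <= h ^+ 2 * (A * M * M) by nonneg.
have r2 : 0 <= h ^+ 2 * (A * G * M) by nonneg.
have r3 : 0 <= tau * (h ^+ 2 * (A * G * G)) by nonneg.
have r4 : 0 <= tau * (h ^+ 2 * (A * L * M)) by nonneg.
have r5 : 0 <= tau ^+ 2 * (eps ^+ 2 * h * (A * G * M)) by nonneg.
have r6 : 0 <= tau ^+ 2 * (eps ^+ 2 * h * (A * L * M)) by nonneg.
have r7 : 0 <= tau ^+ 2 * (eps ^+ 2 * h * (A * G * G)) by nonneg.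
move: (G) (L) t1 t2 t3 t4 t5 t6 t7 r1 r2 r3 r4 r5 r6 r7 => G' L' *.
lra.
Qed.

(** The total increment of [F] over the step is the defect of the trapezoidal
    relation, since [Phi] vanishes at time [0]. *)
Lemma local_error :
  hb sg |: fun l => v tau l - v 0 l +
     'i * (eps / 2)%:C * (Phi tau (v 0) (v 0) l + Phi tau (v tau) (v tau) l) :|
     (local_const sg M * eps ^+ 2 * tau ^+ 3).
Proof.
have e0 : 0 <= eps ^+ 2 * B by nonneg.
have := hb_subdivision tau0 e0 C0 F_increment.
have -> : eps ^+ 2 * B * tau = local_const sg M * eps ^+ 2 * tau ^+ 3.
  by rewrite /B /local_const -/G -/L; ring.
apply: hb_ext => l; rewrite /F.
have P0 a b : Phi 0 a b l = 0.
  rewrite /Phi /zconv (@csum_finite _ _ [::])// ?big_nil// => j _.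
  by rewrite phase_int0 mul0r.
by rewrite !P0 addr0 mulr0 addr0 addrAC.
Qed.

End LocalError.

(** * Stability and solvability of a step *)

Section GeometricConvergence.
Variable R : realType.

Lemma geometric_ccvg (z : nat -> R[i]) (B : R) :
  (forall n, cmod (z n.+1 - z n) <= B * 2^-1 ^+ n) -> exists zl : R[i], ccvg z zl.
Proof.
move=> h.
have key (f : nat -> R) : (forall n, `|f n.+1 - f n| <= B * 2^-1 ^+ n) ->
    cvgn f.
  move=> hf.
  have cs : cvgn (series (fun n => f n.+1 - f n)).
    apply: normed_cvg; apply: (@series_le_cvg _ _ (fun n => B * 2^-1 ^+ n)) => //.
    - by move=> n; exact: normr_ge0.
    - by move=> n; exact: le_trans (hf n).
    - apply: (@is_cvg_geometric_series _ B 2^-1).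
      by rewrite ger0_norm// invf_lt1// ltr1n.
  have -> : f = (fun n => f 0%N + series (fun n => f n.+1 - f n) n).
    apply/funext => n; rewrite /series/= telescope_sumr//.
    by rewrite addrC subrK.
  by apply: is_cvgD => //; exact: is_cvg_cst.
have c1 : cvgn (fun n => complex.Re (z n)).
  by apply: key => n; rewrite -cReB (le_trans (normr_Re _)).
have c2 : cvgn (fun n => complex.Im (z n)).
  by apply: key => n; rewrite -cImB (le_trans (normr_Im _)).
exists (limn (fun n => complex.Re (z n)) +i* limn (fun n => complex.Im (z n))).
apply: (@ccvg_le _ _ _ (fun n => `|complex.Re (z n) - limn (fun n => complex.Re (z n))| +
  `|complex.Im (z n) - limn (fun n => complex.Im (z n))|)).
  by move=> n; rewrite (le_trans (cmod_le_ReIm _))// cReB cImB.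
by rewrite -[X in _ --> X]addr0; apply: cvgD; apply: cvg_dist0.
Qed.

End GeometricConvergence.

Section Scheme.
Variables (R : realType) (sg eps tau K : R).
Hypotheses (sg12 : 1 / 2 < sg) (eps0 : 0 <= eps) (tau0 : 0 <= tau).
Implicit Types (a b u w x y : int -> R[i]).

(** The integrator in the rotating frame: [b] is the new value multiplied by
    the inverse flow, after which [u] and [b] enter the quadratic term alike. *)
Definition twisted_step u b := forall l,
  b l = u l - 'i * (eps / 2)%:C * (Phi tau u u l + Phi tau b b l).

Let A := alg_const sg.
Let A0 : 0 <= A. Proof. exact/ltW/alg_const_gt0. Qed.

Let phase_int_tau j m : cmod (phase_int tau j m) <= tau.
Proof. by rewrite (le_trans (cmod_phase_int _ _ _))// ger0_norm. Qed.

Lemma Phi_bound x y X Y : hb sg |: x :| X -> hb sg |: y :| Y ->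
  hb sg |: Phi tau x y :| (tau * (A * (X * Y))).
Proof. by move=> hx hy; have [] := kb_mul sg12 tau0 phase_int_tau hx hy. Qed.

Lemma Phi_diff x y X : hb sg |: x :| K -> hb sg |: y :| K ->
  hb sg |: fun l => x l - y l :| X ->
  hb sg |: fun l => Phi tau x x l - Phi tau y y l :| (2 * (tau * (A * (K * X)))).
Proof.
move=> hx hy hd.
have kx := kb_mul sg12 tau0 phase_int_tau hx hx.
have ky := kb_mul sg12 tau0 phase_int_tau hy hy.
have k1 := kb_mul sg12 tau0 phase_int_tau hd hx.
have k2 := kb_mul sg12 tau0 phase_int_tau hy hd.
have [hk _] := kbD k1 k2.
apply: (hb_le (hb_ext _ hk)); last by rewrite -/A; lra.
move=> l; rewrite /Phi -(zconvB kx ky); apply: csum_ext => j; ring.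
Qed.

Let x0 := eps * tau * A * K.

Lemma cmod_ieps2 : cmod ('i * (eps / 2)%:C) = eps / 2.
Proof. by rewrite cmodM cmodi mul1r cmodR ger0_norm// divr_ge0. Qed.

(** The error of the new value occurs on both sides of the implicit relation;
    it is absorbed because the nonlinear term carries the factor [eps * tau]. *)
Lemma stability u b w0 w1 E d : x0 <= 1 / 2 -> 0 <= E -> 0 <= d ->
  hb sg |: u :| K -> hb sg |: b :| K -> hb sg |: w0 :| K -> hb sg |: w1 :| K ->
  twisted_step u b ->
  hb sg |: fun l => w1 l - w0 l +
    'i * (eps / 2)%:C * (Phi tau w0 w0 l + Phi tau w1 w1 l) :| d ->
  hb sg |: fun l => w0 l - u l :| E ->
  hb sg |: fun l => w1 l - b l :| ((1 + 4 * x0) * E + 2 * d).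
Proof.
move=> x12 E0 d0 hu hb_ hw0 hw1 hstep hd hE.
have K0 := hb_ge0 hu.
have x00 : 0 <= x0 by rewrite /x0; nonneg.
apply: (hb_le (@hb_absorb _ _ _ (K + K) (E * (1 + x0) + d) x0 _ _ _ _)).
- by nonneg.
- by rewrite x00/=; lra.
- exact: hb_cmodB.
- move=> X hX.
  have h0 := Phi_diff hw0 hu hE; have h1 := Phi_diff hw1 hb_ hX.
  have h := hb_cmodD (hb_cmodB hE (hb_cmodZ ('i * (eps / 2)%:C) (hb_cmodD h0 h1))) hd.
  apply: (hb_le (hb_ext _ h)) => [l|].
    by rewrite [b l]hstep; ring.
  by rewrite cmod_ieps2 /x0; lra.
- rewrite ler_pdivrMr; last by lra.
  have hx : 0 <= (1 / 2 - x0) * (x0 * E) by apply: mulr_ge0; [lra|nonneg].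
  have hx2 : 0 <= (1 / 2 - x0) * d by apply: mulr_ge0; [lra|].
  by nra.
Qed.

Hypothesis x12 : x0 <= 1 / 2.

(** Picard iteration in the ball of radius [K]. *)
Lemma step_exists u U : hb sg |: u :| U -> U + eps * tau * A * K ^+ 2 <= K ->
  exists b, hb sg |: b :| K /\ twisted_step u b.
Proof.
move=> hu hUK; have U0 := hb_ge0 hu.
have K0 : 0 <= K.
  by apply: le_trans hUK; rewrite addr_ge0// mulr_ge0 ?sqr_ge0//; nonneg.
have x00 : 0 <= x0 by rewrite /x0; nonneg.
have UK : U <= K.
  by apply: le_trans hUK; rewrite lerDl mulr_ge0 ?sqr_ge0//; nonneg.
pose S b l := u l - 'i * (eps / 2)%:C * (Phi tau u u l + Phi tau b b l).
have S_ball b : hb sg |: b :| K -> hb sg |: S b :| K.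
  move=> hb_; have h := hb_cmodB hu (hb_cmodZ ('i * (eps / 2)%:C)
    (hb_cmodD (Phi_bound (hb_le hu UK) (hb_le hu UK)) (Phi_bound hb_ hb_))).
  by apply: (hb_le h); rewrite cmod_ieps2; move: hUK; lra.
have S_lip b b' X : hb sg |: b :| K -> hb sg |: b' :| K ->
    hb sg |: fun l => b l - b' l :| X ->
    hb sg |: fun l => S b l - S b' l :| (2^-1 * X).
  move=> hb1 hb2 hX; have X0 := hb_ge0 hX.
  have h := hb_cmodZ (- ('i * (eps / 2)%:C)) (Phi_diff hb1 hb2 hX).
  apply: (hb_le (hb_ext _ h)) => [l|]; first by rewrite /S; ring.
  rewrite cmodN cmod_ieps2.
  have : x0 * X <= 1 / 2 * X by rewrite ler_wpM2r.
  by rewrite /x0; lra.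
(* The iterates contract by the factor [1 / 2] and converge entrywise; the
   bounds pass to the limit. *)
pose bs n := iter n S (fun=> 0).
have hb0 : hb sg |: bs 0%N :| K.
  by split=> // q uq; rewrite big1 ?sqr_ge0// => l _; rewrite /= cmod0 expr0n mulr0.
have hbs n : hb sg |: bs n :| K by elim: n => [//|n IH]; exact: S_ball.
have hdiff n : hb sg |: fun l => bs n.+1 l - bs n l :| (K * 2^-1 ^+ n).
  elim: n => [|n IH].
    rewrite expr0 mulr1; apply: (hb_ext _ (hbs 1%N)) => l.
    by rewrite /bs/= subr0.
  by rewrite exprS mulrCA; exact: (S_lip (bs n.+1) (bs n) _ (hbs _) (hbs _) IH).
have hdiffk n k : hb sg |: fun l => bs (n + k)%N l - bs n l :|
    (2 * K * 2^-1 ^+ n * (1 - 2^-1 ^+ k)).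
  elim: k => [|k IH].
    rewrite addn0 expr0 subrr mulr0; split=> // q uq.
    by rewrite big1 ?sqr_ge0// => l _; rewrite subrr cmod0 expr0n mulr0.
  have h := hb_cmodD (hdiff (n + k)%N) IH.
  apply: (hb_le (hb_ext _ h)) => [l|]; first by rewrite addnS subrKA.
  rewrite exprD exprS; set p := _ ^+ n; set q := _ ^+ k.
  by rewrite le_eqVlt; apply/orP; left; apply/eqP; field.
have s0 : 0 <= sg by move: sg12; lra.
have lim_ex l : exists zl : R[i], ccvg (fun n => bs n l) zl.
  by apply: (@geometric_ccvg _ _ K) => n; exact: (hb_term l s0 (hdiff n)).
have [b hlim] := choice lim_ex.
have hbK : hb sg |: b :| K.
  by apply: (hb_lim hbs) => l; exact: ccvg_cmod.
have hbd n : hb sg |: fun l => b l - bs n l :| (2 * K * 2^-1 ^+ n).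
  apply: (@hb_lim _ _ (fun k l => cmod (bs (n + k)%N l - bs n l))).
    move=> k; apply: (hb_le (hdiffk n k)).
    have q0 i : 0 <= (2^-1 : R) ^+ i by rewrite exprn_ge0// invr_ge0.
    by apply: ler_piMr; [have := q0 n; nonneg|have := q0 k; lra].
  move=> l; apply: ccvg_cmod; apply: (@ccvg_le _ _ _ (fun k => cmod (bs (k + n)%N l - b l))).
    by move=> k; rewrite addnC opprB addrA subrK.
  by have := hlim l; rewrite /ccvg -(cvg_shiftn n).
exists b; split => // l.
apply/eqP; rewrite -subr_eq0; apply/eqP/cmod_eq0/eqP; rewrite eq_le cmod_ge0 andbT.
have : (fun n => 2 * K * 2^-1 ^+ n) @ \oo --> (0 : R).
  rewrite -[X in _ --> X](mulr0 (2 * K)); apply: cvgM; first exact: cvg_cst.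
  by apply: cvg_expr; rewrite ger0_norm// invf_lt1// ltr1n.
move=> /cvgr_to_ge; apply; apply: nearW => n.
have hbd' : hb sg |: fun l => bs n l - b l :| (2 * K * 2^-1 ^+ n).
  by apply: hb_mono (hbd n) => k; rewrite cmod_ge0 cmod_distC/=.
have h1 := hb_cmodD (hbd n.+1) (S_lip _ _ _ (hbs n) hbK hbd').
have := hb_term l s0 h1; rewrite /= subrKA => h2.
by apply: (le_trans h2); rewrite exprS le_eqVlt; apply/orP; left; apply/eqP; field.
Qed.

End Scheme.

Section Gronwall.
Variable R : realType.

(** A supersolution of [e (n + 1) = (1 + 4 * x) * e n + 2 * d], [e 0 = 0]. *)
Definition gronwall_bound (x d : R) n := n%:R * (2 * d) * (1 + 4 * x) ^+ n.

Lemma gronwall_bound_ge0 x d n : 0 <= x -> 0 <= d -> 0 <= gronwall_bound x d n.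
Proof.
move=> x0 d0; rewrite /gronwall_bound mulr_ge0//; first by nonneg.
by apply: exprn_ge0; nonneg.
Qed.

Lemma gronwall_step x d n : 0 <= x -> 0 <= d ->
  (1 + 4 * x) * gronwall_bound x d n + 2 * d <= gronwall_bound x d n.+1.
Proof.
move=> x0 d0; rewrite /gronwall_bound -[n.+1%:R]natr1.
have : 1 <= (1 + 4 * x) ^+ n.+1 by apply: exprn_ege1; lra.
rewrite exprS; move: (_ ^+ n) (n%:R) => P k y1.
have : 2 * d * 1 <= 2 * d * ((1 + 4 * x) * P) by rewrite ler_wpM2l// mulr_ge0.
by lra.
Qed.

Lemma gronwall_bound_le x d n X D : 0 <= x -> 0 <= d ->
  n%:R * (4 * x) <= X -> n%:R * (2 * d) <= D -> gronwall_bound x d n <= D * expR X.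
Proof.
move=> x0 d0 hX hD; rewrite /gronwall_bound ler_pM//; first by nonneg.
  by apply: exprn_ge0; nonneg.
apply: (@le_trans _ _ (expR (4 * x) ^+ n)).
  rewrite lerXn2r ?nnegrE ?expR_ge0 ?expR_ge1Dx//; nonneg.
by rewrite -expRM_natl ler_expR.
Qed.

End Gronwall.

(** * Integrals over the torus *)

Section ComplexIntegral.
Variable R : realType.
Implicit Types (f g : R -> R[i]) (x y : R) (c : R[i]) (l k : int) (B : R).

Local Notation mu := (@lebesgue_measure R).
Local Notation I := (@torus R).

Lemma measurable_torus : measurable (I : set (measurableTypeR R)).
Proof. exact: measurable_itv. Qed.

Lemma measure_torus : mu I = (2 * pi)%:E.
Proof.
rewrite lebesgue_measure_itv/= lte_fin.
have := pi_gt0 R => p0; rewrite ifT; last by lra.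
by rewrite -EFinB; congr _%:E; ring.
Qed.

Lemma measure_torus_lty : (mu I < +oo)%E.
Proof. by rewrite measure_torus ltry. Qed.

Definition cmeas f :=
  measurable_fun (I : set (measurableTypeR R)) (fun x => complex.Re (f x)) /\
  measurable_fun (I : set (measurableTypeR R)) (fun x => complex.Im (f x)).

Definition cint f := mu.-integrable I (EFin \o (fun x => complex.Re (f x))) /\
  mu.-integrable I (EFin \o (fun x => complex.Im (f x))).

Definition cbounded f := exists B, forall x, I x -> cmod (f x) <= B.

Lemma cint_meas f : cint f -> cmeas f.
Proof.
by move=> [h1 h2]; split; [have := measurable_int _ h1|have := measurable_int _ h2];
  move=> /measurable_EFinP.
Qed.

Lemma bounded_le (h : R -> R) B : (forall x, I x -> `|h x| <= B) ->
  [bounded h x | x in I].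
Proof.
move=> hB; exists B; split; first exact: num_real.
by move=> M BM x Ix; rewrite /= (le_trans (hB x Ix))// ltW.
Qed.

Lemma cint_bounded f : cmeas f -> cbounded f -> cint f.
Proof.
move=> [m1 m2] [B hB].
have foo := measure_torus_lty.
split; apply: measurable_bounded_integrable => //; try exact: measurable_torus.
- by apply: (@bounded_le _ B) => x Ix; rewrite (le_trans (normr_Re _))// hB.
- by apply: (@bounded_le _ B) => x Ix; rewrite (le_trans (normr_Im _))// hB.
Qed.

Lemma cmeasD f g : cmeas f -> cmeas g -> cmeas (fun x => f x + g x).
Proof.
move=> [f1 f2] [g1 g2]; split.
- by under eq_fun do rewrite cReD; exact: measurable_funD.
- by under eq_fun do rewrite cImD; exact: measurable_funD.
Qed.

Lemma cmeasM f g : cmeas f -> cmeas g -> cmeas (fun x => f x * g x).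
Proof.
move=> [f1 f2] [g1 g2]; split.
- by under eq_fun do rewrite cReM; apply: measurable_funB; exact: measurable_funM.
- by under eq_fun do rewrite cImM; apply: measurable_funD; exact: measurable_funM.
Qed.

Lemma cmeas_cst c : cmeas (fun=> c).
Proof. by split; exact: measurable_cst. Qed.

Lemma cboundedD f g : cbounded f -> cbounded g -> cbounded (fun x => f x + g x).
Proof.
move=> [A hA] [B hB]; exists (A + B) => x Ix.
by rewrite (le_trans (cmodD _ _))// lerD ?hA ?hB.
Qed.

Lemma cboundedM f g : cbounded f -> cbounded g -> cbounded (fun x => f x * g x).
Proof.
move=> [A hA] [B hB]; exists (A * B) => x Ix.
by rewrite cmodM ler_pM ?cmod_ge0 ?hA ?hB.
Qed.

Lemma cbounded_cst c : cbounded (fun=> c).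
Proof. by exists (cmod c). Qed.

Lemma cintD f g : cint f -> cint g -> cint (fun x => f x + g x).
Proof.
have mI := measurable_torus.
move=> [f1 f2] [g1 g2]; split.
- have := integrableD mI f1 g1; apply: eq_integrable => // x _ /=.
  by rewrite cReD EFinD.
- have := integrableD mI f2 g2; apply: eq_integrable => // x _ /=.
  by rewrite cImD EFinD.
Qed.

Lemma cintM f g : cint f -> cmeas g -> cbounded g -> cint (fun x => f x * g x).
Proof.
have mI := measurable_torus.
move=> [f1 f2] [g1 g2] [B hB].
have b1 : [bounded complex.Re (g x) | x in I].
  by apply: (@bounded_le _ B) => x Ix; rewrite (le_trans (normr_Re _))// hB.
have b2 : [bounded complex.Im (g x) | x in I].
  by apply: (@bounded_le _ B) => x Ix; rewrite (le_trans (normr_Im _))// hB.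
split.
- have := integrableB mI (integrableMl mI f1 g1 b1) (integrableMl mI f2 g2 b2).
  by apply: eq_integrable => // x _ /=; rewrite cReM EFinB !EFinM.
- have := integrableD mI (integrableMl mI f1 g2 b2) (integrableMl mI f2 g1 b1).
  by apply: eq_integrable => // x _ /=; rewrite cImM EFinD !EFinM.
Qed.

Lemma cintZ f c : cint f -> cint (fun x => c * f x).
Proof.
move=> hf; have := cintM hf (cmeas_cst c) (cbounded_cst c).
by under eq_fun do rewrite mulrC.
Qed.

Lemma cint_cst c : cint (fun=> c).
Proof. exact: cint_bounded (cmeas_cst c) (cbounded_cst c). Qed.

Lemma cint_sum (J : Type) (q : seq J) (F : J -> R -> R[i]) :
  (forall j, cint (F j)) -> cint (fun x => \sum_(j <- q) F j x).
Proof.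
move=> h; elim: q => [|j q IH].
  by under eq_fun do rewrite big_nil; exact: cint_cst.
by under eq_fun do rewrite big_cons; exact: cintD.
Qed.

Lemma torus_integralD f g : cint f -> cint g ->
  torus_integral (fun x => f x + g x) = torus_integral f + torus_integral g.
Proof.
have mI := measurable_torus.
move=> [f1 f2] [g1 g2]; apply: complex_ext; rewrite ?cReD ?cImD /torus_integral/=.
- by rewrite -RintegralD//; apply: eq_Rintegral => x _; rewrite cReD.
- by rewrite -RintegralD//; apply: eq_Rintegral => x _; rewrite cImD.
Qed.

Lemma torus_integralZ f c : cint f ->
  torus_integral (fun x => c * f x) = c * torus_integral f.
Proof.
have mI := measurable_torus.
have intZ (r : R) (h : R -> R) : mu.-integrable I (EFin \o h) ->
    mu.-integrable I (EFin \o (fun x => r * h x)).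
  by move=> hh; apply: eq_integrable (integrableZl mI r hh) => // x _.
move=> [f1 f2]; apply: complex_ext; rewrite ?cReM ?cImM /torus_integral/=.
- rewrite -!RintegralZl// -RintegralB//; try exact: intZ.
  by apply: eq_Rintegral => x _; rewrite cReM.
- rewrite -!RintegralZl// -RintegralD//; try exact: intZ.
  by apply: eq_Rintegral => x _; rewrite cImM.
Qed.

(** The factor [2] comes from estimating real and imaginary parts separately. *)
Lemma cmod_torus_integral f B : cint f -> (forall x, I x -> cmod (f x) <= B) ->
  cmod (torus_integral f) <= 2 * pi * (2 * B).
Proof.
have mI := measurable_torus.
have key (h : R -> R) : mu.-integrable I (EFin \o h) ->
    (forall x, I x -> `|h x| <= B) -> `|\int[mu]_(x in I) h x| <= B * (2 * pi).
  move=> hh hB; rewrite (le_trans (le_normr_Rintegral mI hh))//.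
  have -> : B * (2 * pi) = \int[mu]_(x in I) B.
    rewrite Rintegral_cst//; congr (_ * _).
    exact: esym (congr1 fine measure_torus).
  apply: le_Rintegral => //; first exact: (integrable_abse hh).
  apply: measurable_bounded_integrable => //; first exact: measure_torus_lty.
  by apply: (@bounded_le _ `|B|).
move=> [f1 f2] hB; rewrite (le_trans (cmod_le_ReIm _))//=.
have -> : 2 * pi * (2 * B) = B * (2 * pi) + B * (2 * pi) by ring.
apply: lerD; apply: key => // x Ix.
- by rewrite (le_trans (normr_Re _))// hB.
- by rewrite (le_trans (normr_Im _))// hB.
Qed.

Lemma eq_torus_integral f g : (forall x, I x -> f x = g x) ->
  torus_integral f = torus_integral g.
Proof.
by move=> h; congr (_ +i* _); apply: eq_Rintegral => x /set_mem Ix; rewrite h.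
Qed.

Lemma ae_eq_torus_integral f g : cmeas f -> cmeas g ->
  {ae mu, forall x, f x = g x} -> torus_integral f = torus_integral g.
Proof.
have mI := measurable_torus.
move=> [f1 f2] [g1 g2] h; congr (_ +i* _); rewrite /Rintegral;
  congr fine; apply: ae_eq_integral => //; try exact/measurable_EFinP.
- by apply: negligibleS h => x /= hx fg; apply: hx => _ /=; rewrite fg.
- by apply: negligibleS h => x /= hx fg; apply: hx => _ /=; rewrite fg.
Qed.

End ComplexIntegral.

(** * Fourier coefficients *)

Section FourierCoefficients.
Variable R : realType.
Implicit Types (f g : R -> R[i]) (x y : R) (c : int -> R[i]) (l k : int) (A B : R).

Local Notation mu := (@lebesgue_measure R).
Local Notation I := (@torus R).

Lemma cis2pi_int l : cis (2 * pi * l%:~R : R) = 1.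
Proof.
have nat n : cis (2 * pi * n%:R : R) = 1.
  elim: n => [|n IH]; first by rewrite mulr0 cis0.
  rewrite -[n.+1%:R]natr1 mulrDr mulr1 cisD IH mul1r.
  by apply: complex_ext; rewrite /= mulr_natl ?cos2pi ?sin2pi.
case: l => n; first exact: nat.
by rewrite NegzE mulrNz mulrN -[LHS]mulr1 -[X in _ * X](nat n.+1) cisNK.
Qed.

Lemma continuous_cis_lin (a : R) : continuous (fun x => cos (a * x)) /\
  continuous (fun x => sin (a * x)).
Proof.
by split=> x; apply: continuous_comp; try exact: mulrl_continuous;
  [exact: continuous_cos|exact: continuous_sin].
Qed.

Lemma cmeas_cis (a : R) : cmeas (fun x => cis (a * x)).
Proof.
have [h1 h2] := continuous_cis_lin a.
by split; apply: measurable_funTS; exact: continuous_measurable_fun.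
Qed.

Lemma cbounded_cis (a : R) : cbounded (fun x => cis (a * x)).
Proof. by exists 1 => x _; rewrite cmod_cis. Qed.

Lemma cint_mul_char f l : cint f -> cint (fun x => f x * cis (- (l%:~R * x))).
Proof.
move=> hf; apply: cintM => //.
- by under eq_fun do rewrite -mulNr; exact: cmeas_cis.
- by under eq_fun do rewrite -mulNr; exact: cbounded_cis.
Qed.

Lemma fourier_coefD f g l : cint f -> cint g ->
  fourier_coef (fun x => f x + g x) l = fourier_coef f l + fourier_coef g l.
Proof.
move=> hf hg; rewrite /fourier_coef -mulrDr; congr (_ * _).
rewrite -torus_integralD; try exact: cint_mul_char.
by apply: eq_torus_integral => x _; rewrite mulrDl.
Qed.

Lemma fourier_coefZ f (z : R[i]) l : cint f ->
  fourier_coef (fun x => z * f x) l = z * fourier_coef f l.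
Proof.
move=> hf; rewrite /fourier_coef mulrCA; congr (_ * _).
rewrite -torus_integralZ; last exact: cint_mul_char.
by apply: eq_torus_integral => x _; rewrite mulrA.
Qed.

Lemma fourier_coefB f g l : cint f -> cint g ->
  fourier_coef (fun x => f x - g x) l = fourier_coef f l - fourier_coef g l.
Proof.
move=> hf hg; have := fourier_coefD l hf (cintZ (-1) hg).
rewrite fourier_coefZ// mulN1r => <-.
by congr (_ * _); apply: eq_torus_integral => x _; rewrite mulN1r.
Qed.

Lemma eq_fourier_coef f g l : (forall x, I x -> f x = g x) ->
  fourier_coef f l = fourier_coef g l.
Proof.
by move=> h; congr (_ * _); apply: eq_torus_integral => x Ix; rewrite h.
Qed.

Lemma fourier_coef_sum (J : Type) (q : seq J) (F : J -> R -> R[i]) l :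
  (forall j, cint (F j)) ->
  fourier_coef (fun x => \sum_(j <- q) F j x) l =
  \sum_(j <- q) fourier_coef (F j) l.
Proof.
move=> h; elim: q => [|j q IH].
  rewrite big_nil -[RHS](mul0r (fourier_coef (fun=> 0) l)) -fourier_coefZ; last exact: cint_cst.
  by apply: eq_fourier_coef => x _; rewrite big_nil mul0r.
rewrite big_cons -IH -fourier_coefD//; last exact: cint_sum.
by apply: eq_fourier_coef => x _; rewrite big_cons.
Qed.

Lemma cmod_fourier_coef f B l : cint f -> (forall x, I x -> cmod (f x) <= B) ->
  cmod (fourier_coef f l) <= 2 * B.
Proof.
move=> hf hB; rewrite cmodM cmodR.
have pi0 := pi_gt0 R; have p0 : 0 < 2 * pi :> R by rewrite mulr_gt0.
have := cmod_torus_integral (B := B) (cint_mul_char l hf).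
rewrite ger0_norm ?invr_ge0 ?(ltW p0)// ler_pdivrMl//; apply => x Ix.
by rewrite cmodM cmod_cis mulr1 hB.
Qed.

Lemma fourier_coef_mul_char f k l :
  fourier_coef (fun x => cis (k%:~R * x) * f x) l = fourier_coef f (l - k).
Proof.
congr (_ * _); apply: eq_torus_integral => x _.
rewrite mulrAC -cisD mulrC; congr (_ * cis _).
by rewrite rmorphB/=; ring.
Qed.

(** The fundamental theorem of calculus over a period. *)
Lemma integral_char_eq0 (F h : R -> R) :
  (forall x, is_derive x 1 F (h x)) -> continuous h -> F pi = F (- pi) ->
  \int[mu]_(x in I) h x = 0.
Proof.
move=> dF ch Fpi; have pi0 := pi_gt0 R.
have hN : - pi < pi :> R by lra.
have cF x : {for x, continuous F}.
  by apply: differentiable_continuous; apply/derivable1_diffP; have [] := dF x.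
have ih : mu.-integrable `[- pi, pi] (EFin \o h).
  apply: continuous_compact_integrable; first exact: segment_compact.
  exact: continuous_subspaceT.
have := @continuous_FTC2 R h F (- pi) pi hN (continuous_subspaceT ch).
rewrite Fpi -EFinB subrr => /(_ _ _)/wrap[|x _|hF].
- split => [x _||]; first by have [] := dF x.
  + by apply: cvg_at_right_filter; exact: cF.
  + by apply: cvg_at_left_filter; exact: cF.
- by rewrite derive1E; apply: derive_val; exact: dF.
have ih' : mu.-integrable `]- pi, pi] (EFin \o h).
  apply: (integrableS _ _ _ ih); try exact: measurable_itv.
  by apply: subset_itvr; rewrite bnd_simp.
have ih'' : mu.-integrable `]- pi, pi[ (EFin \o h).
  apply: (integrableS _ _ _ ih'); try exact: measurable_itv.
  by apply: subset_itvl; rewrite bnd_simp.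
rewrite /torus Rintegral_itv_bndo_bndc// Rintegral_itv_obnd_cbnd//.
by rewrite /Rintegral hF.
Qed.

(** Orthogonality of the characters; those of nonzero frequency have a periodic
    primitive. *)
Lemma fourier_coef1 l : fourier_coef (fun=> 1) l = (l == 0)%:R :> R[i].
Proof.
have pi0 := pi_gt0 R; have p0 : 2 * pi != 0 :> R by rewrite mulf_neq0// gt_eqF.
rewrite /fourier_coef; have [->|l0] := eqVneq l 0.
  have -> : torus_integral (fun x : R => 1 * cis (- (0 * x))) = (2 * pi)%:C.
    have -> : (fun x : R => 1 * cis (- (0 * x))) = fun=> 1.
      by apply/funext => x; rewrite mul0r oppr0 cis0 mulr1.
    apply: complex_ext => /=.
      rewrite Rintegral_cst ?mul1r; last exact: measurable_torus.
      exact: (congr1 fine (measure_torus R)).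
    by rewrite Rintegral_cst ?mul0r//; exact: measurable_torus.
  by rewrite -rmorphM/= mulVf.
suff -> : torus_integral (fun x : R => 1 * cis (- (l%:~R * x))) = 0 by rewrite mulr0.
have lR : (l%:~R : R) != 0 by rewrite intr_eq0.
have hcis : cis (- (l%:~R * pi)) = cis (- (l%:~R * - pi)) :> R[i].
  rewrite -[RHS]mulr1 -(cis2pi_int (- l)) -cisD; congr cis.
  by rewrite rmorphN/=; ring.
pose G x : R[i] := ('i * (- l%:~R)%:C)^-1 * cis (x * - l%:~R).
have i0 : 'i != 0 :> R[i] by exact: neq0Ci.
have lC : (- l%:~R)%:C != 0 :> R[i] by rewrite (inj_eq (@complexI R)) oppr_eq0.
have dG x : is_cderive G x (cis (- (l%:~R * x))).
  have := is_cderiveM (is_cderive_cst (('i * (- l%:~R)%:C)^-1) x) (is_cderive_cis (- l%:~R) x).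
  rewrite mul0r addr0 mulKf ?mulf_neq0//.
  by have -> : x * - l%:~R = - (l%:~R * x) by ring.
have GE x : G x = ('i * (- l%:~R)%:C)^-1 * cis (- (l%:~R * x)).
  by rewrite /G; have -> : x * - l%:~R = - (l%:~R * x) by ring.
have Gpi : G pi = G (- pi) by rewrite !GE hcis.
have [c1 c2] := continuous_cis_lin (- l%:~R).
apply: complex_ext; rewrite /torus_integral/=.
- under eq_Rintegral do rewrite mul1r mul0r subr0.
  apply: (@integral_char_eq0 (fun x => complex.Re (G x))).
  + by move=> x; have [h _] := dG x; exact: h.
  + by under eq_fun do rewrite -mulNr.
  + by rewrite Gpi.
- under eq_Rintegral do rewrite mul1r mul0r addr0.
  apply: (@integral_char_eq0 (fun x => complex.Im (G x))).
  + by move=> x; have [_ h] := dG x; exact: h.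
  + by under eq_fun do rewrite -mulNr.
  + by rewrite Gpi.
Qed.

End FourierCoefficients.

(** * Absolutely convergent Fourier series *)

Section FourierSeries.
Variable R : realType.
Implicit Types (f g : R -> R[i]) (x y : R) (c : int -> R[i]) (l k : int) (A B : R).

Local Notation I := (@torus R).

Definition partial_series c N x : R[i] := \sum_(l <- zseq N) c l * cis (l%:~R * x).

Lemma cmod_mul_cis (z : R[i]) x : cmod (z * cis x) = cmod z.
Proof. by rewrite cmodM cmod_cis mulr1. Qed.

Lemma l1b_mul_cis c A x : l1b |: c :| A ->
  l1b (fun l => cmod (c l * cis (l%:~R * x))) A.
Proof. by apply: l1b_mono => l; rewrite cmod_mul_cis. Qed.

Lemma fourier_series_bound c A x : l1b |: c :| A -> cmod (fourier_series c x) <= A.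
Proof. by move=> h; exact: csum_bound (l1b_mul_cis x h). Qed.

Lemma fourier_series_tail c A N x : l1b |: c :| A ->
  cmod (fourier_series c x - partial_series c N x) <=
  zsum |: c :| - \sum_(l <- zseq N) cmod (c l).
Proof. by move=> h; apply: (csum_tail _ _ h) => l; rewrite cmod_mul_cis. Qed.

Lemma cmeas_fourier_series c A : l1b |: c :| A -> cmeas (fourier_series c).
Proof.
move=> h.
have hm l : cmeas (fun x => c l * cis (l%:~R * x)).
  by apply: cmeasM; [exact: cmeas_cst|exact: cmeas_cis].
split.
- apply: (@measurable_fun_cvg _ _ _ _ (fun N x => \sum_(l <- zseq N)
    complex.Re (c l * cis (l%:~R * x)))).
    by move=> N; apply: measurable_sum => l; case: (hm l).
  move=> x _; apply: (@cvg_zsum _ _ A).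
  by apply: l1b_mono (l1b_mul_cis x h) => l; exact: normr_Re.
- apply: (@measurable_fun_cvg _ _ _ _ (fun N x => \sum_(l <- zseq N)
    complex.Im (c l * cis (l%:~R * x)))).
    by move=> N; apply: measurable_sum => l; case: (hm l).
  move=> x _; apply: (@cvg_zsum _ _ A).
  by apply: l1b_mono (l1b_mul_cis x h) => l; exact: normr_Im.
Qed.

Lemma cbounded_fourier_series c A : l1b |: c :| A -> cbounded (fourier_series c).
Proof. by move=> h; exists A => x _; exact: fourier_series_bound. Qed.

Lemma cint_fourier_series c A : l1b |: c :| A -> cint (fourier_series c).
Proof.
by move=> h; apply: cint_bounded;
  [exact: cmeas_fourier_series h|exact: cbounded_fourier_series h].
Qed.

Lemma fourier_series_periodic c : periodic2pi (fourier_series c).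
Proof.
move=> x; apply: csum_ext => l; congr (_ * _).
rewrite -[RHS]mulr1 -(cis2pi_int R l) -cisD; congr cis; ring.
Qed.

Lemma fourier_seriesD c c' A A' x : l1b |: c :| A -> l1b |: c' :| A' ->
  fourier_series (fun l => c l + c' l) x = fourier_series c x + fourier_series c' x.
Proof.
move=> h h'; rewrite -[RHS](csumD (l1b_mul_cis x h) (l1b_mul_cis x h')).
by apply: csum_ext => l; rewrite mulrDl.
Qed.

Lemma fourier_seriesZ c A (z : R[i]) x : l1b |: c :| A ->
  fourier_series (fun l => z * c l) x = z * fourier_series c x.
Proof.
move=> h; rewrite -[RHS](csumZ z (l1b_mul_cis x h)).
by apply: csum_ext => l; rewrite mulrA.
Qed.

Lemma cmeas_partial_series c N : cmeas (partial_series c N).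
Proof.
rewrite /partial_series; elim: (zseq N) => [|l q IH].
  by under eq_fun do rewrite big_nil; exact: cmeas_cst.
under eq_fun do rewrite big_cons; apply: cmeasD => //.
by apply: cmeasM; [exact: cmeas_cst|exact: cmeas_cis].
Qed.

Lemma cbounded_partial_series c N : cbounded (partial_series c N).
Proof.
exists (\sum_(l <- zseq N) cmod (c l)) => x _.
rewrite (le_trans (cmod_sum _ _))// ler_sum// => l _.
by rewrite cmod_mul_cis.
Qed.

Lemma fourier_coef_partial_mul c g N l : cint g ->
  fourier_coef (fun x => partial_series c N x * g x) l =
  \sum_(k <- zseq N) c k * fourier_coef g (l - k).
Proof.
move=> hg.
have hcg k : cint (fun x => cis (k%:~R * x) * g x).
  have := cintM hg (cmeas_cis k%:~R) (cbounded_cis k%:~R).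
  by under eq_fun do rewrite mulrC.
rewrite (@eq_fourier_coef _ _
  (fun x => \sum_(k <- zseq N) c k * (cis (k%:~R * x) * g x))).
  rewrite fourier_coef_sum; last by move=> k; exact: cintZ.
  by apply: eq_bigr => k _; rewrite fourier_coefZ// fourier_coef_mul_char.
by move=> x _; rewrite /partial_series mulr_suml; apply: eq_bigr => k _; rewrite mulrA.
Qed.

(** An absolutely convergent series is integrated term by term, its partial
    sums converging uniformly. *)
Lemma fourier_coef_series_mul c A g l : l1b |: c :| A -> cmeas g -> cbounded g ->
  fourier_coef (fun x => fourier_series c x * g x) l =
  csum (fun k => c k * fourier_coef g (l - k)).
Proof.
move=> h mg bg; have ig := cint_bounded mg bg; have [B hB] := bg.
have B0 : 0 <= B by apply: le_trans (hB 0 _); [exact: cmod_ge0|];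
  rewrite /torus/= in_itv/= oppr_lt0 pi_gt0.
apply/esym; apply: (@csum_unique _ _ (2 * B * A)).
  have A0 := l1b_ge0 h.
  apply: (l1b_mono _ (l1bZ (c := 2 * B) _ h)) => [k|]; last by nonneg.
  by rewrite cmodM mulrC ler_wpM2r ?cmod_ge0// cmod_fourier_coef.
apply: (@ccvg_le _ _ _ (fun N => (2 * B) * (zsum |: c :| - \sum_(l <- zseq N) cmod (c l)))).
  move=> N; rewrite -fourier_coef_partial_mul// cmod_distC.
  have i1 : cint (fun x => fourier_series c x * g x).
    by apply: cintM => //; exact: cint_fourier_series h.
  have i2 : cint (fun x => partial_series c N x * g x).
    apply: cintM => //; apply: cint_bounded; [exact: cmeas_partial_series|].
    exact: cbounded_partial_series.
  rewrite -fourier_coefB// -mulrA [B * _]mulrC; apply: cmod_fourier_coef.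
    have := cintD i1 (cintZ (-1) i2).
    by under eq_fun do rewrite mulN1r.
  move=> x Ix; rewrite -mulrBl cmodM ler_pM ?cmod_ge0 ?hB//.
  exact: fourier_series_tail h.
apply: cvg_scale0; apply: cvg_zsum_tail h => k; exact: cmod_ge0.
Qed.

Lemma fourier_coef_series c A l : l1b |: c :| A ->
  fourier_coef (fourier_series c) l = c l.
Proof.
move=> h; rewrite (@eq_fourier_coef _ _ (fun x => fourier_series c x * 1)); last first.
  by move=> x _; rewrite mulr1.
rewrite (fourier_coef_series_mul _ h (cmeas_cst _) (cbounded_cst _)).
rewrite (@csum_finite _ _ [:: l])// ?big_seq1 => [|k].
  by rewrite fourier_coef1 subrr eqxx mulr1.
by rewrite inE => kl; rewrite fourier_coef1 subr_eq0 eq_sym (negbTE kl) mulr0.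
Qed.

Lemma fourier_coef_mul_series c A c' A' l : l1b |: c :| A -> l1b |: c' :| A' ->
  fourier_coef (fun x => fourier_series c x * fourier_series c' x) l =
  zconv (fun j m => c j * c' m) l.
Proof.
move=> h h'; rewrite (fourier_coef_series_mul _ h (cmeas_fourier_series h')
  (cbounded_fourier_series h')).
by apply: csum_ext => k; rewrite (fourier_coef_series _ h').
Qed.

Lemma fourier_series_lip c A x y : l1b (fun l => `|l%:~R| * cmod (c l)) A ->
  (exists A', l1b |: c :| A') ->
  cmod (fourier_series c x - fourier_series c y) <= A * `|x - y|.
Proof.
move=> h [A' h'].
have hy := l1b_mul_cis y h'; have hx := l1b_mul_cis x h'.
have hz : l1b (fun l => cmod (c l * (cis (l%:~R * x) - cis (l%:~R * y)))) (A * `|x - y|).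
  rewrite mulrC; apply: (l1b_mono _ (l1bZ (normr_ge0 (x - y)) h)) => l.
  rewrite cmodM mulrC [leRHS]mulrA ler_wpM2r ?cmod_ge0//.
  by rewrite (le_trans (cmod_cisB _ _))// -mulrBr normrM mulrC.
suff -> : fourier_series c x - fourier_series c y =
    csum (fun l => c l * (cis (l%:~R * x) - cis (l%:~R * y))) by exact: csum_bound hz.
apply/eqP; rewrite subr_eq -(csumD hz hy); apply/eqP.
by apply: csum_ext => l; ring.
Qed.

End FourierSeries.

(** * Termwise differentiation and Bessel's inequality *)

Section SeriesDerivative.
Variable R : realType.
Implicit Types (f g : R -> R[i]) (x y : R) (c : int -> R[i]) (l k : int) (A B : R).

Lemma is_derive_small_o (f : R -> R) x d :
  (forall e, 0 < e -> exists2 dl, 0 < dl &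
     forall h, `|h| < dl -> `|f (x + h) - f x - h * d| <= e * `|h|) ->
  is_derive x 1 f d.
Proof.
move=> hf.
have H : h^-1 *: (f (h *: 1 + x) - f x) @[h --> 0^'] --> d.
  apply/cvgrPdist_le => e e0; have [dl dl0 hdl] := hf e e0.
  exists dl => //= h /=; rewrite sub0r normrN => hh h0.
  have -> : h *: 1 + x = x + h by rewrite addrC /GRing.scale/= mulr1.
  have hn : 0 < `|h| by rewrite normr_gt0.
  rewrite distrC -(ler_pM2r hn) -normrM (le_trans _ (hdl h hh))//.
  rewrite le_eqVlt; apply/orP; left; apply/eqP; congr (`|_|).
  by rewrite /GRing.scale/=; field.
apply: DeriveDef; first by apply/cvg_ex; exists d.
exact: cvg_lim H.
Qed.

Lemma is_cderive_small_o f x (d : R[i]) :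
  (forall e, 0 < e -> exists2 dl, 0 < dl &
     forall h, `|h| < dl -> cmod (f (x + h) - f x - h%:C * d) <= e * `|h|) ->
  is_cderive f x d.
Proof.
move=> hf; split; apply: is_derive_small_o => e /hf[dl dl0 hdl]; exists dl => // h hh.
- apply: le_trans (hdl h hh); apply: le_trans (normr_Re _).
  by rewrite !cReB cReM/= mul0r subr0.
- apply: le_trans (hdl h hh); apply: le_trans (normr_Im _).
  by rewrite !cImB cImM/= mul0r addr0.
Qed.

Definition deriv_coef c l : R[i] := 'i * l%:~R * c l.

Lemma cmod_deriv_coef c l : cmod (deriv_coef c l) = `|l%:~R| * cmod (c l).
Proof. by rewrite !cmodM cmodi mul1r cmod_int. Qed.

(** Termwise differentiation: the low frequencies have a uniformly quadratic
    Taylor remainder, the high ones a small linear one. *)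
Lemma is_cderive_fourier_series c A A' x :
  l1b |: c :| A -> l1b (fun l => `|l%:~R| * cmod (c l)) A' ->
  is_cderive (fourier_series c) x (fourier_series (deriv_coef c) x).
Proof.
move=> h h'; apply: is_cderive_small_o => e e0.
pose al l : R := `|l%:~R| * cmod (c l).
have al0 l : 0 <= al l by rewrite mulr_ge0 ?cmod_ge0.
have hd : l1b |: deriv_coef c :| A'.
  by apply: l1b_mono h' => l; rewrite cmod_deriv_coef.
have := cvg_zsum_tail al0 h'; move/cvgrPdist_le => /(_ (e / 4)) [].
  by rewrite divr_gt0.
move=> N _ /(_ N (leqnn N)); rewrite sub0r normrN => hN.
pose Q := \sum_(l <- zseq N) `|l%:~R : R| ^+ 2 * cmod (c l).
have Q0 : 0 <= Q by apply: sumr_seq_ge0 => l; rewrite mulr_ge0 ?cmod_ge0 ?exprn_ge0.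
exists (e / 2 / (Q + 1)) => [|t ht].
  by rewrite !divr_gt0// ltr_wpDl.
(* The terms of the Taylor remainder of the series. *)
pose b l := c l * cis (l%:~R * x) * (cis (l%:~R * t) - 1 - 'i * (l%:~R * t)%:C).
have hb1 l : cmod (b l) <= cmod (c l) * (`|l%:~R| ^+ 2 * t ^+ 2).
  rewrite cmodM cmod_mul_cis ler_wpM2l ?cmod_ge0//.
  by rewrite (le_trans (cmod_cisB1_lin _))// real_normK ?num_real// -exprMn.
have hb2 l : cmod (b l) <= 2 * `|t| * al l.
  rewrite cmodM cmod_mul_cis /al mulrCA mulrA -[leRHS]mulrC ler_wpM2l ?cmod_ge0//.
  rewrite (le_trans (cmodB _ _))// cmodM cmodi mul1r cmodR.
  by have := cmod_cisB1 (l%:~R * t); rewrite normrM; lra.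
have t20 : 0 <= 2 * `|t| by rewrite mulr_ge0.
have hsb : l1b |: b :| (2 * `|t| * A') by apply: l1b_mono (l1bZ t20 h').
have hx := l1b_mul_cis x h; have hxt := l1b_mul_cis (x + t) h; have hdx := l1b_mul_cis x hd.
have -> : fourier_series c (x + t) - fourier_series c x -
    t%:C * fourier_series (deriv_coef c) x = csum b.
  apply/esym/eqP; rewrite eq_sym subr_eq subr_eq -addrA; apply/eqP.
  have htd : l1b (fun l => cmod (t%:C * (deriv_coef c l * cis (l%:~R * x)))) (`|t| * A').
    by apply: l1b_mono (l1bZ (normr_ge0 t) hdx) => l; rewrite cmodM cmodR.
  rewrite -[t%:C * _](csumZ _ hdx) -(csumD htd hx).
  have hxx : l1b (fun l => cmod (t%:C * (deriv_coef c l * cis (l%:~R * x)) +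
      c l * cis (l%:~R * x))) (`|t| * A' + A).
    by apply: l1b_mono (l1bD htd hx) => l; exact: cmodD.
  rewrite -(csumD hsb hxx); apply: csum_ext => l.
  rewrite /b /deriv_coef mulrDr cisD [in X in 'i * X]rmorphM/= -intC; ring.
have := csum_tail N hb2 (l1bZ t20 h').
have zE : zsum (fun l => 2 * `|t| * al l) = 2 * `|t| * zsum al.
  rewrite !zsumE; under eq_fun do rewrite -mulr_sumr.
  by apply/cvg_lim => //; apply: cvgM; [exact: cvg_cst|exact: is_cvg_zsum_ge0 h'].
rewrite zE -mulr_sumr -mulrBr => htail.
have hlow : cmod (\sum_(l <- zseq N) b l) <= Q * t ^+ 2.
  rewrite (le_trans (cmod_sum _ _))// /Q mulr_suml ler_sum// => l _.
  by rewrite (le_trans (hb1 l))// le_eqVlt; apply/orP; left; apply/eqP; ring.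
have := cmodD (csum b - \sum_(l <- zseq N) b l) (\sum_(l <- zseq N) b l).
rewrite subrK => htot; apply: (le_trans htot).
have : 2 * `|t| * (zsum al - \sum_(l <- zseq N) al l) <= 2 * `|t| * (e / 4).
  by rewrite ler_wpM2l// (le_trans (ler_norm _)).
have : Q * t ^+ 2 <= (e / 2) * `|t|.
  rewrite -(real_normK (num_real t)) expr2 mulrA ler_wpM2r//.
  move: ht; rewrite ltr_pdivlMr ?ltr_wpDl// => /ltW.
  by rewrite mulrDr mulr1; have := normr_ge0 t; lra.
by lra.
Qed.

End SeriesDerivative.

Section Bessel.
Variable R : realType.
Implicit Types (f g : R -> R[i]) (x y : R) (c : int -> R[i]) (l k : int) (A B : R).

Local Notation I := (@torus R).

Lemma normsqE (z : R[i]) : z * z^*%C = (normsq z)%:C.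
Proof. by case: z => a b; apply: complex_ext; rewrite /normsq/=; ring. Qed.

Lemma conj_mul (z w : R[i]) : (z * w)^*%C = z^*%C * w^*%C.
Proof. by case: z w => [a b] [a' b']; apply: complex_ext => /=; ring. Qed.

Lemma cmeas_conj g : cmeas g -> cmeas (fun x => (g x)^*%C).
Proof.
move=> [g1 g2]; split.
- by have -> : (fun x => complex.Re (g x)^*%C) = (fun x => complex.Re (g x));
    [apply/funext => x; case: (g x)|].
- have -> : (fun x => complex.Im (g x)^*%C) = (fun x => - complex.Im (g x)).
    by apply/funext => x; case: (g x).
  exact: measurable_funN.
Qed.

Lemma cbounded_conj g : cbounded g -> cbounded (fun x => (g x)^*%C).
Proof. by move=> [B hB]; exists B => x Ix; rewrite cmodJ hB. Qed.

Lemma fourier_coef0_mul_cisN g l :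
  fourier_coef (fun x => g x * cis (- (l%:~R * x))) 0 = fourier_coef g l.
Proof.
congr (_ * _); apply: eq_torus_integral => x _.
by rewrite mul0r oppr0 cis0 mulr1.
Qed.

Lemma Re_fourier_coef0_ge0 g : (forall x, I x -> 0 <= complex.Re (g x)) ->
  0 <= complex.Re (fourier_coef g 0).
Proof.
move=> h; rewrite cReM/= mul0r subr0 mulr_ge0//.
  by rewrite invr_ge0 mulr_ge0// pi_ge0.
apply: Rintegral_ge0 => x Ix; rewrite cReM/= mul0r oppr0 cos0 sin0 mulr1 mulr0 subr0.
exact: h.
Qed.

(** The mean of [|g - P| ^ 2] is nonnegative, where [P] is the partial sum of the
    Fourier series of [g] over [q]. *)
Lemma bessel g B : cmeas g -> (forall x, I x -> cmod (g x) <= B) ->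
  l1b (fun l => normsq (fourier_coef g l)) (2 * B ^+ 2).
Proof.
move=> mg hB q uq; have bg : cbounded g by exists B.
have ig := cint_bounded mg bg.
pose a l := fourier_coef g l.
pose P x := \sum_(l <- q) a l * cis (l%:~R * x).
pose P' x := \sum_(l <- q) (a l)^*%C * cis (- (l%:~R * x)).
have PP' x : (P x)^*%C = P' x.
  rewrite rmorph_sum; apply: eq_bigr => l _.
  rewrite -[LHS]/((a l * cis (l%:~R * x))^*%C) conj_mul; congr (_ * _).
  by apply: complex_ext; rewrite /= ?cosN ?sinN.
have cmb (F : int -> R -> R[i]) : (forall l, cmeas (F l) /\ cbounded (F l)) ->
    cmeas (fun x => \sum_(l <- q) F l x) /\ cbounded (fun x => \sum_(l <- q) F l x).
  move=> hF; elim: (q) => [|l q' [IH1 IH2]].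
    split; first by under eq_fun do rewrite big_nil; exact: cmeas_cst.
    by exists 0 => x _; rewrite big_nil cmod0.
  have [F1 F2] := hF l; split.
    by under eq_fun do rewrite big_cons; exact: cmeasD.
  have [b hb_] := cboundedD F2 IH2; exists b => x Ix; rewrite big_cons; exact: hb_.
have [mP bP] : cmeas P /\ cbounded P.
  apply: cmb => l; split.
  - by apply: cmeasM; [exact: cmeas_cst|exact: cmeas_cis].
  - by apply: cboundedM; [exact: cbounded_cst|exact: cbounded_cis].
have sumP' h : cint h ->
    fourier_coef (fun x => h x * P' x) 0 = \sum_(l <- q) (a l)^*%C * fourier_coef h l.
  move=> ih; have ihl l : cint (fun x => h x * cis (- (l%:~R * x))) by exact: cint_mul_char.
  rewrite (@eq_fourier_coef _ _
    (fun x => \sum_(l <- q) (a l)^*%C * (h x * cis (- (l%:~R * x))))).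
    rewrite fourier_coef_sum; last by move=> l; exact: cintZ.
    by apply: eq_bigr => l _; rewrite fourier_coefZ// fourier_coef0_mul_cisN.
  by move=> x _; rewrite /P' mulr_sumr; apply: eq_bigr => l _; rewrite mulrCA.
have iP := cint_bounded mP bP.
have hPl l : l \in q -> fourier_coef P l = a l.
  move=> lq.
  have ic k : cint (fun x => cis (k%:~R * x)).
    by apply: cint_bounded; [exact: cmeas_cis|exact: cbounded_cis].
  rewrite /P fourier_coef_sum; last by move=> k; exact: cintZ.
  rewrite (bigD1_seq l)//= [X in _ + X]big1_seq ?addr0 => [|k /andP[kl _]].
    rewrite fourier_coefZ// -[RHS]mulr1; congr (_ * _).
    rewrite -(@eq_fourier_coef _ (fun x => cis (l%:~R * x) * 1)).
      by rewrite fourier_coef_mul_char fourier_coef1 subrr eqxx.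
    by move=> x _; rewrite mulr1.
  rewrite fourier_coefZ// -(@eq_fourier_coef _ (fun x => cis (k%:~R * x) * 1)).
    by rewrite fourier_coef_mul_char fourier_coef1 subr_eq0 eq_sym (negbTE kl) mulr0.
  by move=> x _; rewrite mulr1.
pose S := \sum_(l <- q) normsq (a l).
have SC : \sum_(l <- q) (a l)^*%C * a l = S%:C.
  by rewrite /S rmorph_sum/=; apply: eq_bigr => l _; rewrite mulrC normsqE.
have bP' : cbounded P' /\ cmeas P'.
  have -> : P' = (fun x => (P x)^*%C) by apply/funext => x; rewrite PP'.
  by split; [exact: cbounded_conj|exact: cmeas_conj].
have [{}bP' mP'] := bP'.
pose gg x := g x * (g x)^*%C.
have igg : cint gg by apply: cintM => //; [exact: cmeas_conj|exact: cbounded_conj].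
have igP : cint (fun x => g x * P' x) by exact: cintM.
have iPP : cint (fun x => P x * P' x) by exact: cintM.
have := @Re_fourier_coef0_ge0 (fun x => gg x + (-2) * (g x * P' x) + P x * P' x) _.
have -> : fourier_coef (fun x => gg x + (-2) * (g x * P' x) + P x * P' x) 0 =
    fourier_coef gg 0 - S%:C.
  rewrite fourier_coefD; [|exact: cintD igg (cintZ _ igP)|by []].
  rewrite fourier_coefD; [|by []|exact: cintZ].
  rewrite fourier_coefZ// !sumP'//.
  have -> : \sum_(l <- q) (a l)^*%C * fourier_coef P l = S%:C.
    by rewrite -SC; apply: eq_big_seq => l lq; rewrite hPl.
  by rewrite SC; ring.
move=> /(_ _)/wrap[x Ix|].
  rewrite /gg -!PP'.
  case: (g x) (P x) => [u v] [u' v'] /=.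
  have : 0 <= (u - u') ^+ 2 + (v - v') ^+ 2 by rewrite addr_ge0 ?sqr_ge0.
  by lra.
rewrite cReB -[complex.Re S%:C]/S subr_ge0 => /le_trans; apply.
rewrite (le_trans (ler_norm _))// (le_trans (normr_Re _))//.
apply: cmod_fourier_coef => // x Ix.
by rewrite /gg cmodM cmodJ expr2 ler_pM ?cmod_ge0 ?hB.
Qed.

End Bessel.

(** * Fourier inversion *)

Section Inversion.
Variable R : realType.
Implicit Types (f g : R -> R[i]) (x y : R) (c : int -> R[i]) (l k : int) (A B : R).

Local Notation I := (@torus R).

(** For small angles the chord is compared with its tangent; for the others its
    real part alone is bounded away from [0]. *)
Lemma chord_lower_bound : exists2 c : R, 0 <= c &
  forall y, `|y| <= pi -> `|y| <= c * cmod (cis y - 1).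
Proof.
have pi0 := pi_gt0 R; have pi2 := pi_ge2 R.
have z : (0 : R) \in `[0, pi] by rewrite in_itv/= lexx ltW.
have w : (1 / 2 : R) \in `[0, pi] by rewrite in_itv/=; apply/andP; split; lra.
have m0 : 0 < 1 - cos (1 / 2) :> R.
  by rewrite subr_gt0 -[ltRHS]cos0 (ltr_cos z w).
exists (2 + pi / (1 - cos (1 / 2))) => [|y ypi].
  by rewrite addr_ge0// divr_ge0 ?(ltW pi0) ?(ltW m0).
have q0 : 0 <= pi / (1 - cos (1 / 2)) :> R by rewrite divr_ge0 ?(ltW pi0) ?(ltW m0).
have M0 := cmod_ge0 (cis y - 1).
rewrite mulrDl; have [y12|/ltW y12] := leP `|y| (1 / 2).
  have h1 := cmod_cisB1_lin y.
  have h2 := cmodD (cis y - 1 - 'i * y%:C) ('i * y%:C - (cis y - 1)).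
  have h3 := cmodD ('i * y%:C - (cis y - 1)) (cis y - 1).
  rewrite subrK cmodM cmodi mul1r cmodR -[in X in _ <= X + _]opprB cmodN in h3.
  have h4 : y ^+ 2 <= `|y| * (1 / 2).
    by rewrite -(real_normK (num_real y)) expr2 ler_wpM2l.
  have : 0 <= pi / (1 - cos (1 / 2)) * cmod (cis y - 1) by exact: mulr_ge0.
  by lra.
have hc : cos y <= cos (1 / 2).
  have yI : `|y| \in `[0, pi] by rewrite in_itv/= normr_ge0.
  by rewrite -(cos_norm y) leNgt (ltr_cos yI w) -leNgt.
have h : 1 - cos (1 / 2) <= cmod (cis y - 1).
  apply: le_trans (normr_Re _); rewrite cReB/= -normrN opprB.
  by rewrite (le_trans _ (ler_norm _))// lerB.
have : pi <= pi / (1 - cos (1 / 2)) * cmod (cis y - 1).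
  rewrite -mulrA ler_peMr ?(ltW pi0)// ler_pdivlMl// mulr1.
  exact: h.
by lra.
Qed.

Lemma periodic2pi_int f : periodic2pi f ->
  forall l x, f (x + 2 * pi * l%:~R) = f x.
Proof.
move=> hf.
have nat n x : f (x + 2 * pi * n%:R) = f x.
  elim: n x => [|n IH] x; first by rewrite mulr0 addr0.
  by rewrite -[n.+1%:R]natr1 mulrDr mulr1 addrA hf IH.
case=> n x; first exact: nat.
by rewrite NegzE mulrNz mulrN -(nat n.+1) subrK.
Qed.

Lemma near_representative x x0 :
  exists l, `|x + 2 * pi * l%:~R - x0| <= pi.
Proof.
have pi0 := pi_gt0 R; have p0 : 0 < 2 * pi :> R by lra.
pose y := (x - x0) / (2 * pi) + 1 / 2.
exists (- Num.floor y); have := floor_itv y; rewrite rmorphN/=.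
set n : R := (Num.floor y)%:~R => /andP[h1 h2].
have yE : x - x0 = (y - 1 / 2) * (2 * pi).
  by rewrite /y addrK divfK// gt_eqF.
have -> : x + 2 * pi * - n - x0 = (y - 1 / 2 - n) * (2 * pi).
  by rewrite mulrBl -yE; ring.
rewrite ler_norml; apply/andP; split.
  have : 0 <= (y - n) * (2 * pi) by rewrite mulr_ge0 ?subr_ge0 ?(ltW p0).
  by lra.
have : 0 <= (n + 1 - y) * (2 * pi).
  by rewrite mulr_ge0 ?(ltW p0)// subr_ge0 ltW// -intrD1.
by lra.
Qed.

(** The inverse is the conjugate divided by the squared modulus, also at zero. *)
Lemma cmeas_inv f : cmeas f -> cmeas (fun x => (f x)^-1).
Proof.
move=> hf; have hc := cmeas_conj hf.
have hn : cmeas (fun x => ((normsq (f x)) `^ (-1))%:C).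
  have [f1 f2] := hf; split => /=; last exact: measurable_cst.
  apply: (@measurableT_comp _ _ _ _ _ _ (fun u : R => u `^ (-1))) => //.
  by apply: measurable_funD; exact: measurable_funX.
have := cmeasM hc hn.
congr cmeas; apply/funext => x; rewrite powR_inv1 ?normsq_ge0//.
have [->|f0] := eqVneq (f x) 0.
  by rewrite conjc0 mul0r invr0.
apply: (mulfI f0); rewrite divff// mulrA normsqE -rmorphM/= divff//.
by rewrite -sqr_cmod expf_neq0//; apply: contra_neq f0; exact: cmod_eq0.
Qed.

Lemma bessel_cvg g B (u : nat -> int) : cmeas g -> (forall x, I x -> cmod (g x) <= B) ->
  injective u -> (fun n => cmod (fourier_coef g (u n))) @ \oo --> (0 : R).
Proof.
move=> mg hB ui; have hb_ := bessel mg hB.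
have : cvgn (series (fun n => normsq (fourier_coef g (u n)))).
  apply: nondecreasing_is_cvgn.
    by apply: nondecreasing_series => n *; exact: normsq_ge0.
  exists (2 * B ^+ 2) => _ [n _ <-].
  rewrite /series/= -(big_map u xpredT (fun l => normsq (fourier_coef g l))).
  by apply: hb_; rewrite map_inj_uniq// iota_uniq.
move=> /cvg_series_cvg_0 h.
have := cvg_comp _ _ h (@sqrt_continuous R 0); rewrite sqrtr0.
by [].
Qed.

(** Dividing [f x - f x0] by the character difference [cis (x - x0) - 1] turns
    the partial sums of the series at [x0] into a telescoping sum of Fourier
    coefficients of a bounded function, which vanish at infinity by Bessel's
    inequality. *)
Lemma fourier_inversion f A (L x0 : R) : periodic2pi f -> cmeas f ->
  (forall x, cmod (f x - f x0) <= L * `|x - x0|) ->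
  l1b |: fourier_coef f :| A ->
  fourier_series (fourier_coef f) x0 = f x0.
Proof.
move=> pf mf fL hA; have [c c0 hc] := chord_lower_bound.
have L0 : 0 <= L.
  have := fL (x0 + 1); rewrite addrAC subrr add0r normr1 mulr1.
  exact/le_trans/cmod_ge0.
have pi0 := pi_gt0 R.
have key x : cmod (f x - f x0) <= L * c * cmod (cis (x - x0) - 1).
  have [l hl] := near_representative x x0.
  rewrite -(periodic2pi_int pf l x) (le_trans (fL _))// -[leRHS]mulrA ler_wpM2l//.
  rewrite (le_trans (hc _ hl))//.
  have -> : x + 2 * pi * l%:~R - x0 = (x - x0) + 2 * pi * l%:~R by ring.
  by rewrite cisD cis2pi_int mulr1.
pose den x : R[i] := cis (x - x0) - 1.
pose g x := (f x - f x0) * (den x)^-1.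
have hg x : cmod (g x) <= L * c.
  rewrite cmodM cmodV; have [d0|d0] := eqVneq (cmod (den x)) 0.
    by rewrite d0 invr0 mulr0 mulr_ge0.
  by rewrite ler_pdivrMr ?key// lt_neqAle eq_sym d0 cmod_ge0.
have gE x : f x - f x0 = g x * den x.
  have [d0|d0] := eqVneq (den x) 0; last by rewrite /g divfK.
  rewrite d0 mulr0; apply: cmod_eq0; apply/eqP; rewrite eq_le cmod_ge0 andbT.
  by rewrite (le_trans (key x))// -/(den x) d0 cmod0 mulr0.
have mden : cmeas den.
  apply: (@cmeasD _ _ (fun=> -1)); last exact: cmeas_cst.
  have := cmeasM (cmeas_cst (cis (- x0))) (@cmeas_cis R 1).
  by congr cmeas; apply/funext => x; rewrite -cisD mul1r addrC.
have mg : cmeas g.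
  apply: cmeasM; last exact: cmeas_inv.
  exact: (@cmeasD _ _ (fun=> - f x0) mf (cmeas_cst _)).
have bg : cbounded g by exists (L * c).
have ig := cint_bounded mg bg.
have bf : cbounded f.
  exists (cmod (f x0) + L * (pi + `|x0|)) => x; rewrite /torus/= in_itv/= => /andP[x1 x2].
  have -> : f x = (f x - f x0) + f x0 by rewrite subrK.
  rewrite (le_trans (cmodD _ _))// addrC lerD2l (le_trans (fL x))// ler_wpM2l//.
  rewrite (le_trans (ler_normB _ _))// lerD2r ler_norml; apply/andP; split; lra.
have iff := cint_bounded mf bf.
pose gam l := fourier_coef g l * cis (l%:~R * x0).
have coefE l : fourier_coef f l * cis (l%:~R * x0) - f x0 * (l == 0)%:R =
    gam (l - 1) - gam l.
  have h1 : fourier_coef (fun x => f x - f x0) l =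
      fourier_coef f l - f x0 * (l == 0)%:R.
    rewrite fourier_coefB//; last exact: cint_cst.
    rewrite -(fourier_coef1 R l) -fourier_coefZ; last exact: cint_cst.
    by congr (_ - _); apply: eq_fourier_coef => x _; rewrite mulr1.
  have h2 : fourier_coef (fun x => f x - f x0) l =
      cis (- x0) * fourier_coef g (l - 1) - fourier_coef g l.
    rewrite -fourier_coef_mul_char.
    have ig1 : cint (fun x => cis (1%:~R * x) * g x).
      have := cintM ig (cmeas_cis 1%:~R) (cbounded_cis 1%:~R).
      by congr cint; apply/funext => x; rewrite mulrC.
    rewrite -fourier_coefZ// -fourier_coefB//; last exact: cintZ.
    apply: eq_fourier_coef => x _; rewrite gE /den cisD mul1r; ring.
  have h3 : (fourier_coef f l - f x0 * (l == 0)%:R) * cis (l%:~R * x0) =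
      gam (l - 1) - gam l.
    rewrite -h1 h2 mulrBl; congr (_ - _); rewrite /gam mulrAC mulrC.
    congr (_ * _); rewrite -cisD; congr cis; rewrite rmorphB/=; ring.
  rewrite -h3 mulrBl; congr (_ - _).
  have [->|_] := eqVneq l 0; last by rewrite mulr0 mul0r.
  by rewrite mul0r cis0 !mulr1.
have sumE N : \sum_(l <- zseq N) fourier_coef f l * cis (l%:~R * x0) - f x0 =
    gam (- N.+1%:Z) - gam N%:Z.
  elim: N => [|N IH].
    by have := coefE 0; rewrite eqxx mulr1 [zseq 0]/= big_seq1 sub0r.
  rewrite big_zseqS -[LHS]addrA IH.
  have := coefE N.+1%:Z; rewrite [_ == 0]/= mulr0 subr0 => ->.
  have := coefE (- N.+1%:Z); rewrite [_ == 0]/= mulr0 subr0 => ->.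
  have -> : N.+1%:Z - 1 = N%:Z by lia.
  have -> : - N.+1%:Z - 1 = - N.+2%:Z by lia.
  ring.
have hA' := l1b_mul_cis x0 hA.
apply: (csum_unique hA').
apply: (@ccvg_le _ _ _ (fun N => cmod (fourier_coef g (- N.+1%:Z)) + cmod (fourier_coef g N%:Z))).
  by move=> N; rewrite sumE (le_trans (cmodB _ _))// !cmod_mul_cis.
rewrite -[X in _ --> X]addr0; apply: cvgD.
- by apply: (bessel_cvg (B := L * c) (u := fun N => - N.+1%:Z) mg) => // i j; lia.
- by apply: (bessel_cvg (B := L * c) (u := fun N => N%:Z) mg) => // i j; lia.
Qed.

End Inversion.

(** * The integrator in Fourier coefficients *)

Section Summable.
Variable R : realType.
Implicit Types (x t : R) (c a b : int -> R[i]) (l : int).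

Definition summable_coef c := exists A, l1b |: c :| A.

Lemma summable_coefD a b : summable_coef a -> summable_coef b -> summable_coef (fun l => a l + b l).
Proof.
by move=> [A hA] [B hB]; exists (A + B); apply: l1b_mono (l1bD hA hB) => l; exact: cmodD.
Qed.

Lemma summable_coefZ a (z : R[i]) : summable_coef a -> summable_coef (fun l => z * a l).
Proof.
move=> [A hA]; exists (cmod z * A).
by apply: l1b_mono (l1bZ (cmod_ge0 z) hA) => l; rewrite cmodM.
Qed.

Lemma summable_coef_le a b : (forall l, cmod (a l) <= cmod (b l)) -> summable_coef b -> summable_coef a.
Proof. by move=> h [B hB]; exists B; exact: l1b_mono hB. Qed.

Definition delta0 (z : R[i]) l : R[i] := z * (l == 0)%:R.

Lemma summable_coef_delta0 (z : R[i]) : summable_coef (delta0 z).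
Proof.
exists (cmod z) => q uq; case: (boolP (0 \in q)) => q0.
  rewrite (bigD1_seq 0)//= big1_seq ?addr0 => [|l /andP[l0 _]].
    by rewrite /delta0 eqxx mulr1.
  by rewrite /delta0 (negbTE l0) mulr0 cmod0.
rewrite big1_seq ?cmod_ge0// => l /andP[_ lq].
by rewrite /delta0; case: eqP lq => [->|_ _]; [rewrite (negbTE q0)|rewrite mulr0 cmod0].
Qed.

Lemma fourier_series_delta0 (z : R[i]) x : fourier_series (delta0 z) x = z.
Proof.
rewrite -[LHS]/(csum (fun l => delta0 z l * cis (l%:~R * x))).
rewrite (@csum_finite _ _ [:: 0])// => [|l].
  by rewrite big_seq1 /delta0 eqxx mulr1 mul0r cis0 mulr1.
by rewrite inE /delta0 => /negbTE ->; rewrite mulr0 mul0r.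
Qed.

Lemma fsD a b x : summable_coef a -> summable_coef b ->
  fourier_series (fun l => a l + b l) x = fourier_series a x + fourier_series b x.
Proof. by move=> [A hA] [B hB]; exact: fourier_seriesD hA hB. Qed.

Lemma fsZ a (z : R[i]) x : summable_coef a ->
  fourier_series (fun l => z * a l) x = z * fourier_series a x.
Proof. by move=> [A hA]; exact: fourier_seriesZ hA. Qed.

Lemma fourier_coefK a l : summable_coef a -> fourier_coef (fourier_series a) l = a l.
Proof. by move=> [A hA]; exact: fourier_coef_series hA. Qed.

Definition summable_deriv a := summable_coef a /\ exists A, l1b (fun l => `|l%:~R| * cmod (a l)) A.

(** The product of two series with summable derivatives is Lipschitz, hence the
    sum of its Fourier series. *)
Lemma fourier_series_mul a b x : summable_deriv a -> summable_deriv b ->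
  summable_coef (zconv (fun j m => a j * b m)) ->
  fourier_series a x * fourier_series b x =
  fourier_series (zconv (fun j m => a j * b m)) x.
Proof.
move=> [[A hA] [A' hA']] [[B hB] [B' hB']] [C hC].
pose f x := fourier_series a x * fourier_series b x.
have coefE : fourier_coef f = zconv (fun j m => a j * b m).
  by apply/funext => l; exact: fourier_coef_mul_series hA hB.
rewrite -coefE; apply/esym; apply: (@fourier_inversion _ _ C (A * B' + A' * B)).
- by move=> y; rewrite /f !fourier_series_periodic.
- by apply: cmeasM; [exact: cmeas_fourier_series hA|exact: cmeas_fourier_series hB].
- move=> y.
  have -> : f y - f x = fourier_series a y * (fourier_series b y - fourier_series b x)
    + (fourier_series a y - fourier_series a x) * fourier_series b x.
    by rewrite /f; ring.
  rewrite (le_trans (cmodD _ _))// !cmodM mulrDl; apply: lerD.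
    rewrite -mulrA ler_pM ?cmod_ge0//; first exact: fourier_series_bound hA.
    by apply: fourier_series_lip => //; exists B.
  rewrite mulrAC ler_pM ?cmod_ge0//; last exact: fourier_series_bound hB.
  by apply: fourier_series_lip => //; exists A.
- by rewrite coefE.
Qed.

End Summable.

Lemma normz_ge1 (l : int) : l != 0 -> 1 <= `|l|.
Proof. lia. Qed.

Section StepCoefficients.
Variables (R : realType) (sg eps tau : R).
Hypothesis sg12 : 1 / 2 < sg.
Implicit Types (a b c : int -> R[i]) (l : int) (X : R).

Definition flow (t : R) a l : R[i] := cis (- (t * l%:~R ^+ 2)) * a l.

Definition antideriv_symbol l : R[i] := if l == 0 then 0 else ('i * l%:~R)^-1.

Definition antideriv a l : R[i] := antideriv_symbol l * a l.

Lemma cmod_flow t a l : cmod (flow t a l) = cmod (a l).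
Proof. by rewrite cmodM cmod_cis mul1r. Qed.

Lemma flowK t a l : flow (- t) (flow t a) l = a l.
Proof. by rewrite /flow mulrA -cisD mulNr opprK subrr cis0 mul1r. Qed.

Lemma antideriv_flow t a l : antideriv (flow t a) l = flow t (antideriv a) l.
Proof. exact: mulrCA. Qed.

Lemma cmod_antideriv_symbol l : `|l%:~R| * cmod (antideriv_symbol l) <= 1.
Proof.
rewrite /antideriv_symbol; case: ifPn => [|l0]; first by rewrite cmod0 mulr0.
by rewrite cmodV cmodM cmodi mul1r cmod_int divff// normr_eq0 intr_eq0.
Qed.

Lemma cmod_antideriv a l : cmod (antideriv a l) <= cmod (a l).
Proof.
rewrite cmodM ler_piMl ?cmod_ge0// /antideriv_symbol; case: ifPn => [|l0]; first by rewrite cmod0.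
rewrite cmodV cmodM cmodi mul1r cmod_int invf_le1 ?normr_gt0 ?intr_eq0//.
by rewrite -intr_norm ler1z normz_ge1.
Qed.

Lemma hb_antideriv a X : hb sg |: a :| X -> hb sg |: antideriv a :| X.
Proof. by apply: hb_mono => l; rewrite cmod_ge0 cmod_antideriv. Qed.

Lemma hb_flow t a X : hb sg |: a :| X -> hb sg |: flow t a :| X.
Proof. by apply: hb_mono => l; rewrite cmod_ge0 cmod_flow/=. Qed.

Lemma hb_summable_coef a X : hb sg |: a :| X -> summable_coef a.
Proof. by move=> h; exists (l1_const sg * X); exact: hb_l1. Qed.

Lemma hb_summable_antideriv a X : hb sg |: a :| X -> summable_deriv (antideriv a).
Proof.
move=> h; split; first exact: (hb_summable_coef (hb_antideriv h)).
exists (l1_const sg * X); apply: l1b_mono (hb_l1 sg12 h) => l.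
by rewrite cmodM mulrA ler_piMl ?cmod_ge0// cmod_antideriv_symbol.
Qed.

Lemma summable_deriv_flow t a : summable_deriv a -> summable_deriv (flow t a).
Proof.
move=> [[A hA] [B hB]]; split.
  by exists A; apply: l1b_mono hA => l; rewrite cmod_flow.
by exists B; apply: l1b_mono hB => l; rewrite cmod_flow.
Qed.

Let cmod1_le (j m : int) : cmod (1 : R[i]) <= 1. Proof. by rewrite cmod1. Qed.

Definition prod_coef a := zconv (fun j m => a j * a m).

Lemma kb_prod a X : hb sg |: a :| X ->
  kb sg (fun j m => a j * a m) (1 * (alg_const sg * (X * X))).
Proof.
move=> h; have := kb_mul sg12 ler01 cmod1_le h h.
by apply: kb_ext => j m; rewrite mul1r.
Qed.

Lemma summable_coef_prod a X : hb sg |: a :| X -> summable_coef (prod_coef a).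
Proof. by move=> h; have [h1 _] := kb_prod h; exact: hb_summable_coef h1. Qed.

(** The pairs with [j * m = 0] have a constant phase; in the product they are
    those in which one factor is the mean value of the sequence. *)
Lemma resonant_part a X l : hb sg |: a :| X ->
  zconv (fun j m => (j * m == 0)%:R * (a j * a m)) l =
  2 * a 0 * a l - delta0 (a 0 ^+ 2) l.
Proof.
move=> h; rewrite /zconv /delta0; have [->|l0] := eqVneq l 0.
  rewrite (@csum_finite _ _ [:: 0])// => [|j]; last first.
    by rewrite inE => j0; rewrite sub0r mulrN oppr_eq0 mulf_eq0 (negbTE j0) mul0r.
  by rewrite big_seq1 subrr mul0r eqxx/=; ring.
rewrite (@csum_finite _ _ [:: 0; l])/= => [||j].
- rewrite big_cons big_seq1 subr0 subrr mul0r mulr0 eqxx/=; ring.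
- by rewrite inE eq_sym l0.
- rewrite !inE negb_or => /andP[j0 jl].
  by rewrite mulf_eq0 (negbTE j0) subr_eq0 eq_sym (negbTE jl) mul0r.
Qed.

(** Evaluation of the oscillatory integrals. For [j * m <> 0] the denominator
    [2 * 'i * j * m] is split between the two factors as antiderivatives. *)
Lemma Phi_split a X l : hb sg |: a :| X ->
  Phi tau a a l = 'i / 2 * (zconv (fun j m => phase tau j m * (antideriv a j * antideriv a m)) l
    - prod_coef (antideriv a) l) + tau%:C * (2 * a 0 * a l - delta0 (a 0 ^+ 2) l).
Proof.
move=> h; have hd := hb_antideriv h.
have ph j m : cmod (phase tau j m) <= 1 by rewrite cmod_phase.
have k1 := kb_mul sg12 ler01 ph hd hd.
have k2 := kb_prod hd.
have res (j m : int) : cmod ((j * m == 0)%:R : R[i]) <= 1.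
  by case: (_ == _); rewrite ?cmod1 ?cmod0.
have k3 := kb_mul sg12 ler01 res h h.
rewrite -(resonant_part l h) -(zconvB k1 k2) -(zconvZ _ (kbB k1 k2)) -(zconvZ _ k3).
rewrite -(zconvD (kbZ _ (kbB k1 k2)) (kbZ _ k3)).
apply: csum_ext => j; set m := l - j; clearbody m.
rewrite /phase_int /antideriv /antideriv_symbol [j * m == 0]mulf_eq0.
have i0 : 'i != 0 :> R[i] by exact: neq0Ci.
have frE : freq R j m = 2 * (j%:~R * m%:~R) :> R by [].
have fr0 : (freq R j m == 0 :> R) = (j == 0) || (m == 0).
  by rewrite frE mulf_eq0 pnatr_eq0/= mulf_eq0 !intr_eq0.
rewrite fr0; have [->|j0] := eqVneq j 0 => /=.
  by rewrite !mul0r mulr0 subrr mulr0 add0r mul1r.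
have [->|m0] := eqVneq m 0 => /=.
  by rewrite !mul0r !mulr0 subrr mulr0 add0r mul1r.
have -> : (freq R j m)%:C = 2 * (j%:~R * m%:~R) :> R[i].
  by rewrite frE !rmorphM/= -!intC rmorph_nat.
have ji : (j%:~R : R[i]) != 0 by rewrite intr_eq0.
have mi : (m%:~R : R[i]) != 0 by rewrite intr_eq0.
have i2 : 'i * 'i = -1 :> R[i] by rewrite -expr2 sqrCi.
have iV : 'i^-1 = - 'i :> R[i] by exact: invCi.
rewrite mul0r mulr0 addr0 !invfM iV.
move: (phase tau j m) (a j) (a m) (j%:~R^-1) (m%:~R^-1) => p aj am J M'.
transitivity (('i * 'i) * ('i / 2 * (p - 1) * J * M' * (aj * am))); last by ring.
by rewrite i2; ring.
Qed.

(** Fourier coefficients of the right-hand side of the integrator, for the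
    coefficients [a] of the old and [c] of the new value. *)
Definition step_coef a c l : R[i] :=
  flow tau a l - 'i * (eps * tau)%:C * (a 0 * flow tau a l + c 0 * c l)
  + 'i * (eps * tau / 2)%:C * delta0 (a 0 ^+ 2 + c 0 ^+ 2) l
  + (eps / 4)%:C * (prod_coef (flow tau (antideriv a)) l + prod_coef (antideriv c) l
      - cis (- (tau * l%:~R ^+ 2)) *
          (prod_coef (antideriv a) l + prod_coef (flow (- tau) (antideriv c)) l)).

Lemma summable_coef_step_coef a c X Y : hb sg |: a :| X -> hb sg |: c :| Y ->
  summable_coef (step_coef a c).
Proof.
move=> ha hc; have hda := hb_antideriv ha; have hdc := hb_antideriv hc.
have sp1 := summable_coef_prod hda; have sp2 := summable_coef_prod (hb_flow (- tau) hdc).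
have sp3 := summable_coef_prod (hb_flow tau hda); have sp4 := summable_coef_prod hdc.
have st := hb_summable_coef (hb_flow tau ha); have sc := hb_summable_coef hc.
have s5 : summable_coef (flow tau (fun l => prod_coef (antideriv a) l + prod_coef (flow (- tau) (antideriv c)) l)).
  by apply: summable_coef_le (summable_coefD sp1 sp2) => l; rewrite cmod_flow.
have s6 := summable_coefD (summable_coefD sp3 sp4) (summable_coefZ (-1) s5).
have s7 := summable_coefD (summable_coefZ (a 0) st) (summable_coefZ (c 0) sc).
have := summable_coefD (summable_coefD (summable_coefD st (summable_coefZ (- ('i * (eps * tau)%:C)) s7))
  (summable_coefZ ('i * (eps * tau / 2)%:C) (summable_coef_delta0 (a 0 ^+ 2 + c 0 ^+ 2))))
  (summable_coefZ (eps / 4)%:C s6).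
by apply: summable_coef_le => l; rewrite /step_coef mulNr mulN1r.
Qed.

(** Conjugation of a product by the linear flow produces the phases, because
    [(j + m) ^ 2 - j ^ 2 - m ^ 2 = 2 j m]. *)
Lemma prod_coef_flow a X l : hb sg |: a :| X ->
  prod_coef (flow tau a) l = cis (- (tau * l%:~R ^+ 2)) *
    zconv (fun j m => phase tau j m * (a j * a m)) l.
Proof.
move=> h.
have ph j m : cmod (phase tau j m) <= 1 by rewrite cmod_phase.
rewrite -(zconvZ _ (kb_mul sg12 ler01 ph h h)).
apply: csum_ext => j; rewrite /flow.
have -> : phase tau j (l - j) = cis (tau * l%:~R ^+ 2) *
    (cis (- (tau * j%:~R ^+ 2)) * cis (- (tau * (l - j)%:~R ^+ 2))) :> R[i].
  rewrite /phase -!cisD; congr cis; rewrite /freq rmorphB/=; ring.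
have := cisNK (tau * l%:~R ^+ 2); move: (cis _) (cis _) => p q pq.
by rewrite !mulrA pq; ring.
Qed.

(** By [Phi_split] and [prod_coef_flow], the right-hand side of the integrator is
    the image of that of [twisted_step] under the linear flow. *)
Lemma step_coefP a b X Y : hb sg |: a :| X -> hb sg |: b :| Y ->
  twisted_step eps tau a b <-> forall l, flow tau b l = step_coef a (flow tau b) l.
Proof.
move=> ha hb_.
have key l : step_coef a (flow tau b) l = cis (- (tau * l%:~R ^+ 2)) *
    (a l - 'i * (eps / 2)%:C * (Phi tau a a l + Phi tau b b l)).
  have flow0 (c : int -> R[i]) : flow tau c 0 = c 0.
    by rewrite /flow expr0n/= mulr0 oppr0 cis0 mul1r.
  have d1 : antideriv (flow tau b) = flow tau (antideriv b) by apply/funext => k; exact: antideriv_flow.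
  have d2 : flow (- tau) (flow tau (antideriv b)) = antideriv b by apply/funext => k; exact: flowK.
  rewrite /step_coef flow0 d1 d2 (prod_coef_flow l (hb_antideriv ha)) (prod_coef_flow l (hb_antideriv hb_)).
  rewrite (Phi_split l ha) (Phi_split l hb_) /flow.
  have E : delta0 (a 0 ^+ 2 + b 0 ^+ 2) l = cis (- (tau * l%:~R ^+ 2)) *
      (delta0 (a 0 ^+ 2) l + delta0 (b 0 ^+ 2) l).
    rewrite /delta0; have [->|_] := eqVneq l 0; last by rewrite !mulr0 addr0 mulr0.
    by rewrite expr0n/= mulr0 oppr0 cis0; ring.
  rewrite E.
  have -> : (eps * tau)%:C = eps%:C * tau%:C :> R[i] by exact: rmorphM.
  have -> : (eps * tau / 2)%:C = eps%:C * tau%:C / 2 :> R[i].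
    by rewrite fmorph_div/= rmorphM/= rmorph_nat.
  have -> : (eps / 2)%:C = eps%:C / 2 :> R[i] by rewrite fmorph_div/= rmorph_nat.
  have i2 : 'i * 'i = -1 :> R[i] by rewrite -expr2 sqrCi.
  have -> : (eps / 4)%:C = - ('i * 'i) * eps%:C / 4 :> R[i].
    by rewrite i2 opprK mul1r fmorph_div/= rmorph_nat.
  by field.
split=> [h l|h l]; first by rewrite key /flow h.
have := h l; rewrite key /flow => /(congr1 (fun z => cis (tau * l%:~R ^+ 2) * z)).
by rewrite !mulrA cisKN !mul1r.
Qed.

End StepCoefficients.

Section StepFunctions.
Variables (R : realType) (sg eps tau : R).
Hypothesis sg12 : 1 / 2 < sg.

(** The right-hand side of the relation [slri_step], in which the new value
    enters both through its coefficients and, linearly, through its values. *)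
Definition step_fun (u v : R -> R[i]) (x : R) : R[i] :=
  let E := schrodinger tau in
  let Em := schrodinger (- tau) in
  let u0 := fourier_coef u 0 in
  let v0 := fourier_coef v 0 in
  E u x - 'i * (eps * tau)%:C * (u0 * E u x + v0 * v x)
  + 'i * (eps * tau / 2)%:C * (u0 ^+ 2 + v0 ^+ 2)
  + (eps / 4)%:C *
      (E (dx_inv u) x ^+ 2 + dx_inv v x ^+ 2
       - E (fun y => dx_inv u y ^+ 2 + Em (dx_inv v) y ^+ 2) x).

Lemma schrodinger_series (t : R) (a : int -> R[i]) : summable_coef a ->
  schrodinger t (fourier_series a) = fourier_series (flow t a).
Proof.
move=> h; rewrite /schrodinger /fourier_multiplier; congr fourier_series.
by apply/funext => l; rewrite fourier_coefK.
Qed.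

(** The right-hand side is an absolutely convergent series, except that [v]
    itself need not be the sum of its own Fourier series at the point [x]. *)
Lemma step_funE (u v : R -> R[i]) (X Y x : R) :
  hb sg |: fourier_coef u :| X -> hb sg |: fourier_coef v :| Y ->
  step_fun u v x =
    fourier_series (step_coef eps tau (fourier_coef u) (fourier_coef v)) x
    - 'i * (eps * tau)%:C * fourier_coef v 0 *
      (v x - fourier_series (fourier_coef v) x).
Proof.
set a := fourier_coef u; set c := fourier_coef v => ha hc.
have sa := hb_summable_coef sg12 ha; have sc := hb_summable_coef sg12 hc.
have Ea : schrodinger tau u = fourier_series (flow tau a) := erefl.
have Da : dx_inv u = fourier_series (antideriv a) := erefl.
have Dc : dx_inv v = fourier_series (antideriv c) := erefl.
have hda := hb_antideriv ha; have hdc := hb_antideriv hc.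
have sda := hb_summable_coef sg12 hda; have sdc := hb_summable_coef sg12 hdc.
have da := hb_summable_antideriv sg12 ha; have dc := hb_summable_antideriv sg12 hc.
have hta := hb_flow tau hda; have htc := hb_flow (- tau) hdc.
have sq (b : int -> R[i]) Z y : hb sg |: b :| Z -> summable_deriv b ->
    fourier_series b y ^+ 2 = fourier_series (prod_coef b) y.
  by move=> hb_ db; rewrite expr2; apply: fourier_series_mul => //; exact: summable_coef_prod hb_.
have flowD (b b' : int -> R[i]) l : flow tau (fun k => b k + b' k) l = flow tau b l + flow tau b' l.
  exact: mulrDr.
have stw (b : int -> R[i]) : summable_coef b -> summable_coef (flow tau b).
  by apply: summable_coef_le => l; rewrite cmod_flow.
rewrite /step_fun Ea Da Dc !schrodinger_series//.
have -> : (fun y => fourier_series (antideriv a) y ^+ 2 + fourier_series (flow (- tau) (antideriv c)) y ^+ 2)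
   = fourier_series (fun l => prod_coef (antideriv a) l + prod_coef (flow (- tau) (antideriv c)) l).
  apply/funext => y; rewrite (sq _ X)// (sq _ Y)//; last exact: summable_deriv_flow.
  by rewrite fsD//; [exact: summable_coef_prod hda|exact: summable_coef_prod htc].
have sp1 := summable_coef_prod sg12 hda; have sp2 := summable_coef_prod sg12 htc.
have sp3 := summable_coef_prod sg12 hta; have sp4 := summable_coef_prod sg12 hdc.
rewrite schrodinger_series; last exact: summable_coefD.
rewrite (sq _ X _ hta); last exact: summable_deriv_flow.
rewrite (sq _ Y _ hdc)//.
pose s1 := flow tau a; have h1 : summable_coef s1 by exact: stw.
pose s5 := flow tau (fun l => prod_coef (antideriv a) l + prod_coef (flow (- tau) (antideriv c)) l).
have h5 : summable_coef s5 by apply: stw; exact: summable_coefD.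
have h6 := summable_coef_delta0 (a 0 ^+ 2 + c 0 ^+ 2).
have hz := summable_coefZ.
pose k1 := - ('i * (eps * tau)%:C * a 0); pose k2 := - ('i * (eps * tau)%:C * c 0).
pose k3 := 'i * (eps * tau / 2)%:C; pose k4 : R[i] := (eps / 4)%:C.
have -> : step_coef eps tau a c = (fun l => s1 l + (k1 * s1 l + (k2 * c l +
    (k3 * delta0 (a 0 ^+ 2 + c 0 ^+ 2) l + k4 * (prod_coef (flow tau (antideriv a)) l +
     (prod_coef (antideriv c) l + (-1) * s5 l)))))).
  apply/funext => l; rewrite /step_coef /s5 /s1 /k1 /k2 /k3 /k4 /flow.
  move: (prod_coef _ l) (prod_coef _ l) (prod_coef _ l) (prod_coef _ l) (delta0 _ l)
    => p1 p2 p3 p4 dl.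
  by move: (cis _) (a l) (a 0) (c l) (c 0) => e al a0 cl c0; ring.
have S1 := hz _ s1 k1 h1; have S2 := hz _ c k2 sc; have S3 := hz _ _ k3 h6.
have S5 := hz _ s5 (-1) h5; have S6 := summable_coefD sp4 S5; have S7 := summable_coefD sp3 S6.
have S4 := hz _ _ k4 S7; have T3 := summable_coefD S3 S4.
have T2 := summable_coefD S2 T3; have T1 := summable_coefD S1 T2.
rewrite (fsD x h1 T1) (fsD x S1 T2) (fsD x S2 T3) (fsD x S3 S4) (fsZ k4 x S7).
rewrite (fsD x sp3 S6) (fsD x sp4 S5) (fsZ _ x h5) (fsZ _ x h6) (fsZ _ x sc).
rewrite (fsZ _ x h1) fourier_series_delta0 /k1 /k2 /k3 /k4.
move: (fourier_series s1 x) (fourier_series c x) (fourier_series s5 x)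
  (fourier_series _ x) (fourier_series _ x) => f1 f2 f3 f4 f5.
rewrite -/a -/c; move: (a 0) (c 0) (v x) => u0 v0 vx; ring.
Qed.

End StepFunctions.

(** * Sobolev norms and pointwise tools *)

Section SobolevNorm.
Variable R : realType.
Implicit Types (f : R -> R[i]) (r X : R) (q : seq int).

Local Notation energy r f := (\esum_(l in [set: int])
  (((1 + l%:~R ^+ 2) `^ r * normsq (fourier_coef f l))%:E))%E.

Lemma energy_le r f X : hb r |: fourier_coef f :| X -> (energy r f <= (X ^+ 2)%:E)%E.
Proof.
move=> [X0 h]; apply: ge_ereal_sup => _ [F [finF _] <-].
rewrite fsbig_finite//= sumEFin lee_fin.
apply: le_trans (h _ (finmap.fset_uniq (fset_set F))).
by under [leRHS]eq_bigr do rewrite sqr_cmod.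
Qed.

Lemma energy_ge r f q : uniq q ->
  ((\sum_(l <- q) wt r l * cmod (fourier_coef f l) ^+ 2)%:E <= energy r f)%E.
Proof.
move=> uq; apply: esum_ge; exists [set` q]; first by split => //; exact: finite_seq.
rewrite -fsbig_seq// sumEFin lee_fin.
by under eq_bigr do rewrite sqr_cmod.
Qed.

Lemma energy_ge0 r f : (0 <= energy r f)%E.
Proof.
by apply: esum_ge0 => l _; rewrite lee_fin mulr_ge0 ?powR_ge0 ?normsq_ge0.
Qed.

Lemma sobolev_norm_ge0 r f : (0 <= sobolev_norm r f)%E.
Proof. exact: poweR_ge0. Qed.

Lemma sobolev_normP r f X : 0 <= X ->
  (sobolev_norm r f <= X%:E)%E <-> hb r |: fourier_coef f :| X.
Proof.
move=> X0; have e0 := energy_ge0 r f; split=> [h|h].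
  split=> // q uq; rewrite -lee_fin; apply: (le_trans (energy_ge r f uq)).
  move: h; rewrite /sobolev_norm; case: (energy r f) e0 => [e| |]//; last by rewrite poweRyr ?invr_neq0.
  rewrite lee_fin => e0; rewrite poweR_EFin !lee_fin powR12_sqrt// => h.
  by rewrite -(sqr_sqrtr e0) ler_pXn2r ?nnegrE ?sqrtr_ge0.
have := energy_le h; rewrite /sobolev_norm; case: (energy r f) e0 => [e| |]//.
rewrite lee_fin => e0; rewrite poweR_EFin !lee_fin powR12_sqrt// => he.
by rewrite -(ger0_norm X0) -sqrtr_sqr ler_wsqrtr.
Qed.

Lemma sobolev_norm_bound_ge0 r f X : (sobolev_norm r f <= X%:E)%E -> 0 <= X.
Proof. by move=> h; rewrite -lee_fin (le_trans (sobolev_norm_ge0 r f)). Qed.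

Lemma sobolev_norm_hb r f X : (sobolev_norm r f <= X%:E)%E ->
  hb r |: fourier_coef f :| X.
Proof. by move=> h; apply/sobolev_normP => //; exact: sobolev_norm_bound_ge0 h. Qed.

Lemma sobolev_cmeas r f : sobolev r f -> cmeas f.
Proof. by move=> [_ [m1 m2 _] _]; split; [exact: m1|exact: m2]. Qed.

Lemma L2_cint f : L2 f -> cint f.
Proof.
move=> [m1 m2 h]; have mI := @measurable_torus R.
have h1 : lebesgue_measure.-integrable (torus (R:=R)) (fun=> 1%:E).
  have := measurable_bounded_integrable mI (measure_torus_lty R)
    (@measurable_cst _ _ _ _ _ (1 : R)).
  by apply; apply: (@bounded_le _ _ 1) => x _; rewrite normr1.
have h2 := integrableD mI h1 h.
have key (u : R -> R) : (forall x, `|u x| <= 1 + normsq (f x)) ->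
    measurable_fun (torus (R:=R) : set (measurableTypeR R)) u ->
    lebesgue_measure.-integrable (torus (R:=R)) (EFin \o u).
  move=> hu mu; apply: le_integrable h2 => //; first exact/measurable_EFinP.
  move=> x _ /=; rewrite lee_fin (le_trans (hu x))//.
  by rewrite ger0_norm// addr_ge0// normsq_ge0.
have sq (a b : R) : `|a| <= 1 + (a ^+ 2 + b ^+ 2).
  have : 0 <= (`|a| - 1) ^+ 2 + `|a| ^+ 2 by rewrite addr_ge0 ?sqr_ge0.
  have := sqr_ge0 b; rewrite -(real_normK (num_real a)).
  by have := normr_ge0 a; nra.
split; apply: key => // x.
- exact: sq.
- by rewrite (le_trans (sq _ (complex.Re (f x))))// /normsq lerD2l addrC.
Qed.

End SobolevNorm.

Section PointwiseTools.
Variable R : realType.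
Implicit Types (f : R -> R[i]) (x t S : R) (d : R[i]).

Lemma cderive_val f x d : is_cderive f x d -> cderive f x = d.
Proof.
move=> [h1 h2]; apply: complex_ext; rewrite /cderive/= derive1E.
  by rewrite (@derive_val _ _ _ _ _ _ _ h1).
by rewrite (@derive_val _ _ _ _ _ _ _ h2).
Qed.

Lemma cderivableP f x : cderivable f x -> is_cderive f x (cderive f x).
Proof.
move=> [h1 h2]; split; [apply: (DeriveDef h1)|apply: (DeriveDef h2)];
  exact: esym (derive1E _ _).
Qed.

Lemma is_derive_lip_at (u : R -> R) (x d : R) : is_derive x 1 u d ->
  exists2 dl, 0 < dl & forall y, `|y - x| < dl -> `|u y - u x| <= (`|d| + 1) * `|y - x|.
Proof.
move=> [du dE].
have H : h^-1 *: (u (h *: 1 + x) - u x) @[h --> 0^'] --> d.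
  by rewrite -dE; exact: du.
move/cvgrPdist_le : H => /(_ 1 ltr01) [dl /= dl0 hdl].
exists dl => // y hy; have [->|yx] := eqVneq y x; first by rewrite !subrr normr0 mulr0.
have yx0 : y - x != 0 by rewrite subr_eq0.
have := hdl (y - x); rewrite /= sub0r normrN => /(_ hy yx0).
rewrite [_ *: 1]mulr1 subrK => h.
have hn : 0 < `|y - x| by rewrite normr_gt0.
have -> : u y - u x = (y - x) * ((y - x)^-1 *: (u y - u x)).
  by rewrite [_ *: _]/(_ * _) mulrA divff// mul1r.
rewrite normrM mulrC ler_wpM2r// -lerBlDl (le_trans (lerB_dist _ _))//.
by rewrite distrC.
Qed.

Lemma clamp_in S t : 0 <= S -> 0 <= Num.max 0 (Num.min t S) <= S.
Proof. by move=> S0; rewrite le_max lexx/= ge_max S0 ge_min lexx orbT. Qed.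

Lemma clamp_id S t : 0 <= t <= S -> Num.max 0 (Num.min t S) = t.
Proof. by move=> /andP[t0 tS]; rewrite min_l// max_r. Qed.

Lemma continuous_clamp S : continuous (fun t : R => Num.max 0 (Num.min t S)).
Proof.
move=> t; apply: (@continuous_max R R (fun=> 0) (fun t => Num.min t S) t).
  exact: cvg_cst.
by apply: (@continuous_min R R id (fun=> S) t); [exact: cvg_id|exact: cvg_cst].
Qed.

(** Composing with the projection onto [[0, S]] turns continuity within the
    closed interval into continuity on the line, and [within_of_clamp] goes
    back: results on open intervals thus reach the end points. *)
Lemma continuous_comp_clamp S (u : R -> R) : 0 <= S -> {within `[0, S], continuous u} ->
  continuous (fun t => u (Num.max 0 (Num.min t S))).
Proof.
move=> S0 /subspace_continuousP cu t.
have ct : `[0, S]%classic (Num.max 0 (Num.min t S)) by rewrite /= in_itv/= clamp_in.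
have key : Num.max 0 (Num.min y S) @[y --> t] -->
    within `[0, S] (nbhs (Num.max 0 (Num.min t S))).
  move=> W hW; have hN : \forall y \near t, `[0, S]%classic (Num.max 0 (Num.min y S)) ->
      W (Num.max 0 (Num.min y S)) := @continuous_clamp S t _ hW.
  suff : \forall y \near t, W (Num.max 0 (Num.min y S)) by [].
  apply: filterS hN => y; apply.
  by have := clamp_in y S0; rewrite /= in_itv.
exact: cvg_comp key (cu _ ct).
Qed.

Lemma within_of_clamp S (u : R -> R) : 0 <= S ->
  {in `]-1, S + 1[, continuous (fun t => u (Num.max 0 (Num.min t S)))} ->
  {within `[0, S], continuous u}.
Proof.
move=> S0 h; apply/subspace_continuousP => t; rewrite /= in_itv/= => tS.
have tI : t \in `]-1, S + 1[ by rewrite in_itv/=; move: tS => /andP[t0 t1]; apply/andP; split; lra.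
have := h t tI; rewrite /continuous_at clamp_id// => hc.
move=> W hW.
have hN : \forall y \near t, W (u (Num.max 0 (Num.min y S))) := hc W hW.
suff : \forall y \near t, `[0, S]%classic y -> W (u y) by [].
by apply: filterS hN => y hy; rewrite /= in_itv/= => /clamp_id e; rewrite -e.
Qed.

End PointwiseTools.

(** * The exact solution *)

Section PointwiseInversion.
Variable R : realType.
Implicit Types (f : R -> R[i]) (x y : R).

Lemma periodic_bounded f : periodic2pi f -> (forall x, cderivable f x) ->
  exists B, forall x, cmod (f x) <= B.
Proof.
move=> pf df; have pi0 := pi_gt0 R.
pose h x := `|complex.Re (f x)| + `|complex.Im (f x)|.
have ch : continuous h.
  move=> x; have [c1 c2] := is_cderive_continuous (cderivableP (df x)).
  by apply: cvgD; apply: cvg_norm.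
have hN : - pi <= pi :> R by lra.
have [c _ hc] := EVT_max hN (continuous_subspaceT ch).
exists (h c) => x; have [l] := near_representative x 0; rewrite subr0 => hl.
rewrite -(periodic2pi_int pf l x) (le_trans (cmod_le_ReIm _))// hc// in_itv/=.
by rewrite -ler_norml.
Qed.

(** Near [x] by differentiability, elsewhere because a continuous periodic
    function is bounded. *)
Lemma periodic_lip_at f x : periodic2pi f -> (forall x, cderivable f x) ->
  exists L, forall y, cmod (f y - f x) <= L * `|y - x|.
Proof.
move=> pf df; have [B hB] := periodic_bounded pf df.
have [h1 h2] := cderivableP (df x).
have [d1 d10 l1] := is_derive_lip_at h1; have [d2 d20 l2] := is_derive_lip_at h2.
pose d := Num.min d1 d2; have d0 : 0 < d by rewrite lt_min d10.
set a := `|complex.Re (cderive f x)| + 1 in l1.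
set b := `|complex.Im (cderive f x)| + 1 in l2.
have a0 : 0 <= a by rewrite addr_ge0.
have b0 : 0 <= b by rewrite addr_ge0.
clearbody a b.
have B0 : 0 <= B by rewrite (le_trans (cmod_ge0 _) (hB 0)).
have q0 : 0 <= (B + B) / d by rewrite divr_ge0 ?(ltW d0)// addr_ge0.
exists (a + b + (B + B) / d) => y; have y0 := normr_ge0 (y - x).
have [yd|yd] := ltP `|y - x| d.
  move: yd; rewrite lt_min => /andP[/l1 k1 /l2 k2].
  rewrite (le_trans (cmod_le_ReIm _))// cReB cImB !mulrDl.
  have : 0 <= B / d * `|y - x| by rewrite !mulr_ge0// invr_ge0 ltW.
  by lra.
rewrite mulrDl (le_trans (cmodB _ _))//.
apply: (@le_trans _ _ ((B + B) / d * `|y - x|)).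
  rewrite (le_trans (lerD (hB _) (hB _)))// -mulrA ler_peMr ?addr_ge0//.
  by rewrite ler_pdivlMl// mulr1.
by rewrite lerDr mulr_ge0// addr_ge0.
Qed.

Lemma differentiable_fourier_series f A : periodic2pi f -> cmeas f ->
  (forall x, cderivable f x) -> l1b |: fourier_coef f :| A ->
  f = fourier_series (fourier_coef f).
Proof.
move=> pf mf df hA; apply/funext => x.
have [L hL] := periodic_lip_at x pf df.
by rewrite (fourier_inversion pf mf hL hA).
Qed.

End PointwiseInversion.

Section ExactSolution.
Variables (R : realType) (r eps S M : R) (phi : R -> R[i]) (w : R -> R -> R[i]).
Hypotheses (r12 : 1 / 2 < r) (eps01 : 0 < eps <= 1) (S0 : 0 < S).
Hypothesis w_sol : qnls_solution eps S phi w.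
Hypothesis w_bound : forall t, 0 <= t <= S ->
  sobolev (r + 2) (w t) /\ (sobolev_norm (r + 2) (w t) <= M%:E)%E.

Local Notation mu := (@lebesgue_measure R).
Local Notation I := (@torus R).

Definition w_coef (t : R) : int -> R[i] := fourier_coef (w t).

Lemma w_coef_hb2 t : 0 <= t <= S -> hb (r + 2) |: w_coef t :| M.
Proof. by move=> /w_bound[_ h]; exact: sobolev_norm_hb. Qed.

Lemma w_coef_hb t s : s <= r + 2 -> 0 <= t <= S -> hb s |: w_coef t :| M.
Proof. by move=> sr /w_coef_hb2; exact: hb_weaken. Qed.

Let A := l1_const r * M.

Lemma w_coef_l1 t : 0 <= t <= S -> l1b |: w_coef t :| A.
Proof. by move=> ht; apply: hb_l1 => //; apply: w_coef_hb ht; rewrite lerDl. Qed.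

Lemma w_coef_l1' t : 0 <= t <= S -> l1b (fun l => `|l%:~R| * cmod (w_coef t l)) A.
Proof.
move=> ht; apply: hb_l1 => //; apply: hb_deriv; apply: w_coef_hb ht.
by rewrite lerD2l ler1n.
Qed.

Lemma w_coef_l1'' t : 0 <= t <= S ->
  l1b (fun l => `|l%:~R| * cmod (deriv_coef (w_coef t) l)) A.
Proof.
move=> ht.
have -> : (fun l => `|l%:~R| * cmod (deriv_coef (w_coef t) l)) =
    (fun l => `|l%:~R| * (`|l%:~R| * cmod (w_coef t l))).
  by apply/funext => l; rewrite cmod_deriv_coef.
apply: hb_l1 => //; apply: hb_deriv; apply: hb_deriv; apply: w_coef_hb ht.
by rewrite -addrA.
Qed.

Lemma deriv_l1 t : 0 <= t <= S -> l1b |: deriv_coef (w_coef t) :| A.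
Proof. by move=> ht; apply: l1b_mono (w_coef_l1' ht) => l; rewrite cmod_deriv_coef. Qed.

Lemma deriv2_l1 t : 0 <= t <= S -> l1b |: deriv_coef (deriv_coef (w_coef t)) :| A.
Proof.
by move=> ht; apply: l1b_mono (w_coef_l1'' ht) => l; rewrite [leLHS]cmod_deriv_coef.
Qed.

Let ltW2 t : 0 < t < S -> 0 <= t <= S.
Proof. by move=> /andP[/ltW -> /ltW ->]. Qed.

Lemma w_series t : 0 < t < S -> w t = fourier_series (w_coef t).
Proof.
move=> ht; have h := ltW2 ht; have [hs _] := w_bound h; have [pf _ _] := hs.
apply: (@differentiable_fourier_series _ _ A) => //.
- exact: sobolev_cmeas hs.
- by move=> x; have [_ _ /(_ t x ht)[]] := w_sol.
- exact: w_coef_l1.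
Qed.

(** The time derivative given by the equation. The series converge absolutely,
    so that it is bounded uniformly in time and space. *)
Definition w_rate t x : R[i] :=
  'i * fourier_series (deriv_coef (deriv_coef (w_coef t))) x
  - 'i * eps%:C * (fourier_series (w_coef t) x * fourier_series (w_coef t) x).

Lemma w_rateP t x : 0 < t < S -> is_cderive (fun s => w s x) t (w_rate t x).
Proof.
move=> ht; have h := ltW2 ht.
have [_ _ /(_ t x ht)[dt dx ddx eq]] := w_sol.
have := cderivableP dt; congr is_cderive.
have wE := w_series ht.
have d1 : cderive (w t) = fourier_series (deriv_coef (w_coef t)).
  apply/funext => y; apply: cderive_val; rewrite {1}wE.
  exact: is_cderive_fourier_series (w_coef_l1 h) (w_coef_l1' h).
have d2 : cderive (cderive (w t)) x = fourier_series (deriv_coef (deriv_coef (w_coef t))) x.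
  apply: cderive_val; rewrite d1.
  exact: is_cderive_fourier_series (deriv_l1 h) (w_coef_l1'' h).
have i0 : 'i != 0 :> R[i] by exact: neq0Ci.
have wx : w t x = fourier_series (w_coef t) x by rewrite {1}wE.
have i2 : 'i * 'i = -1 :> R[i] by rewrite -expr2 sqrCi.
apply: (mulfI i0); rewrite eq d2 wx /w_rate.
move: (fourier_series (w_coef t) x) (fourier_series (deriv_coef _) x) => g f.
rewrite -[RHS]/('i * ('i * f - 'i * eps%:C * (g * g))).
transitivity ('i * 'i * f - 'i * 'i * (eps%:C * (g * g))); last by ring.
by rewrite i2; ring.
Qed.

Let A0 : 0 <= A.
Proof. by have := w_coef_l1 (t := 0); rewrite lexx ltW// => /(_ isT)/l1b_ge0. Qed.

Let B := A + A * A.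

Lemma w_rate_bound t x : 0 < t < S -> cmod (w_rate t x) <= B.
Proof.
move=> ht; have h := ltW2 ht.
have b1 := fourier_series_bound x (deriv2_l1 h).
have b2 := fourier_series_bound x (w_coef_l1 h).
have /andP[/ltW e0 e1] := eps01.
rewrite (le_trans (cmodB _ _))// !cmodM cmodi !mul1r cmodR ger0_norm//.
apply: lerD => //; apply: (@le_trans _ _ (1 * (A * A))); last by rewrite mul1r.
by rewrite ler_pM// ?mulr_ge0 ?cmod_ge0// ler_pM ?cmod_ge0.
Qed.

Let clamp t := Num.max 0 (Num.min t S).

Let clampP t : 0 <= clamp t <= S. Proof. exact: clamp_in (ltW S0). Qed.

Let w_clamp_continuous x : continuous (fun t => complex.Re (w (clamp t) x)) /\
  continuous (fun t => complex.Im (w (clamp t) x)).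
Proof.
have [_ /(_ x)[c1 c2] _] := w_sol.
split; first exact: (continuous_comp_clamp (ltW S0) c1).
exact: (continuous_comp_clamp (ltW S0) c2).
Qed.

Let approx0 (n : nat) : R := S / 2 * harmonic n.

Let approx0_in n : 0 < approx0 n < S.
Proof.
rewrite /approx0; have h0 : 0 < harmonic n :> R by exact: harmonic_gt0.
have h1 : harmonic n <= 1 :> R by rewrite /harmonic/= invf_le1// ler1n.
rewrite mulr_gt0 ?divr_gt0//=; apply: (@le_lt_trans _ _ (S / 2 * 1)).
  by rewrite ler_wpM2l// divr_ge0 ?ltW.
by have := S0; lra.
Qed.

Let approx0_cvg : approx0 @ \oo --> (0 : R).
Proof. by apply: cvg_scale0; exact: cvg_harmonic. Qed.

(** Inside the interval the solution is the sum of its Fourier series; the bound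
    reaches the end points by continuity of real and imaginary parts, whence
    [A + A]. *)
Lemma w_bounded t x : 0 <= t <= S -> cmod (w t x) <= A + A.
Proof.
move=> ht; have [c1 c2] := w_clamp_continuous x.
have inner s : 0 < s < S -> cmod (w s x) <= A.
  by move=> hs; rewrite (w_series hs) fourier_series_bound// ; exact: w_coef_l1 (ltW2 hs).
have clE s : 0 < s < S -> clamp s = s by move=> /ltW2; exact: clamp_id.
have key (u : nat -> R) : u @ \oo --> t -> (forall n, 0 < u n < S) ->
    cmod (w t x) <= A + A.
  move=> ut uS; rewrite (le_trans (cmod_le_ReIm _))//.
  rewrite -(clamp_id ht) -/(clamp t); apply: lerD.
  - have h := cvg_comp _ _ ut (c1 t).
    apply: (cvgr_to_le (cvg_norm h)); apply: nearW => n /=.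
    by rewrite clE// (le_trans (normr_Re _))// inner.
  - have h := cvg_comp _ _ ut (c2 t).
    apply: (cvgr_to_le (cvg_norm h)); apply: nearW => n /=.
    by rewrite clE// (le_trans (normr_Im _))// inner.
have [t0|tn0] := eqVneq t 0; first by apply: (key approx0) => //; rewrite t0.
have [tS|tnS] := eqVneq t S.
  apply: (key (fun n => S - approx0 n)).
    rewrite tS -[X in _ --> X]subr0; apply: cvgB => //; exact: cvg_cst.
  by move=> n; have /andP[h1 h2] := approx0_in n; rewrite subr_gt0 h2/= gtrBl.
apply: (key (fun=> t)); first exact: cvg_cst.
by move=> _; move: ht; rewrite !lt_neqAle eq_sym tn0 tnS.
Qed.

Lemma w_cint t : 0 <= t <= S -> cint (w t).
Proof. by move=> /w_bound[[_ /L2_cint]]. Qed.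

Let mI := @measurable_torus R.

Let integrand l t x := w t x * cis (- (l%:~R * x)).

Let integrand_bound l t x : 0 <= t <= S -> cmod (integrand l t x) <= A + A.
Proof. by move=> ht; rewrite cmod_mul_cis w_bounded. Qed.

Let cint_integrand l t : 0 <= t <= S -> cint (integrand l t).
Proof. by move=> ht; apply: cint_mul_char; exact: w_cint. Qed.

Let int_cst (c : R) : mu.-integrable I (EFin \o (fun=> c)).
Proof.
apply: measurable_bounded_integrable => //; first exact: measure_torus_lty.
by apply: (@bounded_le _ _ `|c|).
Qed.

(** Dominated convergence on the torus, with a constant majorant. *)
Lemma w_coef_continuous l : ccontinuous_on `[0, S] (fun t => w_coef t l).
Proof.
rewrite /w_coef /fourier_coef; apply: ccontinuous_onM.
  by split => x; exact: cvg_cst.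
have cI x : continuous (fun t => complex.Re (integrand l (clamp t) x)) /\
    continuous (fun t => complex.Im (integrand l (clamp t) x)).
  have [c1 c2] := w_clamp_continuous x; rewrite /integrand; split => t.
  - under eq_fun do rewrite cReM.
    by apply: cvgB; apply: cvgM; [exact: c1|exact: cvg_cst|exact: c2|exact: cvg_cst].
  - under eq_fun do rewrite cImM.
    by apply: cvgD; apply: cvgM; [exact: c1|exact: cvg_cst|exact: c2|exact: cvg_cst].
split; apply: (within_of_clamp (ltW S0)).
- move=> t tI; apply: (@continuity_under_integral R _ _ mu
    (fun t x => complex.Re (integrand l (clamp t) x)) I mI (-1) (S + 1)
    _ _ (fun=> A + A) _ _ t (mem_set tI)).
  + by move=> s _; have [] := cint_integrand l (clampP s).
  + by apply: aeW => x _ s _; have [h _] := cI x; exact: h.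
  + exact: int_cst.
  + move=> s _; apply: aeW => x _.
    by rewrite (le_trans (normr_Re _))// integrand_bound.
- move=> t tI; apply: (@continuity_under_integral R _ _ mu
    (fun t x => complex.Im (integrand l (clamp t) x)) I mI (-1) (S + 1)
    _ _ (fun=> A + A) _ _ t (mem_set tI)).
  + by move=> s _; have [] := cint_integrand l (clampP s).
  + by apply: aeW => x _ s _; have [_ h] := cI x; exact: h.
  + exact: int_cst.
  + move=> s _; apply: aeW => x _.
    by rewrite (le_trans (normr_Im _))// integrand_bound.
Qed.

Lemma integrand_derive l t x : 0 < t < S ->
  is_cderive (fun s => integrand l s x) t (w_rate t x * cis (- (l%:~R * x))).
Proof.
move=> ht.
have := is_cderiveM (w_rateP x ht) (is_cderive_cst (cis (- (l%:~R * x))) t).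
by rewrite mulr0 add0r.
Qed.

(** Differentiation under the integral sign, the derivative of the integrand
    being bounded by a constant. *)
Lemma w_coef_derive l t : 0 < t < S ->
  is_cderive (fun s => w_coef s l) t (fourier_coef (w_rate t) l).
Proof.
move=> ht.
have B0 : 0 <= B by rewrite addr_ge0// mulr_ge0.
have tI : `]0, S[%classic t by rewrite /= in_itv.
have inI s : `]0, S[%classic s -> 0 < s < S by rewrite /= in_itv.
pose G s x := w_rate s x * cis (- (l%:~R * x)).
have key (p : R[i] -> R) : (forall z, `|p z| <= cmod z) ->
    (forall s, 0 < s < S -> mu.-integrable I (EFin \o (fun x => p (integrand l s x)))) ->
    (forall s x, 0 < s < S -> is_derive s 1 (fun s => p (integrand l s x)) (p (G s x))) ->
    is_derive t 1 (fun s => \int[mu]_(x in I) p (integrand l s x))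
      (\int[mu]_(x in I) p (G t x)).
  move=> hp hint hder.
  pose P s x := p (integrand l s x).
  have i1 s : `]0, S[%classic s -> mu.-integrable I (EFin \o P s).
    by move=> /inI; exact: hint.
  have i2 s x : `]0, S[%classic s -> I x -> derivable (P ^~ x) s 1.
    by move=> /inI/(hder s x)[].
  have d1 s x : `]0, S[%classic s -> partial1of2 P s x = p (G s x).
    by move=> /inI/(hder s x) h; rewrite partial1of2E (@derive_val _ _ _ _ _ _ _ h).
  have i3 s x : `]0, S[%classic s -> I x -> `|partial1of2 P s x| <= B.
    move=> hs _; rewrite d1// (le_trans (hp _))// cmod_mul_cis.
    exact: w_rate_bound (inI _ hs).
  have hd := @derivable_under_integral R _ _ mu P I mI t 0 S tI i1 i2
    (fun=> B) (fun=> B0) (int_cst B) i3.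
  have hv := @differentiation_under_integral R _ _ mu P I mI t 0 S tI i1 i2
    (fun=> B) (fun=> B0) (int_cst B) i3.
  apply: (DeriveDef hd); rewrite -derive1E hv.
  by apply: eq_Rintegral => x _; rewrite d1.
suff h : is_cderive (fun s => torus_integral (integrand l s)) t (torus_integral (G t)).
  have := is_cderiveM (is_cderive_cst ((2 * pi)^-1%:C) t) h.
  by rewrite mul0r addr0.
split.
- apply: (key (@complex.Re R)); first exact: normr_Re.
  + by move=> s /ltW2/(cint_integrand l)[].
  + by move=> s x /(integrand_derive l x)[].
- apply: (key (@complex.Im R)); first exact: normr_Im.
  + by move=> s /ltW2/(cint_integrand l)[].
  + by move=> s x /(integrand_derive l x)[].
Qed.

Lemma w_rate_coef l t : 0 <= t <= S ->
  fourier_coef (w_rate t) l =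
  - 'i * (l%:~R ^+ 2)%:C * w_coef t l - 'i * eps%:C * prod_coef (w_coef t) l.
Proof.
move=> h; have hd := deriv2_l1 h; have hc := w_coef_l1 h.
have i1 := cint_fourier_series hd.
have i2 : cint (fun x => fourier_series (w_coef t) x * fourier_series (w_coef t) x).
  have h1 := cmeas_fourier_series hc; have h2 := cbounded_fourier_series hc.
  exact: cintM (cint_fourier_series hc) h1 h2.
rewrite /w_rate fourier_coefB; try exact: cintZ.
rewrite !fourier_coefZ// (fourier_coef_mul_series _ hc hc) (fourier_coef_series _ hd).
congr (_ - _); rewrite /deriv_coef intC rmorphXn/=.
have i3 : 'i * 'i = -1 :> R[i] by rewrite -expr2 sqrCi.
move: (w_coef t l) (l%:~R%:C) => z y.
transitivity ('i * ('i * 'i) * y ^+ 2 * z); first by ring.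
by rewrite i3; ring.
Qed.

(** The solution seen from time [tn] in the rotating frame of the linear flow. *)
Definition twisted tn s l : R[i] := cis (s * l%:~R ^+ 2) * w_coef (tn + s) l.

Lemma cmod_twisted tn s l : cmod (twisted tn s l) = cmod (w_coef (tn + s) l).
Proof. by rewrite cmodM cmod_cis mul1r. Qed.

Lemma twisted0 tn l : twisted tn 0 l = w_coef tn l.
Proof. by rewrite /twisted mul0r cis0 mul1r addr0. Qed.

Lemma flow_twisted tn s l : flow s (twisted tn s) l = w_coef (tn + s) l.
Proof. by rewrite /flow /twisted mulrA cisNK mul1r. Qed.

(** The rotation cancels the linear term of the equation, and
    [prod_coef_flow] turns the product into the sum with phases. *)
Lemma twisted_derive tn s l : 0 < tn + s < S ->
  is_cderive (fun x => twisted tn x l) s (twisted_rhs eps s (twisted tn s) l).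
Proof.
move=> ht; have h := ltW2 ht.
have shift (u : R -> R) d : is_derive (tn + s) 1 u d -> is_derive s 1 (fun x => u (tn + x)) d.
  move=> hu.
  have hs : is_derive s 1 (fun x : R => tn + x) 1.
    by have := is_deriveD (is_derive_cst tn s 1) (is_derive_id s 1); rewrite add0r.
  have := @is_derive1_comp R u (fun x => tn + x) s _ _ hu hs.
  by rewrite mulr1.
have [d1 d2] := w_coef_derive l ht.
have dw : is_cderive (fun x => w_coef (tn + x) l) s (fourier_coef (w_rate (tn + s)) l).
  by split; [exact: shift d1|exact: shift d2].
have := is_cderiveM (is_cderive_cis (l%:~R ^+ 2) s) dw.
congr is_cderive; rewrite w_rate_coef//.
have hv : hb r |: twisted tn s :| M.
  apply: hb_mono (w_coef_hb (s := r) _ h) => [k|]; last by rewrite lerDl.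
  by rewrite cmod_ge0 cmod_twisted/=.
have -> : prod_coef (w_coef (tn + s)) l = prod_coef (flow s (twisted tn s)) l.
  have e : flow s (twisted tn s) = w_coef (tn + s).
    by apply/funext => k; exact: flow_twisted.
  by rewrite e.
rewrite (prod_coef_flow s r12 l hv) /twisted_rhs.
move: (zconv _ l) (w_coef _ l) => z u.
transitivity (- 'i * eps%:C * z * (cis (- (s * l%:~R ^+ 2)) * cis (s * l%:~R ^+ 2))).
  by ring.
by rewrite cisNK mulr1.
Qed.

Lemma twisted_continuous tn tau l : 0 <= tn -> 0 <= tau -> tn + tau <= S ->
  ccontinuous_on `[0, tau] (fun x => twisted tn x l).
Proof.
move=> tn0 tau0 tS.
apply: ccontinuous_onM.
  exact: (ccontinuous_is_cderive _ (is_cderive_cis (l%:~R ^+ 2))).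
have key (u : R -> R) : {within `[0, S], continuous u} ->
    {within `[0, tau], continuous (fun x => u (tn + x))}.
  move=> /(continuous_comp_clamp (ltW S0)) cu.
  have cs : {within `[0, tau], continuous (fun x => u (clamp (tn + x)))}.
    apply: continuous_subspaceT => x.
    apply: (@continuous_comp _ _ _ (fun x => tn + x) (fun y => u (clamp y))).
      by apply: cvgD; [exact: cvg_cst|exact: cvg_id].
    exact: cu.
  apply: subspace_eq_continuous cs => x; rewrite inE/= in_itv/= => /andP[x0 xt].
  have h : 0 <= tn + x <= S by rewrite addr_ge0//= (le_trans _ tS)// lerD2l.
  by rewrite /from_subspace /clamp clamp_id.
have [c1 c2] := w_coef_continuous l.
by split; [exact: key c1|exact: key c2].
Qed.

Lemma exact_local_error tn tau : 0 <= tn -> 0 <= tau -> tn + tau <= S ->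
  hb r |: fun l => twisted tn tau l - w_coef tn l + 'i * (eps / 2)%:C *
    (Phi tau (w_coef tn) (w_coef tn) l + Phi tau (twisted tn tau) (twisted tn tau) l) :|
    (local_const r M * eps ^+ 2 * tau ^+ 3).
Proof.
move=> tn0 tau0 tS.
have hv t : 0 <= t <= tau -> hb (r + 1) |: twisted tn t :| M.
  move=> /andP[t0 tt].
  have h : 0 <= tn + t <= S by rewrite addr_ge0//= (le_trans _ tS)// lerD2l.
  apply: hb_mono (w_coef_hb (s := r + 1) _ h) => [k|]; last by rewrite lerD2l ler1n.
  by rewrite cmod_ge0 cmod_twisted/=.
have hd t l : 0 < t < tau ->
    is_cderive ((twisted tn)^~ l) t (twisted_rhs eps t (twisted tn t) l).
  move=> /andP[t0 tt]; apply: twisted_derive.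
  by rewrite ltr_wpDl//= (lt_le_trans _ tS)// ltrD2l.
have e : twisted tn 0 = w_coef tn by apply/funext => k; exact: twisted0.
have := local_error r12 eps01 tau0 (fun l => twisted_continuous l tn0 tau0 tS) hd hv.
by rewrite e.
Qed.

End ExactSolution.

(** * The global error *)

Section OneStep.
Variables (R : realType) (r eps tau K : R).
Hypotheses (r12 : 1 / 2 < r) (eps0 : 0 <= eps) (tau0 : 0 <= tau).
Implicit Types (u v : R -> R[i]).

Lemma flow_flowK (t : R) (a : int -> R[i]) : flow t (flow (- t) a) = a.
Proof. by apply/funext => l; have := flowK (- t) a l; rewrite opprK. Qed.

(** The relation holds almost everywhere, so that Fourier coefficients can be
    compared. The difference between the new value and its Fourier series has
    zero coefficients and drops out. *)
Lemma step_twisted u v X Y :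
  hb r |: fourier_coef u :| X -> hb r |: fourier_coef v :| Y ->
  L2 v -> slri_step eps tau u v ->
  twisted_step eps tau (fourier_coef u) (flow (- tau) (fourier_coef v)).
Proof.
move=> hu hv L2v hstep.
apply/(step_coefP eps tau r12 hu (hb_flow (- tau) hv)) => l; rewrite flow_flowK.
set sc := step_coef eps tau (fourier_coef u) (fourier_coef v).
have [A hA] : summable_coef sc by exact: (summable_coef_step_coef _ _ r12 hu hv).
have [A' hA'] := hb_summable_coef r12 hv.
pose k : R[i] := - ('i * (eps * tau)%:C * fourier_coef v 0).
have iv := L2_cint L2v.
have if1 := cint_fourier_series hA; have if2 := cint_fourier_series hA'.
have id : cint (fun x => v x - fourier_series (fourier_coef v) x).
  have := cintD iv (cintZ (-1) if2).
  by congr cint; apply/funext => x; rewrite mulN1r.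
have iR := cintD if1 (cintZ k id).
have E : {ae (@lebesgue_measure R), forall x, v x = fourier_series sc x +
    k * (v x - fourier_series (fourier_coef v) x)}.
  apply: negligibleS hstep => x /= hx vx; apply: hx; rewrite [LHS]vx.
  by rewrite -[LHS]/(step_fun eps tau u v x) (step_funE eps tau r12 x hu hv) /k mulNr.
have -> : fourier_coef v l = fourier_coef (fun x => fourier_series sc x +
    k * (v x - fourier_series (fourier_coef v) x)) l.
  congr (_ * _); apply: ae_eq_torus_integral.
  - exact: (cint_meas (cint_mul_char l iv)).
  - exact: (cint_meas (cint_mul_char l iR)).
  - by apply: negligibleS E => x /= hx vx; apply: hx; rewrite -vx.
rewrite fourier_coefD//; last exact: cintZ.
rewrite fourier_coefZ// fourier_coefB// (fourier_coef_series _ hA) (fourier_coef_series _ hA').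
by rewrite subrr mulr0 addr0.
Qed.

Lemma sobolev_fourier_series (b : int -> R[i]) : 0 <= K -> hb r |: b :| K ->
  [/\ sobolev r (fourier_series b), (sobolev_norm r (fourier_series b) <= K%:E)%E &
      fourier_coef (fourier_series b) = b].
Proof.
move=> K0 hb_; have [A hA] := hb_summable_coef r12 hb_.
have bE : fourier_coef (fourier_series b) = b.
  by apply/funext => l; exact: fourier_coef_series hA.
have hn : (sobolev_norm r (fourier_series b) <= K%:E)%E.
  by apply/sobolev_normP => //; rewrite bE.
split=> //; split; last by rewrite (le_lt_trans hn)// ltry.
  exact: fourier_series_periodic.
have [m1 m2] := cmeas_fourier_series hA.
split; [exact: m1|exact: m2|].
have := @measurable_bounded_integrable _ _ _ (@lebesgue_measure R)
  (fun x => normsq (fourier_series b x)) _ (@measurable_torus R).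
apply; first exact: measure_torus_lty.
  by apply: measurable_funD; exact: measurable_funX.
have A0 := l1b_ge0 hA; apply: (@bounded_le _ _ (A ^+ 2)) => x _.
rewrite ger0_norm ?normsq_ge0// -sqr_cmod ler_pXn2r ?nnegrE ?cmod_ge0//.
exact: fourier_series_bound.
Qed.

(** The Fourier series of the fixed point is a representative for which the
    step relation holds at every point. *)
Lemma next_value u U : hb r |: fourier_coef u :| U ->
  eps * tau * alg_const r * K <= 1 / 2 ->
  U + eps * tau * alg_const r * K ^+ 2 <= K ->
  exists v, [/\ sobolev r v, (sobolev_norm r v <= K%:E)%E & slri_step eps tau u v].
Proof.
move=> hu x12 hU.
have A0 := ltW (alg_const_gt0 r12).
have K0 : 0 <= K.
  by apply: le_trans hU; have U0 := hb_ge0 hu; nonneg.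
have [b [hbK hstep]] := step_exists r12 eps0 tau0 x12 hu hU.
have htw := hb_flow tau hbK.
have [sv nv vE] := sobolev_fourier_series K0 htw.
exists (fourier_series (flow tau b)); split => //.
apply: aeW => x.
rewrite -[RHS]/(step_fun eps tau u (fourier_series (flow tau b)) x).
have hv : hb r |: fourier_coef (fourier_series (flow tau b)) :| K by rewrite vE.
rewrite (step_funE eps tau r12 x hu hv) vE subrr mulr0 subr0.
have e : step_coef eps tau (fourier_coef u) (flow tau b) = flow tau b.
  by apply/funext => l; rewrite -((step_coefP eps tau r12 hu hbK).1 hstep).
by rewrite e.
Qed.

End OneStep.

Section ErrorBound.
Variables (R : realType) (r eps S M K tau : R) (phi : R -> R[i]) (w : R -> R -> R[i]).
Hypotheses (r12 : 1 / 2 < r) (eps01 : 0 < eps <= 1) (S0 : 0 < S) (MK : M < K).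
Hypothesis w_sol : qnls_solution eps S phi w.
Hypothesis w_bound : forall t, 0 <= t <= S ->
  sobolev (r + 2) (w t) /\ (sobolev_norm (r + 2) (w t) <= M%:E)%E.
Hypothesis tau0 : 0 < tau.

Let x0 := eps * tau * alg_const r * K.
Let d := local_const r M * eps ^+ 2 * tau ^+ 3.
Let gb := gronwall_bound x0 d.

Hypothesis x12 : x0 <= 1 / 2.

Let eps0 : 0 <= eps. Proof. by move: eps01 => /andP[/ltW]. Qed.
Let tau_ge0 : 0 <= tau. Proof. exact: ltW. Qed.
Let M0 : 0 <= M.
Proof.
have [_ h] := w_bound (introT andP (conj (lexx 0) (ltW S0))).
exact: sobolev_norm_bound_ge0 h.
Qed.
Let K0 : 0 <= K. Proof. exact: le_trans M0 (ltW MK). Qed.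
Let A0 : 0 <= alg_const r. Proof. exact/ltW/alg_const_gt0. Qed.
Let x00 : 0 <= x0. Proof. by rewrite /x0; nonneg. Qed.
Let d0 : 0 <= d.
Proof.
have c0 := local_const_ge0 r12 M0.
by rewrite /d; apply: mulr_ge0; [nonneg|apply: exprn_ge0].
Qed.

Let in_time n : n%:R * tau <= S -> 0 <= n%:R * tau <= S.
Proof. by move=> ->; rewrite mulr_ge0. Qed.

Let wcr n : n%:R * tau <= S -> hb r |: w_coef w (n%:R * tau) :| M.
Proof.
have r2 : r <= r + 2 by rewrite lerDl.
by move=> /in_time ht; exact: (w_coef_hb w_bound r2 ht).
Qed.

Let error n u := hb r |: fun l => w_coef w (n%:R * tau) l - fourier_coef u l :| (gb n).

Let error0 : error 0 phi.
Proof.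
have [/funext w0 _ _] := w_sol.
have g0 : gb 0 = 0 by rewrite /gb /gronwall_bound !mul0r.
rewrite /error g0; split=> // q uq; rewrite big1 ?sqr_ge0// => l _.
by rewrite mul0r /w_coef w0 subrr cmod0 expr0n mulr0.
Qed.

(** The stability estimate applies because the exact solution satisfies the
    trapezoidal relation up to its local error; rotating back by the linear
    flow preserves the moduli. *)
Let error_step n u v : n.+1%:R * tau <= S ->
  sobolev r u -> (sobolev_norm r u <= K%:E)%E ->
  sobolev r v -> (sobolev_norm r v <= K%:E)%E ->
  slri_step eps tau u v -> error n u -> error n.+1 v.
Proof.
move=> nS su nu sv nv hstep hE.
have nS' : n%:R * tau <= S.
  by rewrite (le_trans _ nS)// ler_wpM2r// ler_nat.
have hu := sobolev_norm_hb nu; have hv := sobolev_norm_hb nv.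
have [_ L2v _] := sv.
have ht := step_twisted r12 hu hv L2v hstep.
have tnE : n%:R * tau + tau = n.+1%:R * tau by rewrite -natr1 mulrDl mul1r.
have tS : n%:R * tau + tau <= S by rewrite tnE.
have t0 : 0 <= n%:R * tau by rewrite mulr_ge0.
have hloc := exact_local_error r12 eps01 S0 w_sol w_bound t0 tau_ge0 tS.
have hw0 := hb_le (wcr nS') (ltW MK).
have hw1 : hb r |: twisted w (n%:R * tau) tau :| K.
  apply: hb_mono (hb_le (wcr nS) (ltW MK)) => l.
  by rewrite cmod_ge0 cmod_twisted tnE/=.
have hb_ : hb r |: flow (- tau) (fourier_coef v) :| K by exact: hb_flow.
have g0 : 0 <= gb n by exact: gronwall_bound_ge0.
have h := stability r12 eps0 tau_ge0 x12 g0 d0 hu hb_ hw0 hw1 ht hloc hE.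
apply: hb_le (gronwall_step n x00 d0).
apply: hb_mono h => l; rewrite cmod_ge0/=.
have -> : twisted w (n%:R * tau) tau l - flow (- tau) (fourier_coef v) l =
    cis (tau * l%:~R ^+ 2) * (w_coef w (n.+1%:R * tau) l - fourier_coef v l).
  by rewrite /twisted /flow tnE mulNr opprK mulrBr.
by rewrite cmodM cmod_cis mul1r.
Qed.

Lemma error_bound W : slri_solution eps tau S r K phi W ->
  forall n, n%:R * tau <= S -> error n (W n).
Proof.
move=> [W0 Wb Wstep]; elim=> [_|n IH nS]; first by rewrite W0.
have nS' : n%:R * tau <= S.
  by rewrite (le_trans _ nS)// ler_wpM2r// ler_nat.
have [s1 n1] := Wb _ nS'; have [s2 n2] := Wb _ nS.
exact: (error_step nS s1 n1 s2 n2 (Wstep n nS) (IH nS')).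
Qed.

Hypothesis gb_small : forall n, n%:R * tau <= S -> gb n <= (K - M) / 2.
Hypothesis ball : (M + K) / 2 + eps * tau * alg_const r * K ^+ 2 <= K.

(** A value with small error has norm at most [(M + K) / 2], which leaves room
    for a step inside the ball of radius [K]; the new value then satisfies the
    error bound of the next time level. *)
Lemma solution_exists : exists W, slri_solution eps tau S r K phi W.
Proof.
have ex u : exists v, hb r |: fourier_coef u :| ((M + K) / 2) ->
    [/\ sobolev r v, (sobolev_norm r v <= K%:E)%E & slri_step eps tau u v].
  have [hu|nhu] := pselect (hb r |: fourier_coef u :| ((M + K) / 2)).
    by have [v hv] := next_value r12 eps0 tau_ge0 hu x12 ball; exists v.
  by exists u.
have [next hnext] := choice ex.
pose W n := iter n next phi.
have near n u : n%:R * tau <= S -> error n u ->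
    hb r |: fourier_coef u :| ((M + K) / 2).
  move=> nS hE; have h := hb_cmodB (wcr nS) hE.
  apply: (hb_le (hb_ext _ h)) => [l|]; first by rewrite opprB addrC subrK.
  by have := gb_small nS; lra.
have [/funext w0 _ _] := w_sol.
have S_in : 0 <= (0 : R) <= S by rewrite lexx ltW.
have inv n : n%:R * tau <= S ->
    [/\ sobolev r (W n), (sobolev_norm r (W n) <= K%:E)%E & error n (W n)].
  elim: n => [_|n IH nS].
    have [[pf L2f _] nf] := w_bound S_in.
    have hf : (sobolev_norm r phi <= M%:E)%E.
      apply/sobolev_normP => //; rewrite -w0.
      have r2 : r <= r + 2 by rewrite lerDl.
      exact: (w_coef_hb w_bound r2 S_in).
    rewrite w0 in pf L2f; split => //.
    + by split => //; rewrite (le_lt_trans hf)// ltry.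
    + by rewrite (le_trans hf)// lee_fin ltW.
  have nS' : n%:R * tau <= S.
    by rewrite (le_trans _ nS)// ler_wpM2r// ler_nat.
  have [s1 n1 e1] := IH nS'; have [s2 n2 st] := hnext _ (near _ _ nS' e1).
  by split => //; exact: (error_step nS s1 n1 s2 n2 st e1).
exists W; split => // n nS; first by have [] := inv n nS.
have nS' : n%:R * tau <= S.
  by rewrite (le_trans _ nS)// ler_wpM2r// ler_nat.
have [_ _ e1] := inv n nS'.
by have [] := hnext _ (near _ _ nS' e1).
Qed.

Lemma error_norm W n : slri_solution eps tau S r K phi W -> n%:R * tau <= S ->
  (sobolev_norm r (fun x => (w (n%:R * tau) x - W n x)%R) <= (gb n)%:E)%E.
Proof.
move=> hW nS; have hE := error_bound hW nS.
apply/sobolev_normP; first exact: gronwall_bound_ge0.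
have [_ Wb _] := hW; have [[_ L2W _] _] := Wb _ nS.
have iw := w_cint w_bound (in_time nS).
by apply: hb_ext hE => l; rewrite fourier_coefB//; exact: L2_cint.
Qed.

End ErrorBound.

Theorem theorem2p9 (R : realType) (r T : R) (phi : R -> R[i]) (M K : R) :
  1 / 2 < r -> 0 < T -> M < K ->
  exists tau0 C : R, [/\ 0 < tau0, 0 < C &
    forall (eps : R) (w : R -> R -> R[i]),
      0 < eps <= 1 ->
      qnls_solution eps (T / eps) phi w ->
      (forall t : R, 0 <= t <= T / eps ->
         sobolev (r + 2) (w t) /\ (sobolev_norm (r + 2) (w t) <= M%:E)%E) ->
      forall tau : R, 0 < tau <= tau0 ->
        (exists W : nat -> R -> R[i], slri_solution eps tau (T / eps) r K phi W)
        /\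
        (forall W : nat -> R -> R[i], slri_solution eps tau (T / eps) r K phi W ->
         forall n : nat, n%:R <= (T / eps) / tau ->
           (sobolev_norm r (fun x => (w (n%:R * tau) x - W n x)%R)
              <= (C * eps * tau ^+ 2)%:E)%E)].
Proof.
move=> r12 T0 MK.
(* A negative bound [M] on a norm is contradictory. *)
have [M0|Mneg] := leP 0 M; last first.
  exists 1, 1; split => // eps w /andP[e0 _] _ hM.
  have [_ h] := hM 0 (introT andP (conj (lexx 0) (ltW (divr_gt0 T0 e0)))).
  by have := sobolev_norm_bound_ge0 h; rewrite leNgt Mneg.
have K0 : 0 < K by exact: le_lt_trans MK.
have A0 := alg_const_gt0 r12; have c0 := local_const_ge0 r12 M0.
set A := alg_const r in A0; set c := local_const r M in c0.
have KM : 0 < K - M by rewrite subr_gt0.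
have [A_ge0 K_ge0 T_ge0 KM_ge0] : [/\ 0 <= A, 0 <= K, 0 <= T & 0 <= K - M].
  by split; exact: ltW.
pose C := 2 * c * T * expR (4 * A * K * T) + 1.
have C0 : 0 < C.
  by rewrite ltr_wpDl//; apply: mulr_ge0; [nonneg|exact: expR_ge0].
(* The terms of [Q] ensure, in this order, that [tau <= 1], that a step is a
   contraction, that the error stays below [(K - M) / 2], and that the ball of
   radius [K] is mapped into itself. *)
pose Q := 1 + 2 * A * K + 2 * C / (K - M) + 2 * A * K ^+ 2 / (K - M).
have q1 : 0 <= 2 * A * K by nonneg.
have C_ge0 := ltW C0.
have q2 : 0 <= 2 * C / (K - M) by apply: divr_ge0 => //; nonneg.
have q3 : 0 <= 2 * A * K ^+ 2 / (K - M).
  by apply: divr_ge0 => //; nonneg.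
have Q0 : 0 < Q by rewrite /Q; lra.
exists Q^-1, C; split => //; first by rewrite invr_gt0.
move=> eps w eps01 w_sol w_bound tau /andP[tau0 tauQ].
have /andP[e0 e1] := eps01.
have S0 : 0 < T / eps by exact: divr_gt0.
have tQ : tau * Q <= 1 by rewrite -ler_pdivlMr// div1r.
have t0 := ltW tau0; have eps_ge0 := ltW e0.
have small q : 0 <= q -> q <= Q -> tau * q <= 1.
  by move=> _ qQ; rewrite (le_trans _ tQ)// ler_wpM2l.
have b0 : tau * 1 <= 1 by apply: small => //; rewrite /Q; lra.
have b1 : tau * (2 * A * K) <= 1 by apply: small => //; rewrite /Q; lra.
have b2 : tau * (2 * C) <= K - M.
  rewrite -[leRHS]mul1r -ler_pdivrMr// -[leLHS]mulrA; apply: small => //; rewrite /Q; lra.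
have b3 : tau * (2 * A * K ^+ 2) <= K - M.
  rewrite -[leRHS]mul1r -ler_pdivrMr// -[leLHS]mulrA; apply: small => //; rewrite /Q; lra.
have ele (y : R) : 0 <= y -> eps * y <= y by move=> y0; rewrite ler_piMl.
have x12 : eps * tau * A * K <= 1 / 2.
  have := ele (tau * (2 * A * K)) (mulr_ge0 t0 q1); lra.
pose x0 := eps * tau * A * K; pose d := c * eps ^+ 2 * tau ^+ 3.
have gbC n : n%:R * tau <= T / eps ->
    gronwall_bound x0 d n <= C * eps * tau ^+ 2.
  rewrite ler_pdivlMr// => nS.
  have hX : n%:R * (4 * x0) <= 4 * A * K * T.
    have : 4 * A * K * (n%:R * tau * eps) <= 4 * A * K * T.
      by apply: ler_wpM2l => //; nonneg.
    by rewrite /x0; lra.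
  have hD : n%:R * (2 * d) <= 2 * c * T * (eps * tau ^+ 2).
    have : 2 * c * (eps * tau ^+ 2) * (n%:R * tau * eps) <= 2 * c * (eps * tau ^+ 2) * T.
      by apply: ler_wpM2l => //; nonneg.
    by rewrite /d; lra.
  have x00 : 0 <= x0 by rewrite /x0; nonneg.
  have d0 : 0 <= d by rewrite /d; apply: mulr_ge0; [nonneg|exact: exprn_ge0].
  apply: (le_trans (gronwall_bound_le x00 d0 hX hD)).
  have : 0 <= eps * tau ^+ 2 by nonneg.
  by rewrite /C; lra.
have gb_small n : n%:R * tau <= T / eps -> gronwall_bound x0 d n <= (K - M) / 2.
  move=> nS; apply: (le_trans (gbC n nS)).
  have h1 : eps * (C * tau ^+ 2) <= C * tau ^+ 2.
    by apply: ele; nonneg.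
  have h2 : tau * (C * tau) <= 1 * (C * tau).
    by apply: ler_wpM2r; [nonneg|lra].
  by lra.
have ball : (M + K) / 2 + eps * tau * A * K ^+ 2 <= K.
  have q : 0 <= tau * (2 * A * K ^+ 2) by nonneg.
  by have := ele _ q; lra.
split; first exact: (solution_exists r12 eps01 S0 MK w_sol w_bound tau0 x12 gb_small ball).
move=> W hW n; rewrite ler_pdivlMr// => nS.
apply: (le_trans (error_norm r12 eps01 S0 MK w_sol w_bound tau0 x12 hW nS)).
by rewrite lee_fin gbC.
Qed.
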